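(* Let $j,k \in \mathbb{N}_0$ and $\varepsilon >0$, and for each $s \in (0,\infty)$ let $\phi_s \in \Phi_\varepsilon$ with $\overline{\phi}_s \leq 1- \varepsilon$. Suppose that $$\lim_{s \to \infty} \mathbb{E}\, D_{\leq j}(G(\mathcal{P}_s,\phi_s)) = \alpha \in (0,\infty).$$ Then, as $s \to \infty$, $$D_j(G(\mathcal{P}_s,\phi_s)) \stackrel{\mathcal{D}}{\longrightarrow} Z_\alpha \quad\text{and}\quad D_j(G(\mathcal{X}_{\lfloor s \rfloor},\phi_{\lfloor s \rfloor})) \stackrel{\mathcal{D}}{\longrightarrow} Z_\alpha,$$ and also $$D_{\leq j-1}(G(\mathcal{P}_s,\phi_s)) \stackrel{P}{\longrightarrow} 0 \quad\text{and}\quad D_{\leq j-1}(G(\mathcal{X}_{\lfloor s \rfloor},\phi_{\lfloor s \rfloor})) \stackrel{P}{\longrightarrow} 0,$$ and moreover $$\mathbb{E}[ D_k(G(\mathcal{P}_s,\phi_s)) ] = \Theta((\log s)^{k-j}),$$ and if also $k >j$ then $$\frac{ D_k(G(\mathcal{P}_s,\phi_s)) - \mathbb{E}[ D_k(G(\mathcal{P}_s,\phi_s)) ] }{ \sqrt{ \mathbb{E}[ D_k(G(\mathcal{P}_s,\phi_s)) ] } } \stackrel{\mathcal{D}}{\longrightarrow} \mathcal{N}.$$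
   Context: $(\mathbb{X},\mathcal{F},\mu)$ is an arbitrary probability space. $\Phi$ is the class of all measurable symmetric functions $\phi:\mathbb{X}\times\mathbb{X}\to[0,1]$ (connection functions), and $\overline{\phi} := \sup_{x,y}\phi(x,y)$; $\overline{\phi}_s$ denotes $\overline{\phi}$ for $\phi=\phi_s$. For $\varepsilon>0$, $\Phi_\varepsilon$ is the class of all $\phi\in\Phi$ with $$\inf_{x\in\mathbb{X}} \int_{\mathbb{X}}\phi(x,y)\,\mu(dy) \ \geq\ \varepsilon \sup_{x\in\mathbb{X}}\int_{\mathbb{X}}\phi(x,y)\,\mu(dy).$$ Let $X_1,X_2,\ldots$ be independent random elements of $\mathbb{X}$ with common distribution $\mu$. For $n\in\mathbb{N}$, $\mathcal{X}_n=\{X_1,\ldots,X_n\}$ (binomial point process). For real $s>0$, $\mathcal{P}_s$ is the Poisson point process $\{X_1,\ldots,X_{N}\}$, where $N$ is Poisson with mean $s$, independent of $(X_i)$; it has mean measure $s\mu$. (Points are counted with multiplicity, i.e. vertices are distinguished by their index $i$.) For $\phi\in\Phi$ and a finite collection $\mathcal{V}$ of points of $\mathbb{X}$ (possibly with multiplicity), $G(\mathcal{V},\phi)$ is the random undirected graph with vertex set $\mathcal{V}$ in which each pair $\{x,y\}$ of points of $\mathcal{V}$ is joined by an edge with probability $\phi(x,y)$, independently of all other pairs; $G(\mathcal{P}_s,\phi)$ and $G(\mathcal{X}_n,\phi)$ are obtained in this way conditionally on the point process. For a graph $G$ and $j\in\mathbb{N}_0=\mathbb{N}\cup\{0\}$,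 $D_j(G)$ is the number of vertices of degree $j$ in $G$, $D_{\leq j}(G):=\sum_{i=0}^j D_i(G)$, and $D_{\leq -1}(G):=0$. $Z_\alpha$ is a Poisson random variable with parameter $\alpha$; $\mathcal{N}$ is a standard normal random variable; $\stackrel{\mathcal{D}}{\longrightarrow}$ and $\stackrel{P}{\longrightarrow}$ denote convergence in distribution and in probability. For positive functions, $u(s)=O(v(s))$ means $\limsup_{s\to\infty}u(s)/v(s)<\infty$, and $u(s)=\Theta(v(s))$ means $u(s)=O(v(s))$ and $v(s)=O(u(s))$. *)

(* Defs.v *)
From HB Require Import structures.
From mathcomp Require Import all_boot all_order all_algebra.
From mathcomp Require Import all_classical all_reals all_analysis.

Set Implicit Arguments.
Unset Strict Implicit.
Unset Printing Implicit Defensive.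

Import Order.TTheory GRing.Theory Num.Theory.
Import numFieldNormedType.Exports.

Local Open Scope classical_set_scope.
Local Open Scope ring_scope.

(* In the degree counts, [g] is a graph on the vertices [0, ..., n - 1]; its
   values at indices [>= n] are ignored. *)
Definition degree (n : nat) (g : rel nat) (i : nat) : nat :=
  #|[pred l : 'I_n | g i l]|.

Definition num_deg (n : nat) (g : rel nat) (j : nat) : nat :=
  #|[pred i : 'I_n | degree n g i == j]|.

(* Vertices of degree [< j]: D_{<= j} is [num_deg_lt n g j.+1] and D_{<= j - 1}
   is [num_deg_lt n g j], which is 0 when [j = 0]. *)
Definition num_deg_lt (n : nat) (g : rel nat) (j : nat) : nat :=
  (\sum_(i < j) num_deg n g i)%N.

Section connection_functions.
Context d (T : measurableType d) (R : realType).
Implicit Types phi : T -> T -> R.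

Record connection_function phi : Prop := ConnectionFunction {
  connection_measurable :
    measurable_fun [set: T * T] (fun p : T * T => phi p.1 p.2);
  connection_sym : forall x y, phi x y = phi y x;
  connection_itv : forall x y, 0 <= phi x y <= 1 }.

Definition connection_sup phi : R := sup (range (fun p : T * T => phi p.1 p.2)).

Definition mean_connection (mu : probability T R) phi (x : T) : R :=
  \int[mu]_y phi x y.

Definition Phi_class (mu : probability T R) (eps : R) phi : Prop :=
  connection_function phi /\
  eps * sup (range (mean_connection mu phi))
    <= inf (range (mean_connection mu phi)).

End connection_functions.

Section random_graphs.
Context dO d (Omega : measurableType dO) (T : measurableType d) (R : realType).
Variable P : probability Omega R.
Implicit Types (X : nat -> {RV P >-> T}) (N : Omega -> nat).

(* The sigma-algebra on Omega generated by the X i with i in I. *)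
Definition sigma_gen X (I : set nat) : set (set Omega) :=
  <<s [set X i @^-1` A | i in I & A in measurable] >>.

Definition iid_with_law (mu : probability T R) X : Prop :=
  (forall i (A : set T), measurable A -> P (X i @^-1` A) = mu A) /\
  (forall n (A : nat -> set T), (forall i, measurable (A i)) ->
    P (\bigcap_(i in `I_n) (X i @^-1` A i))
      = (\prod_(i < n) P (X i @^-1` A i))%E).

Definition poisson_distributed (s : R) (N : {RV P >-> nat}) : Prop :=
  forall m, P (N @^-1` [set m]) = (poisson_pmf s m)%:E.

Definition independent_of_seq (N : {RV P >-> nat}) X : Prop :=
  forall m B, sigma_gen X setT B ->
    P (N @^-1` [set m] `&` B) = (P (N @^-1` [set m]) * P B)%E.

(* [G] is the random graph on the points X_0, ..., X_{N-1} with connection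
   function phi: given N and X_0, ..., X_{N-1}, the edges {i, l} are present
   independently with probabilities phi (X_i, X_l).  The last clause says this
   through the defining property of the conditional probability of each edge
   configuration [e], tested on the events {N = n} `&` F with F in
   sigma(X_0, ..., X_{n-1}); only the values [e i l] with i < l matter. *)
Record random_connection_graph X N (phi : T -> T -> R)
    (G : Omega -> rel nat) : Prop := RandomConnectionGraph {
  graph_sym : forall w, symmetric (G w);
  graph_irr : forall w, irreflexive (G w);
  graph_measurable : forall i l, measurable [set w | G w i l];
  graph_edges : forall n (F : set Omega) (e : rel 'I_n),
    sigma_gen X `I_n F ->
    P (N @^-1` [set n] `&` F `&`
       [set w | forall i l : 'I_n, (i < l)%N -> G w i l = e i l]) =
    (\int[P]_(w in N @^-1` [set n] `&` F)
      (\prod_(i < n) \prod_(l < n | (i < l)%N)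
         (if e i l then phi (X i w) (X l w)
          else 1 - phi (X i w) (X l w)))%:E)%E }.

(* D_j and D_{< j} of the graph with N vertices, as real random variables. *)
Definition D N (G : Omega -> rel nat) (j : nat) (w : Omega) : R :=
  (num_deg (N w) (G w) j)%:R.

Definition Dlt N (G : Omega -> rel nat) (j : nat) (w : Omega) : R :=
  (num_deg_lt (N w) (G w) j)%:R.

Definition cvg_in_distribution (Y : R -> Omega -> R) 
    (Q : probability (measurableTypeR R) R) :=
  forall r : R, {for r, continuous (fun t : R => Q `]-oo, t]%classic)} ->
    P [set w | Y s w <= r] @[s --> +oo] --> Q `]-oo, r]%classic.

Definition cvg_in_probability (Y : R -> Omega -> R) (c : R) :=
  forall delta : R, 0 < delta ->
    P [set w | delta < `|Y s w - c|] @[s --> +oo] --> 0%E.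

End random_graphs.

Section poisson_law.
Context (R : realType).

Definition nat_to_real (n : nat) : measurableTypeR R := n%:R.

Let measurable_nat_to_real : measurable_fun [set: nat] nat_to_real.
Proof. by []. Qed.

HB.instance Definition _ :=
  isMeasurableFun.Build _ _ nat (measurableTypeR R) nat_to_real measurable_nat_to_real.

(* The nat argument of [poisson_prob] is a dummy. *)
Definition poisson_law (a : R) : probability (measurableTypeR R) R :=
  distribution (poisson_prob a 0) nat_to_real.

End poisson_law.

(* Main.v *)
(** By the Mecke formula the mean number of vertices of degree [k] in
    [G(P_s, phi_s)] is [lam k = s \int pi_k(x) mu(dx)], where [pi_k(x)] is the
    Poisson probability of [k] at [s p(x)] and [p(x) = \int phi_s(x, y) mu(dy)].
    Convergence of [E D_{<= j}], together with the comparability of all values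
    of [p], forces [s p(x) = Theta(log s)] uniformly in [x]; hence [lam k] is
    of order [(log s)^(k - j)].

    The law of [W = D_k] is compared with the Poisson law by Stein's method.
    Given a root [x] with neighbourhood [S], the vertices outside [S] form a
    Poisson process independent of [S], thinned by [1 - phi(x, .)], and [W] can
    differ from the count in the graph they induce only if some vertex in [S],
    or adjacent to [S], has at most [k] neighbours outside [S].  Since
    [phi <= 1 - eps], thinning retains a fraction [eps] of every
    neighbourhood, and a Chernoff bound makes this event have probability
    [O(s^(-c))] up to powers of [log s]; the approximation error therefore
    vanishes even after multiplication by [lam k].  If [lam k] tends to
    infinity, the central limit theorem for the Poisson law finishes the proof.

    For the binomial process, adding one vertex changes the law of [D_k] by an
    amount controlled by the probability that a vertex of degree at most [k]
    is the new vertex or one of its neighbours; summing over the [O(sqrt n)]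
    typical deviations of a Poisson variable of mean [n] gives an error that
    tends to [0]. *)

(* No point process is built: a Poisson expectation is the Poisson average over [n] of an integral
   over [n] independent points, and the independence of the neighbours and the non-neighbours of a
   root becomes the factorisation of a Poisson average of binomial convolutions.

   Stein's method asks for [E[W f(W)]] to be close to [lam k * E[f(W + 1)]]. The left side is an
   average over a root [x] of degree [k]. The right side has no root, so a virtual one is placed at
   [x], with a neighbourhood of arbitrary size. Off the bad event both counts reduce to the graph on
   the non-neighbours of [x], and the normalised mean over that graph is the same in the two cases.
   Hence a sup bound on the Stein solution is enough, and crude constants do: the error is a
   negative power of [s], against powers of [log s]. *)
Require Import Defs.
From HB Require Import structures.
From mathcomp Require Import all_boot all_order all_algebra.
From mathcomp Require Import all_classical all_reals all_analysis.
From mathcomp Require Import measurable_realfun ring lra.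

Set Implicit Arguments.
Unset Strict Implicit.
Unset Printing Implicit Defensive.

Import Order.TTheory GRing.Theory Num.Theory.
Import numFieldNormedType.Exports.

Local Open Scope classical_set_scope.
Local Open Scope ring_scope.

(** * Integrals of bounded measurable functions *)

Section bounded_measurable.
Context d (T : measurableType d) (R : realType).
Implicit Types (f g : T -> R) (P : probability T R).

(** Such functions are integrable for every probability and closed under the operations below, which
    settles the integrability side conditions throughout. *)
Definition bm f := measurable_fun [set: T] f /\ exists M, forall x, `|f x| <= M.

Lemma bm_integrable P f : bm f -> P.-integrable setT (EFin \o f).
Proof.
move=> [mf [M fM]]; apply: measurable_bounded_integrable => //.
  exact: (le_lt_trans (probability_le1 P measurableT) (ltry _)).
exists M; split; first exact: num_real.
by move=> x Mx y _ /=; rewrite (le_trans (fM y))// ltW.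
Qed.

Lemma bm_cst c : bm (fun=> c).
Proof. by split; [exact: measurable_cst | exists `|c| => x]. Qed.

Lemma bmD f g : bm f -> bm g -> bm (fun x => f x + g x).
Proof.
move=> [mf [M fM]] [mg [N gN]]; split; first exact: measurable_funD.
by exists (M + N) => x; rewrite (le_trans (ler_normD _ _))// lerD.
Qed.

Lemma bmN f : bm f -> bm (fun x => - f x).
Proof.
move=> [mf [M fM]]; split; first exact: measurableT_comp.
by exists M => x; rewrite normrN.
Qed.

Lemma bmB f g : bm f -> bm g -> bm (fun x => f x - g x).
Proof. by move=> bf bg; apply: bmD => //; exact: bmN. Qed.

Lemma bmM f g : bm f -> bm g -> bm (fun x => f x * g x).
Proof.
move=> [mf [M fM]] [mg [N gN]]; split; first exact: measurable_funM.
by exists (M * N) => x; rewrite normrM ler_pM.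
Qed.

Lemma bmX f n : bm f -> bm (fun x => f x ^+ n).
Proof.
move=> bf; elim: n => [|n ih]; first exact: bm_cst.
by under eq_fun do rewrite exprS; exact: bmM.
Qed.

Lemma bm_sum (I : Type) (r : seq I) (Q : pred I) (h : I -> T -> R) :
  (forall i, bm (h i)) -> bm (fun x => \sum_(i <- r | Q i) h i x).
Proof.
move=> bh; elim: r => [|i r ih].
  by under eq_fun do rewrite big_nil; exact: bm_cst.
case Qi: (Q i); under eq_fun do rewrite big_cons Qi; [exact: bmD|exact: ih].
Qed.

Lemma bm_prod (I : Type) (r : seq I) (Q : pred I) (h : I -> T -> R) :
  (forall i, bm (h i)) -> bm (fun x => \prod_(i <- r | Q i) h i x).
Proof.
move=> bh; elim: r => [|i r ih].
  by under eq_fun do rewrite big_nil; exact: bm_cst.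
case Qi: (Q i); under eq_fun do rewrite big_cons Qi; [exact: bmM|exact: ih].
Qed.

Lemma bm_if (b : bool) f g : bm f -> bm g -> bm (fun x => if b then f x else g x).
Proof. by case: b. Qed.

Lemma RintD P f g : bm f -> bm g ->
  \int[P]_x (f x + g x) = \int[P]_x f x + \int[P]_x g x.
Proof. by move=> bf bg; rewrite RintegralD//; exact: bm_integrable. Qed.

Lemma RintB P f g : bm f -> bm g ->
  \int[P]_x (f x - g x) = \int[P]_x f x - \int[P]_x g x.
Proof. by move=> bf bg; rewrite RintegralB//; exact: bm_integrable. Qed.

Lemma RintZ P f c : bm f -> \int[P]_x (c * f x) = c * \int[P]_x f x.
Proof. by move=> bf; rewrite RintegralZl//; exact: bm_integrable. Qed.

Lemma RintZr P f c : bm f -> \int[P]_x (f x * c) = \int[P]_x f x * c.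
Proof. by move=> bf; rewrite RintegralZr//; exact: bm_integrable. Qed.

Lemma Rint_cst P c : \int[P]_x (fun=> c) x = c.
Proof.
rewrite Rintegral_cst// -[RHS]mulr1; congr (_ * _).
exact: (congr1 fine (probability_setT P)).
Qed.

Lemma Rint_le P f g : bm f -> bm g -> (forall x, f x <= g x) ->
  \int[P]_x f x <= \int[P]_x g x.
Proof.
by move=> bf bg fg; apply: le_Rintegral => //; exact: bm_integrable.
Qed.

Lemma Rint_ge0 P f : (forall x, 0 <= f x) -> 0 <= \int[P]_x f x.
Proof. by move=> f0; exact: Rintegral_ge0. Qed.

Lemma Rint_norm P f : bm f -> `|\int[P]_x f x| <= \int[P]_x `|f x|.
Proof. by move=> bf; apply: le_normr_Rintegral => //; exact: bm_integrable. Qed.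

Lemma Rint_sum P (I : Type) (r : seq I) (Q : pred I) (h : I -> T -> R) :
  (forall i, bm (h i)) ->
  \int[P]_x (\sum_(i <- r | Q i) h i x) = \sum_(i <- r | Q i) \int[P]_x h i x.
Proof.
move=> bh; elim: r => [|i r ih].
  under eq_Rintegral do rewrite big_nil.
  by rewrite big_nil -[RHS](Rint_cst P 0).
rewrite big_cons; case Qi: (Q i); under eq_Rintegral do rewrite big_cons Qi.
  by rewrite RintD ?ih//; exact: bm_sum.
exact: ih.
Qed.

Lemma Rint_le_cst P f c : bm f -> (forall x, f x <= c) -> \int[P]_x f x <= c.
Proof.
move=> bf fc; rewrite -[leRHS](Rint_cst P c).
by apply: Rint_le => //; exact: bm_cst.
Qed.

Lemma Rint_ge_cst P f c : bm f -> (forall x, c <= f x) -> c <= \int[P]_x f x.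
Proof.
move=> bf fc; rewrite -[leLHS](Rint_cst P c).
by apply: Rint_le => //; exact: bm_cst.
Qed.

Lemma EFin_Rint P f : bm f -> ((\int[P]_x f x)%:E = \int[P]_x (f x)%:E)%E.
Proof.
move=> bf; rewrite /Rintegral fineK//.
by apply: integrable_fin_num => //; exact: bm_integrable.
Qed.

End bounded_measurable.

Lemma bm_comp d d' (T : measurableType d) (T' : measurableType d')
    (R : realType) (f : T -> R) (g : T' -> T) :
  bm f -> measurable_fun setT g -> bm (fun x => f (g x)).
Proof.
move=> [mf [M fM]] mg; split; first exact: (measurableT_comp mf mg).
by exists M => x.
Qed.

Section bounded_fubini.
Context d d' (T : measurableType d) (T' : measurableType d') (R : realType).
Variables (m : probability T R) (m' : probability T' R).
Variable f : T * T' -> R.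
Hypothesis bf : bm f.

Let intf : (m \x m')%E.-integrable setT (EFin \o f).
Proof. exact: bm_integrable. Qed.

Let bm_section x : bm (fun y => f (x, y)).
Proof. by apply: (bm_comp bf); exact: pair1_measurable. Qed.

Lemma bm_Rint : bm (fun x => \int[m']_y f (x, y)).
Proof.
split.
  rewrite (_ : (fun x => _) =
      fine \o (fun x => \int[m']_y (f (x, y))%:E)%E); last by [].
  apply: measurableT_comp => //.
  exact: (measurable_fubini_F intf).
have [_ [M fM]] := bf; exists M => x.
apply: le_trans (Rint_norm _ _) _ => //.
apply: Rint_le_cst => //.
have [mg [N gN]] := bm_section x; split; first exact: measurableT_comp.
by exists N => y; rewrite normr_id.
Qed.

Lemma Rint_prod :
  \int[(m \x m')%E]_z f z = \int[m]_x \int[m']_y f (x, y).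
Proof.
apply: EFin_inj; rewrite [LHS]EFin_Rint// [RHS]EFin_Rint; last exact: bm_Rint.
rewrite -(integral12_prod_meas1 intf); apply: eq_integral => x _.
by rewrite [RHS]EFin_Rint.
Qed.

End bounded_fubini.

Lemma Rint_distribution d d' (T : measurableType d) (T' : measurableType d')
    (R : realType) (P : probability T R) (X : {RV P >-> T'}) (f : T' -> R) :
  bm f -> \int[distribution P X]_y f y = \int[P]_x f (X x).
Proof.
move=> bf; rewrite /Rintegral (@integral_distribution _ _ _ _ _ P X)//.
  by case: bf => mf _; exact/measurable_EFinP.
by apply: (bm_integrable P (f := f \o X)); apply: (bm_comp bf).
Qed.

Lemma eq_Rint_measure d (T : measurableType d) (R : realType)
    (P Q : probability T R) (f : T -> R) :
  (forall A, measurable A -> P A = Q A) -> \int[P]_x f x = \int[Q]_x f x.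
Proof.
by move=> PQ; rewrite /Rintegral; congr fine; apply: eq_measure_integral => A mA _; exact: PQ.
Qed.

(** * Laws of finitely many independent points *)

Section tuple_measure.
Context d (T : measurableType d) (R : realType).

Definition box n (A : 'I_n -> set T) : set (n.-tuple T) :=
  [set t | forall i, A i (tnth t i)].

Lemma box_bigcap n (A : 'I_n -> set T) :
  box A = \bigcap_(i in setT) ((@tnth n T)^~ i @^-1` A i).
Proof. by apply/seteqP; split=> t /= h i; [move=> _|]; exact: h. Qed.

Lemma measurable_box n (A : 'I_n -> set T) :
  (forall i, measurable (A i)) -> measurable (box A).
Proof.
move=> mA; rewrite box_bigcap.
apply: fin_bigcap_measurable => [|i _]; first exact: finite_finset.
by rewrite -[X in measurable X]setTI; exact: measurable_tnth.
Qed.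

(** Boxes are stable under intersection, include the whole space and generate the product
    sigma-algebra. *)
Lemma box_measure_unique n (m1 m2 : probability (n.-tuple T) R) :
  (forall A : 'I_n -> set T, (forall i, measurable (A i)) ->
     m1 (box A) = m2 (box A)) ->
  forall B, measurable B -> m1 B = m2 B.
Proof.
move=> m12 B mB.
pose G := [set box A | A in [set A : 'I_n -> set T | forall i, measurable (A i)]].
apply: (@g_sigma_algebra_measure_unique _ R _ G _ (fun=> setT)) => //.
- by move=> _ [A mA <-]; exact: measurable_box.
- by move=> _; exists (fun=> setT) => [//|]; apply/seteqP; split.
- by apply/seteqP; split => // x _; exists 0%N.
- move=> _ _ [A mA <-] [A' mA' <-]; exists (fun i => A i `&` A' i) => [i|].
    exact: measurableI.
  apply/seteqP; split => [t h|t [h1 h2] i].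
    by split => i; have [] := h i.
  by split.
- by move=> _ [A mA <-]; exact: m12.
- by move=> _; exact: (le_lt_trans (probability_le1 m1 measurableT) (ltry _)).
- apply: (smallest_sub _ _ mB); first exact: smallest_sigma_algebra.
  rewrite -bigcup_seq => C [i _] [A mA <-]; apply: sub_sigma_algebra.
  (* A cylinder over one coordinate is a box whose other sides are full. *)
  exists (fun l => if l == i then A else setT) => [l|]; first by case: ifP.
  apply/seteqP; split => [t /(_ i)|t [_ At] l]; first by rewrite eqxx.
  by case: eqP => // ->.
Qed.

Definition ins n (u : 'I_n.+1) (x : T) (t : n.-tuple T) : n.+1.-tuple T :=
  [tuple if unlift u i is Some l then tnth t l else x | i < n.+1].

Lemma tnth_ins n (u : 'I_n.+1) x (t : n.-tuple T) : tnth (ins u x t) u = x.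
Proof. by rewrite tnth_mktuple unlift_none. Qed.

Lemma tnth_ins_lift n (u : 'I_n.+1) x (t : n.-tuple T) i :
  tnth (ins u x t) (lift u i) = tnth t i.
Proof. by rewrite tnth_mktuple liftK. Qed.

Definition ins_pair n (u : 'I_n.+1) (p : T * n.-tuple T) := ins u p.1 p.2.

Lemma measurable_ins n (u : 'I_n.+1) : measurable_fun setT (ins_pair u).
Proof.
apply/measurable_fun_tnthP => i.
rewrite (_ : _ \o _ = fun p : T * n.-tuple T =>
   if unlift u i is Some l then tnth p.2 l else p.1); last first.
  by apply/funext => p /=; rewrite tnth_mktuple.
case: unliftP => [l _|_]; last exact: measurable_fst.
apply: (measurableT_comp (f := fun t => tnth t l)); first exact: measurable_tnth.
exact: measurable_snd.
Qed.

HB.instance Definition _ n (u : 'I_n.+1) := isMeasurableFun.Build _ _ _ _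
  (ins_pair u) (@measurable_ins n u).

Variable mu : probability T R.

(** The recursion puts the new point in front; by [Rint_ins] every position gives the same integral,
    so any vertex can serve as root. *)
Fixpoint mpow n : probability (n.-tuple T) R :=
  if n is m.+1 then
    distribution (mu \x mpow m)%E (@ins_pair m ord0)
  else \d_[tuple].

Lemma ins_box n (u : 'I_n.+1) (A : 'I_n.+1 -> set T) :
  @ins_pair n u @^-1` box A =
  A u `*` box (fun i => A (lift u i)).
Proof.
apply/seteqP; split => [[x t] /= h|[x t] /= [Ax h] i].
  split => /= [|i]; first by have := h u; rewrite tnth_ins.
  by have := h (lift u i); rewrite tnth_ins_lift.
by case: (unliftP u i) => [l ->|->]; rewrite ?tnth_ins ?tnth_ins_lift//; exact: h.
Qed.

Lemma mpow_box n (A : 'I_n -> set T) : (forall i, measurable (A i)) ->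
  mpow n (box A) = (\prod_(i < n) mu (A i))%E.
Proof.
elim: n A => [|n ih] A mA.
  by rewrite big_ord0 /= diracE (_ : _ \in _)//; apply/mem_set => -[].
rewrite /= /distribution /pushforward ins_box product_measure1E//; last first.
  exact: measurable_box.
by rewrite big_ord_recl; congr (_ * _)%E; exact: ih.
Qed.

(** Wherever the point is inserted, a box gets the product of the measures of its sides, and
    [box_measure_unique] applies. *)
Lemma Rint_ins n (u : 'I_n.+1) (f : n.+1.-tuple T -> R) : bm f ->
  \int[mpow n.+1]_t f t = \int[mu]_x \int[mpow n]_t f (ins u x t).
Proof.
move=> bf.
have bf' : bm (fun p => f (ins_pair u p)).
  by apply: (bm_comp bf); exact: measurable_ins.
rewrite -(Rint_prod _ _ bf') -(Rint_distribution _ bf).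
apply: eq_Rint_measure; apply: box_measure_unique => A mA.
rewrite mpow_box// (bigD1_ord u)//=.
transitivity ((mu \x mpow n)%E (ins_pair u @^-1` box A)); last by [].
rewrite ins_box product_measure1E//; last exact: measurable_box.
by congr (_ * _)%E; apply/esym; exact: mpow_box.
Qed.

Lemma bm_tnth n (i : 'I_n) (f : T -> R) : bm f -> bm (fun t : n.-tuple T => f (tnth t i)).
Proof. by move=> bf; apply: (bm_comp bf); exact: measurable_tnth. Qed.

Lemma Rint_mpow_prod n (h : 'I_n -> T -> R) : (forall i, bm (h i)) ->
  \int[mpow n]_t (\prod_i h i (tnth t i)) = \prod_i \int[mu]_x h i x.
Proof.
elim: n h => [|n ih] h bh.
  under eq_Rintegral do rewrite big_ord0.
  by rewrite big_ord0 Rint_cst.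
rewrite (Rint_ins ord0); last by apply: bm_prod => i; exact: bm_tnth.
under eq_Rintegral do under eq_Rintegral do rewrite big_ord_recl tnth_ins.
rewrite big_ord_recl -ih// -RintZr//; apply: eq_Rintegral => x _.
rewrite -RintZ; last by apply: bm_prod => i; exact: bm_tnth.
by apply: eq_Rintegral => t _; congr (_ * _); apply: eq_bigr => i _; rewrite tnth_ins_lift.
Qed.

End tuple_measure.

(** * Poisson sums *)

Section poisson_sums.
Variables (R : realType) (s : R).
Hypothesis s0 : 0 < s.

Local Notation w := (poisson_pmf s).

Lemma poisson_pmfE n : w n = s ^+ n / n`!%:R * expR (- s).
Proof. by rewrite /poisson_pmf s0. Qed.

Let w0 n : 0 <= w n. Proof. exact: poisson_pmf_ge0. Qed.

(** Extended-real valued, so that nonnegative series can be manipulated before they are known to be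
    finite. *)
Definition pmean (a : nat -> R) : \bar R :=
  (\sum_(0 <= n <oo) (w n * a n)%:E)%E.

Implicit Types a b : nat -> R.

Lemma eq_pmean a b : a =1 b -> pmean a = pmean b.
Proof. by move=> ab; apply: eq_eseriesr => n _; rewrite ab. Qed.

Let wa0 a : (forall n, 0 <= a n) -> forall n, (0 <= (w n * a n)%:E)%E.
Proof. by move=> a0 n; rewrite lee_fin mulr_ge0. Qed.

Lemma pmean_ge0 a : (forall n, 0 <= a n) -> (0 <= pmean a)%E.
Proof. by move=> a0; apply: nneseries_ge0 => n _ _; exact: wa0. Qed.

Lemma le_pmean a b : (forall n, 0 <= a n) -> (forall n, a n <= b n) ->
  (pmean a <= pmean b)%E.
Proof.
move=> a0 ab; apply: lee_nneseries => n _; first by move=> _; exact: wa0.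
by rewrite lee_fin ler_wpM2l.
Qed.

Lemma pmeanD a b : (forall n, 0 <= a n) -> (forall n, 0 <= b n) ->
  (pmean (fun n => (a n + b n)%R) = pmean a + pmean b)%E.
Proof.
move=> a0 b0; rewrite -nneseriesD; [|by move=> n _ _; exact: wa0..].
by apply: eq_eseriesr => n _; rewrite mulrDr EFinD.
Qed.

Lemma pmeanZ c a : (forall n, 0 <= a n) ->
  (pmean (fun n => (c * a n)%R) = c%:E * pmean a)%E.
Proof.
move=> a0; rewrite -nneseriesZl; last by move=> n _; exact: wa0.
by apply: eq_eseriesr => n _; rewrite mulrCA EFinM.
Qed.

Lemma pmean_cst c : pmean (fun=> c) = c%:E.
Proof.
have h1 : pmean (fun=> 1) = 1%E.
  have := @probability_setT _ _ _ (poisson_prob s 0).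
  rewrite /= /poisson_prob s0 -nneseries_esumT; last by move=> n; rewrite lee_fin; exact: w0.
  by move=> <-; apply: eq_eseriesr => n _; rewrite mulr1.
rewrite -[RHS]mule1 -h1 -pmeanZ//.
by apply: eq_pmean => n; rewrite mulr1.
Qed.

Lemma pmean_le_cst c a : (forall n, 0 <= a n) -> (forall n, a n <= c) ->
  (pmean a <= c%:E)%E.
Proof. by move=> a0 ac; rewrite -(pmean_cst c); exact: le_pmean. Qed.

(** From [n * w n = s * w n.-1]. Together with [GmeanS] this gives the Mecke formula
    [Pmean_shift]. *)
Lemma pmean_shift a : (forall n, 0 <= a n) ->
  (pmean (fun n => (n%:R * a n)%R) = s%:E * pmean (fun n => a n.+1))%E.
Proof.
move=> a0; rewrite -pmeanZ// /pmean nneseries_recl//; last first.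
  by move=> n _; rewrite lee_fin mulr_ge0// mulr_ge0.
rewrite mul0r mulr0 add0e -(nneseries_addn 1)//; last first.
  by move=> n; rewrite lee_fin mulr_ge0// mulr_ge0.
apply: eq_eseriesr => n _; rewrite addn1 !poisson_pmfE factS natrM exprS.
congr EFin; field; rewrite pnatr_eq0 -lt0n fact_gt0 /=.
by rewrite nat1r pnatr_eq0.
Qed.

(** Since ['C(n, i) * w n = expR s * w i * w (n - i)]: a Poisson number of points split into two
    classes gives two independent Poisson numbers, up to normalisation. *)
Lemma pmean_conv a b : (forall n, 0 <= a n) -> (forall n, 0 <= b n) ->
  (pmean (fun n => (\sum_(i < n.+1) 'C(n, i)%:R * (a i * b (n - i)%N))%R) =
   (expR s)%:E * pmean a * pmean b)%E.
Proof.
move=> a0 b0.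
pose c n i : \bar R := if (i <= n)%N then (expR s * (w i * a i) * (w (n - i)%N * b (n - i)%N))%:E else 0%E.
have c0 n i : (0 <= c n i)%E.
  by rewrite /c; case: ifP => // _; rewrite lee_fin !mulr_ge0 ?expR_ge0.
transitivity (\sum_(0 <= n <oo) \sum_(0 <= i <oo) c n i)%E.
  apply: eq_eseriesr => n _.
  rewrite (nneseries_split 0 n.+1)// add0n.
  rewrite [X in (_ + X)%E](_ : _ = 0%E) ?adde0; last first.
    rewrite -(nneseries_addn n.+1)//; apply: eseries0 => i _ _.
    by rewrite /c leqNgt leq_addl.
  rewrite big_distrr /= -sumEFin big_mkord; apply: eq_bigr => i _.
  have iN : (i <= n)%N by rewrite -ltnS.
  rewrite /c iN; congr EFin; rewrite !poisson_pmfE.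
  have -> : 'C(n, i)%:R = n`!%:R / (i`!%:R * (n - i)`!%:R) :> R.
    by rewrite -(bin_fact iN) !natrM mulfK// mulf_neq0// pnatr_eq0 -lt0n fact_gt0.
  have -> : s ^+ n = s ^+ i * s ^+ (n - i) by rewrite -exprD subnKC.
  have -> : expR s = (expR (- s))^-1 by rewrite expRN invrK.
  field; rewrite !pnatr_eq0 -!lt0n !fact_gt0 /= gt_eqF ?expR_gt0//.
rewrite nneseries_interchange//.
transitivity (\sum_(0 <= i <oo) ((expR s * (w i * a i))%:E * pmean b))%E.
  apply: eq_eseriesr => i _.
  rewrite (nneseries_split 0 i)// add0n.
  rewrite big_nat_cond big1 ?add0e; last first.
    by move=> n /andP[/andP[_ ni] _]; rewrite /c leqNgt ni.
  rewrite -(nneseries_addn i)// -nneseriesZl; last by move=> n _; exact: wa0.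
  by apply: eq_eseriesr => n _; rewrite /c leq_addl addnK EFinM.
have : (0 <= pmean b)%E by exact: pmean_ge0.
(* A constant comes out of the series only if it is finite. When [pmean b] is infinite both sides
   are infinite, unless [pmean a] is 0, and then every term vanishes. *)
rewrite /pmean; case: (\sum_(0 <= n <oo) (w n * b n)%:E)%E => [r| |] // r0.
- transitivity (\sum_(0 <= i <oo) ((r * expR s)%:E * (w i * a i)%:E))%E.
    by apply: eq_eseriesr => i _; rewrite -!EFinM; congr EFin; ring.
  rewrite nneseriesZl; last by move=> i _; exact: wa0.
  by rewrite EFinM -muleA muleC.
- have [/eqP z|] := eqVneq (pmean a) 0%E; last first.
    move=> an0; have ap : (0 < pmean a)%E by rewrite lt_def an0 pmean_ge0.
    have [i ai] : exists i, 0 < w i * a i.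
      apply: contrapT => /forallNP h; move: an0; rewrite /pmean eseries0 ?eqxx// => i _ _.
      by congr EFin; apply/eqP; rewrite eq_le mulr_ge0// andbT leNgt; apply/negP/h.
    rewrite gt0_muley//; last by rewrite mule_gt0// lte_fin expR_gt0.
    apply: (@nneseries_pinfty _ _ _ i) => // [n _|].
      by rewrite mule_ge0// lee_fin mulr_ge0 ?expR_ge0// mulr_ge0.
    by rewrite gt0_muley// lte_fin mulr_gt0 ?expR_gt0.
  have z' : (\sum_(0 <= n <oo) (w n * a n)%:E)%E = 0%E by exact/eqP.
  rewrite z' mule0 mul0e; apply: eseries0 => i _ _.
  suff -> : w i * a i = 0 by rewrite mulr0 mul0e.
  apply/eqP; rewrite eq_le mulr_ge0// andbT.
  suff : ((w i * a i)%:E <= 0)%E by rewrite lee_fin.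
  rewrite -z'.
  rewrite (nneseriesD1 (n := i))//; last by move=> n _; exact: wa0.
  by rewrite leeDl// nneseries_ge0// => n _ _; exact: wa0.
Qed.

Lemma pmean_delta k c : 0 <= c -> pmean (fun n => if n == k then c else 0) = (w k * c)%:E.
Proof.
move=> c0; rewrite /pmean (nneseriesD1 (n := k))//; last first.
  by move=> n _; rewrite lee_fin mulr_ge0//; case: ifP.
rewrite eqxx eseries0 ?adde0// => n _ /= nk.
by rewrite (negbTE nk) mulr0.
Qed.

(** [pmean_conv] with its first sequence concentrated at [k]: fixing the number of neighbours of a
    root leaves the average over the other points intact. *)
Lemma pmean_binom k a : (forall n, 0 <= a n) ->
  (pmean (fun n => ('C(n, k)%:R * a (n - k)%N)%R) = (s ^+ k / k`!%:R)%:E * pmean a)%E.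
Proof.
move=> a0; have := @pmean_conv (fun i => if i == k then 1 else 0) a _ a0.
rewrite pmean_delta//; have -> : ((expR s)%:E * (w k * 1)%:E = (s ^+ k / k`!%:R)%:E)%E.
  by rewrite -EFinM mulr1 poisson_pmfE expRN mulrC divfK// gt_eqF// expR_gt0.
move=> <-; last by move=> n; case: ifP.
apply: eq_pmean => n.
have [nk|kn] := ltnP n k.
  rewrite bin_small// mul0r big1// => i _; case: eqP => [ik|]; last by rewrite mul0r mulr0.
  by have := ltn_ord i; rewrite ltnS ik leqNgt nk.
rewrite (bigD1 (Ordinal (kn : (k < n.+1)%N)))//= eqxx mul1r big1 ?addr0// => i ik.
rewrite (_ : (_ == k) = false) ?mul0r ?mulr0//.
by apply: contraNF ik => /eqP E; apply/eqP/val_inj.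
Qed.

Lemma pmean_exp u : 0 <= u -> pmean (fun n => u ^+ n) = (expR (s * (u - 1)))%:E.
Proof.
(* For [u > 0] the series is, up to a factor, the total mass of the Poisson law of mean [s * u]; the
   mean 0 is treated apart. *)
rewrite le_eqVlt => /predU1P[<-|u0].
  rewrite (@eq_pmean _ (fun n => if n == 0%N then 1 else 0)); last first.
    by move=> n; rewrite expr0n; case: eqP.
  by rewrite pmean_delta// poisson_pmfE expr0 fact0 sub0r mulrN mulr1 invr1 !mul1r mulr1.
have su0 : 0 < s * u by rewrite mulr_gt0.
have h1 := @probability_setT _ _ _ (poisson_prob (s * u) 0).
move: h1; rewrite /= /poisson_prob su0 -nneseries_esumT; last first.
  by move=> n; rewrite lee_fin poisson_pmf_ge0.
move=> h1; rewrite -[RHS]mule1 -h1 -nneseriesZl; last first.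
  by move=> n _; rewrite lee_fin poisson_pmf_ge0.
apply: eq_eseriesr => n _; rewrite -EFinM poisson_pmfE /poisson_pmf su0.
rewrite mulrBr mulr1 expRD expRN [expR (- _)]expRN exprMn.
congr EFin; field; rewrite !gt_eqF ?expR_gt0// pnatr_eq0 -lt0n fact_gt0.
Qed.

Lemma pmean_nexp u : 0 <= u ->
  pmean (fun n => n%:R * u ^+ n.-1) = (s * expR (s * (u - 1)))%:E.
Proof.
move=> u0; rewrite (pmean_shift (a := fun n => u ^+ n.-1)); last by move=> n; rewrite exprn_ge0.
by rewrite EFinM -pmean_exp.
Qed.

Lemma pmean_nexp' u : 0 <= u ->
  pmean (fun n => n%:R * u ^+ n) = (s * u * expR (s * (u - 1)))%:E.
Proof.
move=> u0; rewrite (pmean_shift (a := fun n => u ^+ n)); last by move=> n; rewrite exprn_ge0.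
rewrite (@eq_pmean _ (fun n => u * u ^+ n)); last by move=> n; rewrite exprS.
rewrite pmeanZ; last by move=> n; rewrite exprn_ge0.
by rewrite pmean_exp// -!EFinM mulrA.
Qed.

Lemma Rint_pmean d (T : measurableType d) (mu : probability T R) (g : nat -> T -> R) :
  (forall n, bm (g n)) -> (forall n x, 0 <= g n x) ->
  pmean (fun n => \int[mu]_x g n x) = (\int[mu]_x pmean (fun n => g n x))%E.
Proof.
move=> bg g0; rewrite /pmean integral_nneseries//; last first.
- by move=> n x _; rewrite lee_fin mulr_ge0.
- move=> n; apply/measurable_EFinP; apply: measurable_funM => //.
  by case: (bg n).
apply: eq_eseriesr => n _; rewrite -RintZ// EFin_Rint//.
by apply: bmM => //; exact: bm_cst.
Qed.

End poisson_sums.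

(** * Random connection graphs on finitely many independent points *)

Local Close Scope classical_set_scope.

(** Indexing by all subsets makes edges unordered and lets an injection of vertices act by direct
    image. Only pairs can be present with positive weight, as [edge_prob] is 0 on all other sets. *)
Notation edges n := {ffun {set 'I_n} -> bool}.

Section bernoulli_field.
Variable R : realType.

Definition bwt (I : finType) (psi : I -> R) (e : {ffun I -> bool}) : R :=
  \prod_i (if e i then psi i else 1 - psi i).

Definition Bern (I : finType) (psi : I -> R) (h : {ffun I -> bool} -> R) : R :=
  \sum_e bwt psi e * h e.

Lemma eq_Bern (I : finType) (psi psi' : I -> R) h h' :
  psi =1 psi' -> h =1 h' -> Bern psi h = Bern psi' h'.
Proof.
move=> pp hh; apply: eq_bigr => e _; rewrite hh; congr (_ * _).
by apply: eq_bigr => i _; rewrite pp.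
Qed.

Lemma Bern_prod (I : finType) (psi : I -> R) (g : I -> bool -> R) :
  Bern psi (fun e => \prod_i g i (e i)) =
  \prod_i (psi i * g i true + (1 - psi i) * g i false).
Proof.
transitivity (\prod_i \sum_(b : bool) (if b then psi i else 1 - psi i) * g i b).
  rewrite bigA_distr_bigA /=; apply: eq_bigr => e _.
  by rewrite /bwt -big_split.
by apply: eq_bigr => i _; rewrite big_bool.
Qed.

Lemma Bern_cst (I : finType) (psi : I -> R) c : Bern psi (fun=> c) = c.
Proof.
rewrite /Bern -big_distrl /= -[RHS]mul1r; congr (_ * _).
have := Bern_prod psi (fun _ _ => 1).
rewrite /Bern [RHS]big1; last by move=> i _; rewrite !mulr1 addrC subrK.
by move=> <-; apply: eq_bigr => e _; rewrite big1 ?mulr1.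
Qed.

Lemma BernD (I : finType) (psi : I -> R) h h' :
  Bern psi (fun e => h e + h' e) = Bern psi h + Bern psi h'.
Proof. by rewrite /Bern -big_split; apply: eq_bigr => e _; rewrite mulrDr. Qed.

Lemma BernZ (I : finType) (psi : I -> R) c h :
  Bern psi (fun e => c * h e) = c * Bern psi h.
Proof. by rewrite /Bern big_distrr; apply: eq_bigr => e _; rewrite mulrCA. Qed.

Lemma Bern_sum (I J : finType) (psi : I -> R) (Q : pred J) (h : J -> _ -> R) :
  Bern psi (fun e => \sum_(j | Q j) h j e) = \sum_(j | Q j) Bern psi (h j).
Proof.
rewrite /Bern exchange_big /=; apply: eq_bigr => e _; by rewrite big_distrr.
Qed.

Lemma bwt_ge0 (I : finType) (psi : I -> R) e :
  (forall i, 0 <= psi i <= 1) -> 0 <= bwt psi e.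
Proof.
move=> p01; apply: prodr_ge0 => i _; have /andP[p0 p1] := p01 i.
by case: ifP => // _; rewrite subr_ge0.
Qed.

Lemma Bern_le (I : finType) (psi : I -> R) h h' :
  (forall i, 0 <= psi i <= 1) -> (forall e, h e <= h' e) ->
  Bern psi h <= Bern psi h'.
Proof. by move=> p01 hh; apply: ler_sum => e _; rewrite ler_wpM2l// bwt_ge0. Qed.

Section split.
Variables (I J1 J2 : finType) (psi : I -> R) (k1 : J1 -> I) (k2 : J2 -> I).
Hypotheses (k1I : injective k1) (k2I : injective k2).
Hypothesis k12 : forall j1 j2, k1 j1 != k2 j2.

Let r1 (e : {ffun I -> bool}) : {ffun J1 -> bool} := [ffun j => e (k1 j)].
Let r2 (e : {ffun I -> bool}) : {ffun J2 -> bool} := [ffun j => e (k2 j)].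

(** Brings a product over [J] to one over [I], each [i] carrying its fibre, which is the shape
    [Bern_prod] expects. *)
Let fib (J : finType) (k : J -> I) (F : I -> J -> R) :
  \prod_j F (k j) j = \prod_i \prod_(j | k j == i) F i j.
Proof.
rewrite (partition_big k predT) //=; apply: eq_bigr => i _.
by apply: eq_bigr => j /eqP ->.
Qed.

Let ind (J : finType) (f a : {ffun J -> bool}) :
  (f == a)%:R = \prod_j (f j == a j)%:R :> R.
Proof.
have [->|/eqP fa] := eqVneq f a; first by rewrite big1// => j _; rewrite eqxx.
have [j fj] : exists j, f j != a j.
  apply/existsP; apply: contra_notT fa => /existsPn h.
  by apply/ffunP => j; apply/eqP; have := h j; rewrite negbK.
by rewrite (bigD1 j)//= (negbTE fj) mul0r.
Qed.

Let Bern_ind a b :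
  Bern psi (fun e => (r1 e == a)%:R * (r2 e == b)%:R) =
  bwt (psi \o k1) a * bwt (psi \o k2) b.
Proof.
pose g i c : R := (\prod_(j | k1 j == i) (c == a j)%:R) *
                  (\prod_(j | k2 j == i) (c == b j)%:R).
transitivity (Bern psi (fun e => \prod_i g i (e i))).
  apply: eq_Bern => // e; rewrite !ind.
  under eq_bigr do rewrite ffunE.
  under [X in _ * X]eq_bigr do rewrite ffunE.
  rewrite (fib k1 (fun i j => (e i == a j)%:R)) (fib k2 (fun i j => (e i == b j)%:R)).
  by rewrite -big_split.
rewrite Bern_prod /bwt /=.
rewrite (fib k1 (fun i j => if a j then psi i else 1 - psi i)).
rewrite (fib k2 (fun i j => if b j then psi i else 1 - psi i)).
rewrite -big_split; apply: eq_bigr => i _ /=; rewrite /g.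
(* An index lies in the image of [k1], in that of [k2] or in neither, and each nonempty fibre is a
   single point. *)
have [/existsP[j1 /eqP i1]|/existsPn n1] := boolP [exists j, k1 j == i].
  have e1 : (fun j => k1 j == i) =1 pred1 j1.
    by move=> j; rewrite /= -i1 (inj_eq k1I).
  have e2 : (fun j => k2 j == i) =1 pred0.
    by move=> j; apply/negbTE; rewrite -i1 eq_sym k12.
  rewrite !(eq_bigl _ _ e1) !big_pred1_eq !(eq_bigl _ _ e2) !big_pred0_eq.
  by case: (a j1) => /=; ring.
have e1 : (fun j => k1 j == i) =1 pred0 by move=> j; apply/negbTE/n1.
rewrite !(eq_bigl _ _ e1) !big_pred0_eq.
have [/existsP[j2 /eqP i2]|/existsPn n2] := boolP [exists j, k2 j == i].
  have e2 : (fun j => k2 j == i) =1 pred1 j2.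
    by move=> j; rewrite /= -i2 (inj_eq k2I).
  rewrite !(eq_bigl _ _ e2) !big_pred1_eq.
  by case: (b j2) => /=; ring.
have e2 : (fun j => k2 j == i) =1 pred0 by move=> j; apply/negbTE/n2.
by rewrite !(eq_bigl _ _ e2) !big_pred0_eq; ring.
Qed.

(** Coordinates over disjoint index sets are independent, and the remaining ones are summed out with
    mass 1. By linearity it is enough to treat indicators of configurations, which is [Bern_ind]. *)
Lemma Bern_split (h : {ffun J1 -> bool} -> {ffun J2 -> bool} -> R) :
  Bern psi (fun e => h [ffun j => e (k1 j)] [ffun j => e (k2 j)]) =
  Bern (psi \o k1) (fun a => Bern (psi \o k2) (h a)).
Proof.
transitivity (Bern psi (fun e => \sum_a \sum_b
    h a b * ((r1 e == a)%:R * (r2 e == b)%:R))).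
  apply: eq_Bern => // e; rewrite (bigD1 (r1 e))//= (bigD1 (r2 e))//= !eqxx.
  rewrite !mulr1 big1 => [|b /negbTE bb]; last by rewrite eq_sym bb !mulr0.
  rewrite addr0 big1 ?addr0// => a /negbTE aa; rewrite big1// => b _.
  by rewrite eq_sym aa mul0r mulr0.
rewrite Bern_sum [RHS]/Bern; apply: eq_bigr => a _.
rewrite Bern_sum /Bern big_distrr; apply: eq_bigr => b _ /=.
rewrite -/(Bern _ _) -[X in X = _]/(Bern psi (fun e => h a b * ((r1 e == a)%:R * (r2 e == b)%:R))).
by rewrite BernZ Bern_ind mulrC mulrA.
Qed.

End split.

End bernoulli_field.

Section graph_expectation.
Context d (T : measurableType d) (R : realType).
Variables (mu : probability T R) (phi : T -> T -> R).
Hypothesis cf : connection_function phi.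

(** The symmetry of [phi] makes the result independent of the ordering that is picked; see
    [edge_probE]. *)
Definition edge_prob n (t : n.-tuple T) (A : {set 'I_n}) : R :=
  if [pick p : 'I_n * 'I_n | (p.1 != p.2) && (A == [set p.1; p.2])]
    is Some p then phi (tnth t p.1) (tnth t p.2) else 0.

Lemma edge_prob01 n (t : n.-tuple T) A : 0 <= edge_prob t A <= 1.
Proof.
rewrite /edge_prob; case: pickP => [p _|_]; first exact: connection_itv cf _ _.
by rewrite lexx ler01.
Qed.

Lemma edge_probE n (t : n.-tuple T) i l : i != l ->
  edge_prob t [set i; l] = phi (tnth t i) (tnth t l).
Proof.
move=> il; rewrite /edge_prob; case: pickP => [[a b] /= /andP[ab /eqP E]|].
  have : a \in [set i; l] by rewrite E set21.
  have : b \in [set i; l] by rewrite E set22.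
  rewrite !inE => /orP[]/eqP be /orP[]/eqP ae; move: ab; rewrite ae be ?eqxx//.
  by move=> _; rewrite (connection_sym cf).
by move=> /(_ (i, l)) /=; rewrite il eqxx.
Qed.

Lemma edge_prob_non n (t : n.-tuple T) A :
  (forall i l, i != l -> A != [set i; l]) -> edge_prob t A = 0.
Proof.
move=> nA; rewrite /edge_prob; case: pickP => // -[a b] /= /andP[ab /eqP E].
by have := nA _ _ ab; rewrite E eqxx.
Qed.

Lemma edge_prob_imset n m (f : 'I_m -> 'I_n) (t : n.-tuple T) (A : {set 'I_m}) :
  injective f ->
  edge_prob t (f @: A) = edge_prob [tuple tnth t (f i) | i < m] A.
Proof.
move=> fI; rewrite [RHS]/edge_prob.
case: pickP => [[a b] /= /andP[ab /eqP ->]|nA].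
  by rewrite imsetU1 imset_set1 edge_probE ?inj_eq// !tnth_mktuple.
apply: edge_prob_non => i l il; apply/eqP => E.
have : i \in f @: A by rewrite E set21.
have : l \in f @: A by rewrite E set22.
case/imsetP => b bA lb /imsetP[a aA ia]; subst i l.
have := nA (a, b) => /=; rewrite -(inj_eq fI) il /=.
move=> /negbT/eqP; apply; apply: (imset_inj fI).
by rewrite E imsetU1 imset_set1.
Qed.

Lemma bm_phi d' (T' : measurableType d') (f g : T' -> T) :
  measurable_fun setT f -> measurable_fun setT g ->
  bm (fun z => phi (f z) (g z)).
Proof.
move=> mf mg; split.
  apply: (@measurableT_comp _ _ _ _ _ _ (fun p : T * T => phi p.1 p.2) _
            (fun z => (f z, g z))); first exact: connection_measurable.
  exact: measurable_fun_pair.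
by exists 1 => z; have /andP[p0 p1] := connection_itv cf (f z) (g z); rewrite ger0_norm.
Qed.

Lemma bm_phi2 x : bm (phi x).
Proof. by apply: bm_phi => //; exact: measurable_cst. Qed.

Lemma bm_edge_prob n A : bm (fun t : n.-tuple T => edge_prob t A).
Proof.
rewrite /edge_prob; case: pickP => [p _|_]; last exact: bm_cst.
by apply: bm_phi; exact: measurable_tnth.
Qed.

Lemma bm_Bern n h : bm (fun t : n.-tuple T => Bern (edge_prob t) h).
Proof.
apply: bm_sum => e; apply: bmM; last exact: bm_cst.
apply: bm_prod => A; apply: bm_if; first exact: bm_edge_prob.
by apply: bmB; [exact: bm_cst|exact: bm_edge_prob].
Qed.

(* Expectation of [h] over the random connection graph on [n] independent
   points, point [v] being weighted by [g v]. *)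
Definition GE n (g : 'I_n -> T -> R) (h : edges n -> R) : R :=
  \int[mpow mu n]_t ((\prod_v g v (tnth t v)) * Bern (edge_prob t) h).

Lemma bm_GE n (g : 'I_n -> T -> R) h : (forall v, bm (g v)) ->
  bm (fun t : n.-tuple T => (\prod_v g v (tnth t v)) * Bern (edge_prob t) h).
Proof.
move=> bg; apply: bmM; last exact: bm_Bern.
by apply: bm_prod => v; exact: bm_tnth.
Qed.

Lemma eq_GE n (g g' : 'I_n -> T -> R) h h' :
  (forall v, g v =1 g' v) -> h =1 h' -> GE g h = GE g' h'.
Proof.
move=> gg hh; apply: eq_Rintegral => t _; congr (_ * _); last exact: eq_Bern.
by apply: eq_bigr => v _; rewrite gg.
Qed.

Section GE_linear.
Variables (n : nat) (g : 'I_n -> T -> R).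
Hypothesis bg : forall v, bm (g v).

Lemma GED h h' : GE g (fun e => h e + h' e) = GE g h + GE g h'.
Proof.
rewrite /GE -RintD; try exact: bm_GE.
by apply: eq_Rintegral => t _; rewrite BernD mulrDr.
Qed.

Lemma GEZ c h : GE g (fun e => c * h e) = c * GE g h.
Proof.
rewrite /GE -RintZ; last exact: bm_GE.
by apply: eq_Rintegral => t _; rewrite BernZ mulrCA.
Qed.

Lemma GE_sum (J : finType) (Q : pred J) (h : J -> _ -> R) :
  GE g (fun e => \sum_(j | Q j) h j e) = \sum_(j | Q j) GE g (h j).
Proof.
rewrite /GE -Rint_sum => [|j]; last exact: bm_GE.
by apply: eq_Rintegral => t _; rewrite Bern_sum big_distrr.
Qed.

Hypothesis g0 : forall v x, 0 <= g v x.

Lemma GE_le h h' : (forall e, h e <= h' e) -> GE g h <= GE g h'.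
Proof.
move=> hh; apply: Rint_le; [exact: bm_GE|exact: bm_GE|move=> t].
rewrite ler_wpM2l ?prodr_ge0//; apply: Bern_le => // A; exact: edge_prob01.
Qed.

Lemma GE_ge0 h : (forall e, 0 <= h e) -> 0 <= GE g h.
Proof.
move=> h0; have := GE_le (h := fun=> 0) h0; apply: le_trans.
by rewrite -[fun=> 0]/(fun e => 0) (@eq_GE _ g g _ (fun e => 0 * 0)) ?GEZ ?mul0r// => e; rewrite mul0r.
Qed.

End GE_linear.

Lemma GE_cst n c : GE (fun (_ : 'I_n) (_ : T) => 1) (fun=> c) = c.
Proof.
rewrite /GE; under eq_Rintegral do rewrite big1// Bern_cst mul1r.
exact: Rint_cst.
Qed.

(** [star] and [del] are the two halves of a graph seen from a root [u]. They involve disjoint sets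
    of pairs, hence are independent given the points. *)
Definition star n (u : 'I_n.+1) (e : edges n.+1) : {set 'I_n} :=
  [set i | e [set u; lift u i]].

Definition del n (u : 'I_n.+1) (e : edges n.+1) : edges n :=
  [ffun A : {set 'I_n} => e (lift u @: A)].

(** Likelihood factor of a vertex at [y] when a root at [x] has neighbourhood [S]. Used as a weight
    in [GE], it replaces conditioning on [S]. *)
Definition nbr_wt n (x : T) (S : {set 'I_n}) (i : 'I_n) (y : T) : R :=
  if i \in S then phi x y else 1 - phi x y.

Lemma bm_nbr_wt n x (S : {set 'I_n}) i : bm (nbr_wt x S i).
Proof.
apply: bm_if; first exact: bm_phi2.
by apply: bmB; [exact: bm_cst|exact: bm_phi2].
Qed.

Lemma nbr_wt_ge0 n x (S : {set 'I_n}) i y : 0 <= nbr_wt x S i y.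
Proof.
rewrite /nbr_wt; have /andP[p0 p1] := connection_itv cf x y.
by case: ifP => // _; rewrite subr_ge0.
Qed.

(** [Bern_split] for the pairs that contain [u] and the sets that avoid it; the configurations of
    the former are then indexed by the neighbourhood [S]. *)
Lemma Bern_ins n (u : 'I_n.+1) x (t : n.-tuple T) (H : {set 'I_n} -> edges n -> R) :
  Bern (edge_prob (ins u x t)) (fun e => H (star u e) (del u e)) =
  \sum_(S : {set 'I_n}) (\prod_i nbr_wt x S i (tnth t i)) * Bern (edge_prob t) (H S).
Proof.
pose k1 (i : 'I_n) := [set u; lift u i].
pose k2 (A : {set 'I_n}) := lift u @: A.
have k1I : injective k1.
  move=> i l /setP /(_ (lift u i)).
  rewrite !inE eqxx orbT => /esym/orP[]/eqP; last exact: lift_inj.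
  by move=> /esym E; have := neq_lift u i; rewrite -E eqxx.
have k2I : injective k2 by apply: imset_inj; exact: lift_inj.
have k12 i A : k1 i != k2 A.
  apply/eqP => /setP /(_ u); rewrite !inE eqxx /= => /esym /imsetP[l _ E].
  by have := neq_lift u l; rewrite -E eqxx.
transitivity (Bern (edge_prob (ins u x t))
  (fun e => H [set i | [ffun i => e (k1 i)] i] [ffun A : {set 'I_n} => e (k2 A)])).
  apply: eq_Bern => // e; congr (H _ _).
  by apply/setP => i; rewrite !inE ffunE.
rewrite (Bern_split _ k1I k2I k12 (fun a b => H [set i | a i] b)).
rewrite {1}/Bern.
rewrite (reindex (fun S : {set 'I_n} => [ffun i => i \in S])) /=; last first.
  exists (fun a : {ffun 'I_n -> bool} => [set i | a i]) => [S _|a _].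
    by apply/setP => i; rewrite inE ffunE.
  by apply/ffunP => i; rewrite ffunE inE.
apply: eq_bigr => S _; congr (_ * _).
  apply: eq_bigr => i _; rewrite ffunE /nbr_wt /= edge_probE ?neq_lift//.
  by rewrite tnth_ins tnth_ins_lift.
apply: eq_Bern => [A|e]; last first.
  by congr (H _ _); apply/setP => i; rewrite inE ffunE.
rewrite /= edge_prob_imset; last exact: lift_inj.
by congr edge_prob; apply: eq_from_tnth => i; rewrite tnth_mktuple tnth_ins_lift.
Qed.

Lemma GE_root n (u : 'I_n.+1) (g : 'I_n.+1 -> T -> R) (H : {set 'I_n} -> edges n -> R) :
  (forall v, bm (g v)) ->
  GE g (fun e => H (star u e) (del u e)) =
  \int[mu]_x (g u x * \sum_(S : {set 'I_n})
     GE (fun i y => g (lift u i) y * nbr_wt x S i y) (H S)).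
Proof.
move=> bg; rewrite /GE (Rint_ins _ u); last exact: bm_GE.
apply: eq_Rintegral => x _.
have bgS S : bm (fun t : n.-tuple T =>
    \prod_v (g (lift u v) (tnth t v) * nbr_wt x S v (tnth t v)) *
      Bern (edge_prob t) (H S)).
  apply: (@bm_GE _ (fun i y => g (lift u i) y * nbr_wt x S i y)) => i.
  by apply: bmM; [exact: bg|exact: bm_nbr_wt].
rewrite -Rint_sum// -RintZ; last exact: bm_sum.
apply: eq_Rintegral => t _.
rewrite (bigD1_ord u)//= tnth_ins -mulrA; congr (_ * _).
rewrite Bern_ins big_distrr /=; apply: eq_bigr => S _.
rewrite mulrA big_split /=; congr (_ * _ * _).
by apply: eq_bigr => i _; rewrite tnth_ins_lift.
Qed.

Lemma bm_GE_nbr n (g : 'I_n -> T -> R) (S : {set 'I_n}) h :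
  (forall v, bm (g v)) -> bm (fun x => GE (fun i y => g i y * nbr_wt x S i y) h).
Proof.
move=> bg; apply: (@bm_Rint _ _ _ _ _ mu (mpow mu n) (fun p : T * n.-tuple T =>
  \prod_v (g v (tnth p.2 v) * nbr_wt p.1 S v (tnth p.2 v)) * Bern (edge_prob p.2) h)).
apply: bmM; last by apply: (bm_comp (@bm_Bern n h)).
apply: bm_prod => i; apply: bmM.
  apply: (bm_comp (bg i)); apply: (measurableT_comp (f := (@tnth n T)^~ i)) => //.
  exact: measurable_tnth.
have bphi : bm (fun p : T * n.-tuple T => phi p.1 (tnth p.2 i)).
  apply: bm_phi => //; apply: (measurableT_comp (f := (@tnth n T)^~ i)) => //.
  exact: measurable_tnth.
by apply: bm_if => //; apply: bmB => //; exact: bm_cst.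
Qed.

(** Given the position of the root, the other vertices contribute independently, so the sum over [S]
    is an expanded product of one-vertex integrals. The Chernoff bounds below all come from this
    formula. *)
Lemma GE_star n (u : 'I_n.+1) (g : 'I_n.+1 -> T -> R) (h : 'I_n -> bool -> R) :
  (forall v, bm (g v)) ->
  GE g (fun e => \prod_i h i (i \in star u e)) =
  \int[mu]_x (g u x * \prod_i \int[mu]_y
     (g (lift u i) y * (phi x y * h i true + (1 - phi x y) * h i false))).
Proof.
move=> bg; rewrite (GE_root u (fun S _ => \prod_i h i (i \in S)) bg).
apply: eq_Rintegral => x _; congr (_ * _).
rewrite /GE -Rint_sum; last first.
  move=> S; apply: (@bm_GE _ (fun i y => g (lift u i) y * nbr_wt x S i y)) => i.
  by apply: bmM; [exact: bg|exact: bm_nbr_wt].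
rewrite -(@Rint_mpow_prod _ _ _ mu n (fun i y =>
    g (lift u i) y * (phi x y * h i true + (1 - phi x y) * h i false))); last first.
  move=> i; apply: bmM => //; apply: bmD; apply: bmM; try exact: bm_cst.
    exact: bm_phi2.
  by apply: bmB; [exact: bm_cst|exact: bm_phi2].
apply: eq_Rintegral => t _.
under [LHS]eq_bigr do rewrite Bern_cst -big_split /=.
under [RHS]eq_bigr do rewrite mulrDr.
rewrite bigA_distr; apply: eq_bigr => S _; apply: eq_bigr => i _.
by rewrite /nbr_wt; case: ifP => _; rewrite -mulrA.
Qed.

End graph_expectation.

(** * Degrees, and the effect of deleting a neighbourhood *)

Section degrees.
Local Open Scope nat_scope.

(** The vertex [v] may lie outside [B]: [bad] needs the degree into [~: S] of vertices of [S]
    too. *)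
Definition deg n (B : {set 'I_n}) (e : edges n) (v : 'I_n) : nat :=
  #|[set l in B | (l != v) && e [set v; l]]|.

Definition Dk k n (B : {set 'I_n}) (e : edges n) : nat :=
  #|[set v in B | deg B e v == k]|.

(* The number of vertices of degree [k] once a vertex with neighbourhood [S]
   has been added. *)
Definition DkR (k : nat) n (S : {set 'I_n}) (e : edges n) : nat :=
  (#|S| == k) + #|[set v | deg [set: _] e v + (v \in S) == k]|.

Lemma card_lift n (u : 'I_n.+1) (Q : pred 'I_n.+1) :
  #|[set l | Q l]| = Q u + #|[set i | Q (lift u i)]|.
Proof.
rewrite -!sum1_card big_mkcond (bigD1_ord u)//= [in RHS]big_mkcond.
congr (_ + _); first by rewrite inE; case: (Q u).
by apply: eq_bigr => i _; rewrite !inE.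
Qed.

Lemma deg_star n (u : 'I_n.+1) (B : {set 'I_n.+1}) (e : edges n.+1) :
  deg B e u = #|[set i in star u e | lift u i \in B]|.
Proof.
rewrite /deg (card_lift u) /= eqxx /= andbF add0n; congr #|pred_of_set _|.
by apply/setP => i; rewrite !inE eq_sym neq_lift /= andbC.
Qed.

Lemma deg_lift n (u : 'I_n.+1) (e : edges n.+1) v :
  deg [set: _] e (lift u v) = deg [set: _] (del u e) v + (v \in star u e).
Proof.
rewrite /deg (card_lift u) /= finset.in_setT neq_lift /= addnC; congr (_ + _).
  congr #|pred_of_set _|; apply/setP => i; rewrite !inE (inj_eq (@lift_inj _ u)).
  by rewrite ffunE imsetU1 imset_set1.
by rewrite inE finset.setUC.
Qed.

Lemma Dk_ins (k : nat) n (u : 'I_n.+1) (e : edges n.+1) :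
  Dk k [set: _] e = DkR k (star u e) (del u e).
Proof.
rewrite /Dk (card_lift u) /DkR /= finset.in_setT /= deg_star; congr (nat_of_bool (_ == _) + _).
  by apply: eq_card => i; rewrite !inE andbT.
by apply: eq_card => i; rewrite !inE /= deg_lift !inE.
Qed.

(* The event on which deleting [S] may change the number of vertices of degree
   [k]: compare [nbad_Dk] and [nbad_DkR]. *)
Definition bad (k : nat) n (S : {set 'I_n}) (e : edges n) : bool :=
  [exists v in S, deg (~: S) e v <= k] ||
  [exists v in ~: S, (deg (~: S) e v <= k) && [exists y in S, e [set v; y]]].

Lemma leq_deg n (B B' : {set 'I_n}) e v : B \subset B' -> deg B e v <= deg B' e v.
Proof.
by move=> /fintype.subsetP BB'; apply/subset_leq_card/fintype.subsetP => l; rewrite !inE => /andP[/BB' -> ->].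
Qed.

(** Off the bad event a vertex of [S] has more than [k] neighbours outside [S] and never counts,
    while a vertex outside [S] either has more than [k] such neighbours or loses none when [S] is
    deleted. The bit [b] stands for an edge to the root, possible only inside [S]. *)
Lemma nbad_status (k : nat) n (S : {set 'I_n}) e v (b : bool) : ~~ bad k S e -> b <= (v \in S) ->
  (deg [set: _] e v + b == k) = (v \notin S) && (deg (~: S) e v == k).
Proof.
rewrite negb_or => /andP[/exists_inPn n1 /exists_inPn n2] bS.
have dle : deg (~: S) e v <= deg [set: _] e v by apply: leq_deg; exact: finset.subsetT.
have [vS|vS] /= := boolP (v \in S).
  have := n1 _ vS; rewrite -ltnNge => kd; apply/negbTE; rewrite gtn_eqF//.
  by rewrite (leq_trans kd)// (leq_trans dle)// leq_addr.
move: bS; rewrite (negbTE vS) leqn0 => /eqP ->; rewrite addn0.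
have := n2 v; rewrite inE vS => /(_ isT); rewrite negb_and -ltnNge.
move=> /orP[kd|/exists_inPn nS].
  by rewrite !gtn_eqF// (leq_trans kd).
congr (_ == _); congr #|pred_of_set _|; apply/setP => l; rewrite !inE.
have [lS|//] := boolP (l \in S).
by have := nS _ lS; move/negbTE ->; rewrite andbF.
Qed.

Lemma nbad_Dk (k : nat) n (S : {set 'I_n}) e : ~~ bad k S e ->
  Dk k [set: _] e = Dk k (~: S) e.
Proof.
move=> nb; apply: eq_card => v; rewrite !inE -[deg [set: _] e v]addn0.
by rewrite (@nbad_status k n S e v false).
Qed.

Lemma nbad_DkR (k : nat) n (S : {set 'I_n}) e : #|S| = k -> ~~ bad k S e ->
  DkR k S e = (Dk k (~: S) e).+1.
Proof.
move=> Sk nb; rewrite /DkR Sk eqxx add1n; congr _.+1; apply: eq_card => v.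
by rewrite !inE (@nbad_status k n S e v (v \in S)) ?inE.
Qed.

Lemma deg_imset m n (f : 'I_m -> 'I_n) (e : edges n) v : injective f ->
  deg (f @: [set: _]) e (f v) = deg [set: _] [ffun A : {set 'I_m} => e (f @: A)] v.
Proof.
move=> fI; rewrite /deg -(card_imset _ fI); apply: eq_card => l.
apply/idP/imsetP; rewrite !inE.
  move=> /andP[/imsetP[i _ ->]]; rewrite (inj_eq fI) => /andP[iv ei].
  by exists i => //; rewrite !inE iv ffunE imsetU1 imset_set1.
move=> [i]; rewrite !inE ffunE imsetU1 imset_set1 => /and3P[_ iv ei] ->.
by rewrite (inj_eq fI) iv ei imset_f.
Qed.

Lemma Dk_imset k m n (f : 'I_m -> 'I_n) (e : edges n) : injective f ->
  Dk k (f @: [set: _]) e = Dk k [set: _] [ffun A : {set 'I_m} => e (f @: A)].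
Proof.
move=> fI; rewrite /Dk -(card_imset _ fI); apply: eq_card => l.
apply/idP/imsetP; rewrite !inE.
  move=> /andP[/imsetP[i _ ->]]; rewrite deg_imset// => di.
  by exists i => //; rewrite !inE.
move=> [i]; rewrite !inE => di ->.
by rewrite imset_f// deg_imset// di.
Qed.

Lemma Dk_sum k n (e : edges n) :
  Dk k [set: _] e = \sum_(v < n) (deg [set: _] e v == k).
Proof.
rewrite /Dk -sum1_card big_mkcond; apply: eq_bigr => v _.
by rewrite !inE; case: eqP.
Qed.

End degrees.

(* Chernoff's bound: the indicator of [deg <= k] is at most [th ^ (deg - k)]. *)
Lemma deg_le_prod (R : realType) k n (u : 'I_n.+1) (B : {set 'I_n.+1}) (th : R)
    (e : edges n.+1) : 0 < th -> th <= 1 ->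
  ((deg B e u <= k)%N)%:R <=
  (th ^- k) * \prod_i (if (lift u i \in B) && (i \in star u e) then th else 1).
Proof.
move=> th0 th1.
rewrite -big_mkcond /= prodr_const.
have -> : #|[pred i | (lift u i \in B) && (i \in star u e)]| = deg B e u.
  by rewrite deg_star; apply: eq_card => i; rewrite !inE andbC.
case: leqP => [dk|_]; last by rewrite mulr_ge0// ?invr_ge0 exprn_ge0// ltW.
by rewrite mulrC ler_pdivlMr ?exprn_gt0// mul1r ler_wiXn2l// ltW.
Qed.

(** * Restriction to a subset of the vertices *)

Section marginal.
Context d (T : measurableType d) (R : realType).
Variables (mu : probability T R) (phi : T -> T -> R).
Hypothesis cf : connection_function phi.

Definition pick_tuple m n (f : 'I_m -> 'I_n) (t : n.-tuple T) : m.-tuple T :=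
  [tuple tnth t (f i) | i < m].

Lemma measurable_pick_tuple m n (f : 'I_m -> 'I_n) :
  measurable_fun setT (pick_tuple f).
Proof.
apply/measurable_fun_tnthP => i.
rewrite (_ : _ \o _ = (@tnth n T)^~ (f i)); first exact: measurable_tnth.
by apply/funext => t /=; rewrite tnth_mktuple.
Qed.

HB.instance Definition _ m n (f : 'I_m -> 'I_n) := isMeasurableFun.Build _ _ _ _
  (pick_tuple f) (@measurable_pick_tuple m n f).

Lemma Rint_perm n (f : 'I_n -> 'I_n) (h : n.-tuple T -> R) :
  injective f -> bm h ->
  \int[mpow mu n]_t h (pick_tuple f t) = \int[mpow mu n]_t h t.
Proof.
move=> fI bh; rewrite -(@Rint_distribution _ _ _ _ _ (mpow mu n) (pick_tuple f))//.
apply: eq_Rint_measure; apply: box_measure_unique => A mA.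
rewrite mpow_box//.
have [g fg gf] : bijective f by exact: injF_bij.
transitivity (mpow mu n (box (fun i => A (g i)))).
  rewrite /distribution /= /pushforward; congr (mpow mu n _).
  apply/seteqP; split => t /= h1 i; last by rewrite tnth_mktuple -{1}(fg i); exact: h1.
  by have := h1 (g i); rewrite tnth_mktuple gf.
by rewrite mpow_box// [RHS](reindex g)//=; exists f => i _; rewrite ?fg ?gf.
Qed.

(** Induction on [n]: a vertex off the image of [f] is integrated out by [Rint_ins]; once there is
    none, [f] is a permutation and [Rint_perm] applies. *)
Lemma Rint_pick m n (f : 'I_m -> 'I_n) (g : 'I_n -> T -> R) (h : m.-tuple T -> R) :
  injective f -> (forall v, bm (g v)) -> bm h ->
  \int[mpow mu n]_t ((\prod_v g v (tnth t v)) * h (pick_tuple f t)) =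
  (\prod_(v | v \notin f @: [set: _]) \int[mu]_x g v x) *
  \int[mpow mu m]_t ((\prod_i g (f i) (tnth t i)) * h t).
Proof.
elim: n f g => [|n ih] f g fI bg bh.
  have m0 : m = 0%N by case: m f h fI bh => // m f; case: (f ord0).
  subst m; rewrite big_pred0 ?mul1r => [|[]//].
  by apply: eq_Rintegral => t _; rewrite !big_ord0 (tuple0 t) (tuple0 (pick_tuple _ _)).
have [fT|] := boolP (f @: [set: _] == [set: _]).
  have mn : m = n.+1.
    by rewrite -[m]card_ord -[n.+1]card_ord -!cardsT -(eqP fT) card_imset.
  subst m; rewrite big_pred0 ?mul1r => [|v]; last by rewrite (eqP fT) inE.
  rewrite -[RHS](Rint_perm fI); last first.
    by apply: bmM => //; apply: bm_prod => i; exact: bm_tnth.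
  apply: eq_Rintegral => t _; congr (_ * _).
  rewrite (reindex f) /=; last first.
    by apply: onW_bij; exact: injF_bij.
  by apply: eq_bigr => i _; rewrite tnth_mktuple.
rewrite -finset.subTset => /fintype.subsetPn[u _ uf].
have fu i : u != f i by apply: contra uf => /eqP ->; rewrite imset_f.
have [f1 f1E] : exists f1 : 'I_m -> 'I_n, forall i, f i = lift u (f1 i).
  have h1 i : exists l : 'I_n, f i == lift u l.
    by case: (unliftP u (f i)) => [l ->|E]; [exists l|have := fu i; rewrite E eqxx].
  by exists (fun i => xchoose (h1 i)) => i; apply/eqP; exact: xchooseP (h1 i).
have f1I : injective f1 by move=> i l E; apply: fI; rewrite !f1E E.
rewrite (Rint_ins _ u); last first.
  apply: bmM; first by apply: bm_prod => v; exact: bm_tnth.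
  by apply: (bm_comp bh); exact: measurable_pick_tuple.
under eq_Rintegral => x _.
  under eq_Rintegral => t _.
    rewrite (bigD1_ord u)//= tnth_ins -mulrA.
    under eq_bigr do rewrite tnth_ins_lift.
    rewrite (_ : pick_tuple f _ = pick_tuple f1 t); last first.
      by apply: eq_from_tnth => i; rewrite [LHS]tnth_mktuple [RHS]tnth_mktuple f1E tnth_ins_lift.
    over.
  rewrite RintZ; last first.
    apply: bmM; first by apply: bm_prod => v; exact: bm_tnth.
    by apply: (bm_comp bh); exact: measurable_pick_tuple.
  rewrite (ih f1 (fun i => g (lift u i)))//.
  over.
rewrite RintZr// (bigD1_ord u)//= mulrA.
congr (_ * _ * _); last first.
  by apply: eq_Rintegral => t _; congr (_ * _); apply: eq_bigr => i _; rewrite f1E.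
apply: eq_bigl => i; apply/negP/negP; apply: contra_not.
  by move=> /imsetP[l _]; rewrite f1E => /lift_inj ->; rewrite imset_f.
by move=> /imsetP[l _ ->]; apply/imsetP; exists l => //; rewrite f1E.
Qed.

Lemma GE_pick m n (f : 'I_m -> 'I_n) (g : 'I_n -> T -> R) (h : edges m -> R) :
  injective f -> (forall v, bm (g v)) ->
  GE mu phi g (fun e => h [ffun A : {set 'I_m} => e (f @: A)]) =
  (\prod_(v | v \notin f @: [set: _]) \int[mu]_x g v x) *
  GE mu phi (fun i => g (f i)) h.
Proof.
move=> fI bg.
rewrite -(Rint_pick fI bg (bm_Bern cf h)); apply: eq_Rintegral => t _; congr (_ * _).
(* With an empty first family, [Bern_split] sums out every set outside the image. *)
have n12 (j1 : void) (A : {set 'I_m}) : of_void {set 'I_n} j1 != f @: A by case: j1.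
have := @Bern_split R _ _ _ (edge_prob phi t) (of_void _) (fun A : {set 'I_m} => f @: A)
  (fun x => match x with end) (imset_inj fI) n12 (fun _ => h).
rewrite Bern_cst => ->; apply: eq_Bern => // A /=.
by rewrite (edge_prob_imset cf).
Qed.

End marginal.

Lemma prod_if_card (R : realType) (I : finType) (S : {set I}) (a b : R) :
  \prod_l (if l \in S then a else b) = a ^+ #|S| * b ^+ #|~: S|.
Proof.
rewrite (bigID (mem S)) /=; congr (_ * _).
  by rewrite -prodr_const; apply: eq_bigr => l ->.
rewrite -prodr_const; apply: eq_big => l; first by rewrite !inE.
by move=> /negbTE ->.
Qed.

Lemma sum_subset_card (R : realType) n (F : nat -> R) :
  \sum_(S : {set 'I_n}) F #|S| = \sum_(a < n.+1) 'C(n, a)%:R * F a.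
Proof.
have lt S : (#|S : {set 'I_n}| < n.+1)%N by rewrite ltnS -[leqRHS]card_ord max_card.
rewrite (partition_big (fun S => Ordinal (lt S)) predT) //=.
apply: eq_bigr => a _.
rewrite (eq_bigr (fun=> F a)); last by move=> S /eqP <-.
rewrite sumr_const -(mulr_natl (F a)); congr (_%:R * _).
have := card_draws 'I_n a; rewrite card_ord => <-; apply: eq_card => S.
by rewrite !inE.
Qed.

Lemma Rint_swap d d' (T : measurableType d) (T' : measurableType d') (R : realType)
    (m : probability T R) (m' : probability T' R) (f : T -> T' -> R) :
  bm (fun p => f p.1 p.2) ->
  \int[m]_x \int[m']_y f x y = \int[m']_y \int[m]_x f x y.
Proof.
move=> bf.
have bf' : bm (fun p : T' * T => f p.2 p.1).
  by apply: (bm_comp bf (g := fun p => (p.2, p.1))); exact: measurable_swap.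
apply: EFin_inj.
rewrite [LHS]EFin_Rint; last exact: (@bm_Rint _ _ _ _ _ m m' (fun p => f p.1 p.2)).
rewrite [RHS]EFin_Rint; last exact: (@bm_Rint _ _ _ _ _ m' m (fun p => f p.2 p.1)).
transitivity (\int[m]_x \int[m']_y (f x y)%:E)%E.
  apply: eq_integral => x _; rewrite [LHS]EFin_Rint//.
  by apply: (bm_comp bf (g := pair x)); exact: pair1_measurable.
rewrite (@Fubini _ _ _ _ _ m m' (fun p => (f p.1 p.2)%:E)); last exact: bm_integrable.
apply: eq_integral => y _; rewrite [RHS]EFin_Rint//.
by apply: (bm_comp bf' (g := pair y)); exact: pair1_measurable.
Qed.

(** * The graph on the non-neighbours of a root *)

Section thinning.
Context d (T : measurableType d) (R : realType).
Variables (mu : probability T R) (phi : T -> T -> R).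
Hypothesis cf : connection_function phi.

Local Notation p := (mean_connection mu phi).

Let phi01 x y : 0 <= phi x y <= 1. Proof. exact: connection_itv. Qed.
Let phi0 x y : 0 <= phi x y. Proof. by have /andP[] := phi01 x y. Qed.
Let phi1 x y : phi x y <= 1. Proof. by have /andP[] := phi01 x y. Qed.
Let bphi2 x : bm (phi x). Proof. exact: bm_phi2. Qed.

Lemma mean_connection_ge0 x : 0 <= p x.
Proof. exact: Rint_ge0. Qed.

Lemma mean_connection_le1 x : p x <= 1.
Proof. by apply: Rint_le_cst => //; exact: bphi2. Qed.

Lemma bm_mean_connection : bm p.
Proof.
apply: (@bm_Rint _ _ _ _ _ mu mu (fun z => phi z.1 z.2)).
by apply: (bm_phi cf).
Qed.

Lemma Rint_nbr_wt n x (S : {set 'I_n}) i :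
  \int[mu]_y nbr_wt phi x S i y = if i \in S then p x else 1 - p x.
Proof.
rewrite /nbr_wt; case: ifP => // _.
by rewrite RintB ?Rint_cst//; exact: bm_cst.
Qed.

Lemma GE_nbr_wt_cst n x (S : {set 'I_n}) c :
  GE mu phi (nbr_wt phi x S) (fun=> c) = p x ^+ #|S| * (1 - p x) ^+ #|~: S| * c.
Proof.
rewrite /GE; under eq_Rintegral do rewrite Bern_cst.
rewrite RintZr; last by apply: bm_prod => i; apply: bm_tnth; exact: bm_nbr_wt.
rewrite Rint_mpow_prod; last by move=> i; exact: bm_nbr_wt.
congr (_ * _); rewrite -prod_if_card; apply: eq_bigr => i _; exact: Rint_nbr_wt.
Qed.

(** The factors [phi] and [1 - phi] add up to 1 at every vertex: a virtual root at [x] can be added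
    without changing the graph. *)
Lemma sum_GE_nbr_wt n x (h : edges n -> R) :
  \sum_(S : {set 'I_n}) GE mu phi (nbr_wt phi x S) h = GE mu phi (fun _ _ => 1) h.
Proof.
rewrite /GE -Rint_sum; last by move=> S; apply: bm_GE => // i; exact: bm_nbr_wt.
apply: eq_Rintegral => t _; rewrite -big_distrl /=; congr (_ * _).
rewrite [RHS]big1// /nbr_wt -(bigA_distr _ _ (fun i => phi x (tnth t i))
  (fun i => 1 - phi x (tnth t i))) big1// => i _; rewrite /= addrC subrK//.
Qed.

Lemma le_GE_diff n (g : 'I_n -> T -> R) (h h' b : edges n -> R) :
  (forall v, bm (g v)) -> (forall v x, 0 <= g v x) ->
  (forall e, `|h e - h' e| <= b e) ->
  `|GE mu phi g h - GE mu phi g h'| <= GE mu phi g b.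
Proof.
move=> bg g0 hb; rewrite ler_distl; apply/andP; split; last first.
  rewrite -GED//; apply: GE_le => // e.
  by have := hb e; rewrite ler_distl => /andP[].
rewrite lerBlDr -GED//; apply: GE_le => // e.
by have := hb e; rewrite ler_distl lerBlDr => /andP[].
Qed.

Variables (eps pm PM : R).
Hypotheses (eps0 : 0 < eps) (phie : forall x y, phi x y <= 1 - eps).
Hypotheses (pmp : forall x, pm <= p x) (pPM : forall x, p x <= PM).

(** The non-neighbours of the root keep at least [eps * pm] of the neighbourhood of any point, and
    the Chernoff parameter [2^-1] keeps half of that. *)
Definition thin_rate : R := eps * pm / 2.
Local Notation rho x := (1 - p x - thin_rate).

(* The vertices outside the neighbourhood of [x] see [z] with probability at
   least [eps * p z], because [phi x y <= 1 - eps]. *)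
Lemma thin_le x z :
  \int[mu]_y ((1 - phi x y) * (phi z y * 2^-1 + (1 - phi z y) * 1)) <= rho x.
Proof.
rewrite (@eq_Rintegral _ _ _ _ _
  (fun y => (1 - phi x y) - 2^-1 * ((1 - phi x y) * phi z y))); last first.
  by move=> y _ /=; field.
have b1 : bm (fun y => 1 - phi x y) by apply: bmB => //; exact: bm_cst.
have b2 : bm (fun y => (1 - phi x y) * phi z y) by exact: bmM.
have b3 : bm (fun y => 2^-1 * ((1 - phi x y) * phi z y)).
  by apply: bmM => //; exact: bm_cst.
rewrite RintB// RintZ// RintB ?Rint_cst//; last exact: bm_cst.
rewrite lerD2l lerN2 /thin_rate mulrC ler_wpM2l//.
apply: (@le_trans _ _ (\int[mu]_y (eps * phi z y))).
  by rewrite RintZ//; apply: ler_wpM2l; [exact: ltW|exact: pmp].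
apply: Rint_le => // [|y]; first by apply: bmM => //; exact: bm_cst.
by rewrite ler_wpM2r// lerBrDl -lerBrDr phie.
Qed.

Lemma rho_ge0 x : 0 <= rho x.
Proof.
apply: le_trans (thin_le x x); apply: Rint_ge0 => y.
apply: mulr_ge0; first by rewrite subr_ge0.
by apply: addr_ge0; apply: mulr_ge0 => //; rewrite subr_ge0.
Qed.

Let bm_star_int (g : T -> R) a b : bm g ->
  bm (fun z => \int[mu]_y (g y * (phi z y * a + (1 - phi z y) * b))).
Proof.
move=> bg.
apply: (@bm_Rint _ _ _ _ _ mu mu
  (fun z => g z.2 * (phi z.1 z.2 * a + (1 - phi z.1 z.2) * b))).
have bp : bm (fun z : T * T => phi z.1 z.2) by apply: (bm_phi cf).
apply: bmM; first by apply: (bm_comp bg).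
apply: bmD; apply: bmM => //; try exact: bm_cst.
by apply: bmB => //; exact: bm_cst.
Qed.

Let wprod (n : nat) (x : T) (S : {set 'I_n}) l := if l \in S then p x else rho x.

Let wprod_ge0 n x (S : {set 'I_n}) l : 0 <= wprod x S l.
Proof. by rewrite /wprod; case: ifP => _; [exact: mean_connection_ge0|exact: rho_ge0]. Qed.

Variable k : nat.

Let hh n (v : 'I_n.+1) (S : {set 'I_n.+1}) i (b : bool) : R :=
  if (lift v i \in ~: S) && b then 2^-1 else 1.

Let hh_le n (v : 'I_n.+1) (S : {set 'I_n.+1}) i x z :
  \int[mu]_y (nbr_wt phi x S (lift v i) y *
    (phi z y * hh v S i true + (1 - phi z y) * hh v S i false)) <=
  wprod x S (lift v i).
Proof.
rewrite /nbr_wt /hh /wprod inE andbF andbT.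
case: (boolP (lift v i \in S)) => lS /=; last exact: thin_le.
apply: Rint_le => //.
  apply: bmM => //; apply: bmD; apply: bmM; try exact: bm_cst; try exact: bphi2.
  by apply: bmB; [exact: bm_cst|exact: bphi2].
by move=> y; rewrite !mulr1 addrC subrK mulr1.
Qed.

Let hh_ge0 n (v : 'I_n.+1) (S : {set 'I_n.+1}) i b : 0 <= hh v S i b.
Proof. by rewrite /hh; case: ifP. Qed.

Let inner_ge0 n (S : {set 'I_n}) x z l a b : 0 <= a -> 0 <= b ->
  0 <= \int[mu]_y (nbr_wt phi x S l y * (phi z y * a + (1 - phi z y) * b)).
Proof.
move=> a0 b0; apply: Rint_ge0 => y.
by rewrite mulr_ge0 ?nbr_wt_ge0// addr_ge0// mulr_ge0// subr_ge0.
Qed.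

Let half_gt0 : 0 < 2^-1 :> R. Proof. by rewrite invr_gt0. Qed.
Let half_le1 : 2^-1 <= 1 :> R. Proof. by rewrite invf_le1// ler1n. Qed.

(** With [v] as the root of [GE_star], each other vertex of [S] contributes at most [p x] and each
    vertex outside at most [rho x], by [thin_le]; the position of [v] gives the last factor
    [p x]. *)
Lemma GE_deg_nbr n x (S : {set 'I_n}) v : v \in S ->
  GE mu phi (nbr_wt phi x S) (fun e => ((deg (~: S) e v <= k)%N)%:R) <=
  2 ^+ k * (p x ^+ #|S| * rho x ^+ #|~: S|).
Proof.
case: n S v => [S []//|n] S v vS.
have bS i : bm (nbr_wt phi x S i) by exact: bm_nbr_wt.
apply: le_trans.
  apply: GE_le => // [i y|e]; first exact: nbr_wt_ge0.
  exact: (deg_le_prod k v (~: S) e half_gt0 half_le1).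
rewrite GEZ// (GE_star mu cf v (hh v S))// exprVn invrK.
rewrite ler_wpM2l// -prod_if_card (bigD1_ord v)//= vS /=.
rewrite /mean_connection -RintZr//; apply: Rint_le => [||z].
- by apply: bmM => //; apply: bm_prod => i; exact: bm_star_int.
- by apply: bmM => //; exact: bm_cst.
rewrite /nbr_wt vS ler_wpM2l//; apply: ler_prod => i _.
by rewrite inner_ge0//=; exact: hh_le.
Qed.

(** As in [GE_deg_nbr], but the weight of [v], now outside [S], is bounded by 1, whence [.-1], and
    the edge from [v] to [y] brings the factor [PM]. *)
Lemma GE_deg_nbr2 n x (S : {set 'I_n}) v y : v \notin S -> y \in S ->
  GE mu phi (nbr_wt phi x S)
    (fun e => ((deg (~: S) e v <= k)%N)%:R * (e [set v; y]%SET)%:R) <=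
  2 ^+ k * (PM * (p x ^+ #|S| * rho x ^+ #|~: S|.-1)).
Proof.
case: n S v y => [S []//|n] S v y vS yS.
have [i0 yE|yv] := unliftP v y; last by rewrite -yv yS in vS.
have bS i : bm (nbr_wt phi x S i) by exact: bm_nbr_wt.
pose h' i b : R := hh v S i b * (if i == i0 then b%:R else 1).
have h'0 i b : 0 <= h' i b.
  by rewrite /h' mulr_ge0//; case: ifP => // _; case: b.
apply: (@le_trans _ _ (GE mu phi (nbr_wt phi x S)
   (fun e => 2 ^+ k * \prod_i h' i (i \in star v e)))).
  apply: GE_le => // [i z|e]; first exact: nbr_wt_ge0.
  rewrite big_split /= mulrA ler_pM//.
    by have := deg_le_prod k v (~: S) e half_gt0 half_le1; rewrite exprVn invrK.
  by rewrite -big_mkcond big_pred1_eq inE yE.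
rewrite GEZ// (GE_star mu cf v h')// ler_wpM2l//.
pose W := \prod_(i < n | i != i0) wprod x S (lift v i).
have W0 : 0 <= W by rewrite prodr_ge0.
(* In the labels relative to [v], the set [S] keeps its size and its complement loses [v]. *)
have WE : p x ^+ #|S| * rho x ^+ #|~: S|.-1 = p x * W.
  have -> : p x ^+ #|S| * rho x ^+ #|~: S|.-1 =
     \prod_(i < n) (if i \in [set i | lift v i \in S]%SET then p x else rho x).
    rewrite prod_if_card; congr (_ ^+ _ * _ ^+ _).
      transitivity #|[set l | l \in S]%SET|; first by apply: eq_card => l; rewrite inE.
      by rewrite (card_lift v (fun l => l \in S)) (negbTE vS).
    transitivity #|[set l | l \notin S]%SET|.-1; first by congr _.-1; apply: eq_card => l; rewrite !inE.
    by rewrite (card_lift v (fun l => l \notin S)) vS; apply: eq_card => i; rewrite !inE.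
  rewrite (bigD1 i0)//= inE -yE yS; congr (_ * _).
  by apply: eq_bigr => i _; rewrite inE.
rewrite WE mulrA.
apply: (@le_trans _ _ (\int[mu]_z ((\int[mu]_y (phi x y * phi z y)) * W))).
  have bz : bm (fun z => \int[mu]_y (phi x y * phi z y)).
    apply: (@bm_Rint _ _ _ _ _ mu mu (fun z => phi x z.2 * phi z.1 z.2)).
    by apply: bmM; [apply: (bm_comp (bphi2 x)) | apply: (bm_phi cf)].
  apply: Rint_le => [||z].
  - by apply: bmM => //; apply: bm_prod => i; exact: bm_star_int.
  - by apply: bmM => //; exact: bm_cst.
  have pW : \prod_i \int[mu]_y0 (nbr_wt phi x S (lift v i) y0 *
       (phi z y0 * h' i true + (1 - phi z y0) * h' i false)) <=
       \int[mu]_y0 (phi x y0 * phi z y0) * W.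
    rewrite (bigD1 i0)//= ler_pM ?inner_ge0 ?prodr_ge0//.
    - by move=> i _; exact: inner_ge0.
    - rewrite le_eqVlt; apply/orP; left; apply/eqP; apply: eq_Rintegral => y0 _.
      by rewrite /nbr_wt -yE yS /h' eqxx /hh -yE inE yS /= !mulr0 addr0 !mulr1.
    apply: ler_prod => i ii0; rewrite inner_ge0//=.
    by rewrite /h' (negbTE ii0) !mulr1; exact: hh_le.
  apply: le_trans pW; rewrite ler_piMl//.
    by apply: prodr_ge0 => i _; exact: inner_ge0.
  by rewrite /nbr_wt (negbTE vS) gerBl.
have bxz : bm (fun q : T * T => phi x q.2 * phi q.1 q.2).
  by apply: bmM; [apply: (bm_comp (bphi2 x)) | apply: (bm_phi cf)].
rewrite RintZr; last exact: (@bm_Rint _ _ _ _ _ mu mu (fun z => phi x z.2 * phi z.1 z.2)).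
(* Integrating first over the position of [v] turns the edge probability into a value of [p], at
   most [PM]. *)
rewrite ler_wpM2r// (Rint_swap mu mu (f := fun z y => phi x y * phi z y))//.
rewrite /mean_connection -RintZ//; apply: Rint_le.
- apply: (@bm_Rint _ _ _ _ _ mu mu (fun q => phi x q.1 * phi q.2 q.1)).
  by apply: bmM; [apply: (bm_comp (bphi2 x)) | apply: (bm_phi cf)].
- by apply: bmM => //; exact: bm_cst.
move=> z; under eq_Rintegral => w _ do rewrite (connection_sym cf w z).
by rewrite RintZ// mulrC ler_wpM2r//; exact: pPM.
Qed.

Lemma bad_le_sum n (S : {set 'I_n}) (e : edges n) :
  (bad k S e)%:R <= \sum_(v in S) ((deg (~: S) e v <= k)%N)%:R +
    \sum_(v in ~: S) \sum_(y in S)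
       ((deg (~: S) e v <= k)%N)%:R * (e [set v; y]%SET)%:R :> R.
Proof.
have s1 : 0 <= \sum_(v in S) ((deg (~: S) e v <= k)%N)%:R :> R by rewrite sumr_ge0.
have s2 : 0 <= \sum_(v in ~: S) \sum_(y in S)
       ((deg (~: S) e v <= k)%N)%:R * (e [set v; y]%SET)%:R :> R.
  by apply: sumr_ge0 => v _; apply: sumr_ge0 => y _; rewrite mulr_ge0.
rewrite /bad; case: (boolP [exists v in S, _]) => [/exists_inP[v vS dv]|_] /=.
  apply: ler_wpDr => //; rewrite (bigD1 v)//= dv lerDl sumr_ge0//.
case: (boolP [exists v in ~: S, _]) => [|_] /=; last by rewrite addr_ge0.
move=> /exists_inP[v vS /andP[dv /exists_inP[y yS ey]]].
apply: ler_wpDl => //; rewrite (bigD1 v)//= (bigD1 y)//= dv ey mulr1 -addrA lerDl.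
rewrite addr_ge0//; first by apply: sumr_ge0 => z _; rewrite mulr_ge0.
by apply: sumr_ge0 => w _; apply: sumr_ge0 => z _; rewrite mulr_ge0.
Qed.

(** Union bound over the [a] vertices of [S], then over the [a * b] pairs of a vertex in [S] and one
    outside. *)
Definition bad_rate x a b : R :=
  2 ^+ k * (a%:R * (p x ^+ a * rho x ^+ b) +
            (a * b)%:R * (PM * (p x ^+ a * rho x ^+ b.-1))).

Lemma GE_bad n x (S : {set 'I_n}) :
  GE mu phi (nbr_wt phi x S) (fun e => (bad k S e)%:R) <= bad_rate x #|S| #|~: S|.
Proof.
have bS i : bm (nbr_wt phi x S i) by exact: bm_nbr_wt.
have S0 i y : 0 <= nbr_wt phi x S i y by exact: nbr_wt_ge0.
apply: le_trans; first by apply: GE_le => //; exact: bad_le_sum.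
rewrite GED// !GE_sum// /bad_rate mulrDr; apply: lerD.
  rewrite mulrCA mulr_natl -sumr_const.
  by apply: ler_sum => v vS; exact: GE_deg_nbr.
rewrite mulrCA mulnC natrM -mulrA !mulr_natl -sumr_const.
apply: ler_sum => v; rewrite inE => vS; rewrite GE_sum// -sumr_const.
by apply: ler_sum => y yS; exact: GE_deg_nbr2.
Qed.

(** Not normalised: it carries the mass [(1 - p x) ^+ b] of the event that the root misses all [b]
    points. *)
Definition non_nbr_mean (f : nat -> R) b x : R :=
  GE mu phi (fun (_ : 'I_b) y => 1 - phi x y) (fun e => f (Dk k [set: _]%SET e)).

Lemma non_nbr_mean_cst c b x : non_nbr_mean (fun=> c) b x = (1 - p x) ^+ b * c.
Proof.
rewrite /non_nbr_mean -(@eq_GE _ _ _ mu phi _ (nbr_wt phi x finset.set0) _ (fun=> c))//.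
  by rewrite GE_nbr_wt_cst cards0 mul1r finset.setC0 cardsT card_ord.
by move=> v y; rewrite /nbr_wt inE.
Qed.

(** The functional ignores [S], so each vertex of [S] integrates to [p x]; the others are relabelled
    by [enum_val]. *)
Lemma GE_non_nbr n x (S : {set 'I_n}) f :
  GE mu phi (nbr_wt phi x S) (fun e => f (Dk k (~: S) e)) =
  p x ^+ #|S| * non_nbr_mean f #|~: S| x.
Proof.
have bS i : bm (nbr_wt phi x S i) by exact: bm_nbr_wt.
pose ev (i : 'I_#|~: S|) : 'I_n := enum_val i.
have evI : injective ev := @enum_val_inj _ _.
have evS : ev @: [set: _] = ~: S.
  apply/setP => l; apply/imsetP/idP => [[i _ ->]|lS]; first exact: enum_valP.
  by exists (enum_rank_in lS l); rewrite ?inE// /ev enum_rankK_in.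
under eq_GE => [v x0|e].
  over.
  rewrite -{1}evS Dk_imset//. over.
rewrite (GE_pick mu cf (fun e => f (Dk k [set: _]%SET e)) evI bS) evS; congr (_ * _).
  rewrite -prodr_const; apply: eq_big => i; first by rewrite inE negbK.
  by rewrite inE negbK Rint_nbr_wt => ->.
apply: eq_GE => // i y; rewrite /nbr_wt.
by have := enum_valP i; rewrite inE => /negbTE ->.
Qed.

End thinning.

(** * Degree counts with a fixed number of vertices *)

Section vertex_counts.
Context d (T : measurableType d) (R : realType).
Variables (mu : probability T R) (phi : T -> T -> R).
Hypothesis cf : connection_function phi.

Local Notation p := (mean_connection mu phi).

Let phi01 x y : 0 <= phi x y <= 1. Proof. exact: connection_itv. Qed.
Let phi0 x y : 0 <= phi x y. Proof. by have /andP[] := phi01 x y. Qed.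
Let phi1 x y : phi x y <= 1. Proof. by have /andP[] := phi01 x y. Qed.
Let bphi2 x : bm (phi x). Proof. exact: bm_phi2. Qed.
Let bp : bm p. Proof. exact: bm_mean_connection. Qed.

Lemma cardCn n (S : {set 'I_n}) : #|~: S| = (n - #|S|)%N.
Proof. by have := cardsC S; rewrite card_ord => E; rewrite -[X in (X - _)%N]E addKn. Qed.

(* [E f(D_k)] for [n] independent points of law [mu]. *)
Definition Gmean n k (f : nat -> R) : R :=
  GE mu phi (fun (_ : 'I_n) _ => 1) (fun e => f (Dk k [set: _]%SET e)).

Let b1 : bm (fun _ : T => 1 : R). Proof. exact: bm_cst. Qed.

Lemma Gmean_le n k f g : (forall m, f m <= g m) -> Gmean n k f <= Gmean n k g.
Proof. by move=> fg; apply: GE_le => // e; exact: fg. Qed.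

Lemma Gmean_ge0 n k f : (forall m, 0 <= f m) -> 0 <= Gmean n k f.
Proof. by move=> f0; apply: GE_ge0 => // e; exact: f0. Qed.

Lemma Gmean_cst n k c : Gmean n k (fun=> c) = c.
Proof. exact: GE_cst. Qed.

Lemma GmeanD n k f g : Gmean n k (fun m => f m + g m) = Gmean n k f + Gmean n k g.
Proof. by rewrite /Gmean GED. Qed.

Lemma GmeanZ n k c f : Gmean n k (fun m => c * f m) = c * Gmean n k f.
Proof. by rewrite /Gmean GEZ. Qed.

Lemma eq_Gmean n k f g : f =1 g -> Gmean n k f = Gmean n k g.
Proof. by move=> fg; apply: eq_GE => // e; rewrite fg. Qed.

Lemma Gmean0 k f : Gmean 0 k f = f 0%N.
Proof.
rewrite -[RHS](Gmean_cst 0 k); apply: eq_GE => // e; congr f.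
by apply/eqP; rewrite -leqn0 (leq_trans (max_card _))// card_ord.
Qed.

Variable k : nat.

(** Mean of [f (D_k)] on the event that an extra vertex at [x] has degree [k]. *)
Definition root_mean n (f : nat -> R) (x : T) : R :=
  \sum_(S : {set 'I_n} | #|S| == k) GE mu phi (nbr_wt phi x S) (fun e => f (DkR k S e)).

Lemma bm_root_mean n f : bm (root_mean n f).
Proof.
apply: bm_sum => S; have := bm_GE_nbr mu cf S
  (fun e : edges n => f (DkR k S e)) (g := fun _ _ => 1) (fun=> bm_cst _ _).
congr bm; apply/funext => x; apply: eq_GE => // v y; by rewrite mul1r.
Qed.

(** The factor [m] is a sum over the vertices of the indicators of degree [k]; each vertex in turn
    is the root, and all give the same integral. *)
Lemma GmeanS n f : Gmean n.+1 k (fun m => m%:R * f m) =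
  n.+1%:R * \int[mu]_x root_mean n f x.
Proof.
pose H (S : {set 'I_n}) (e : edges n) : R := (#|S| == k)%:R * f (DkR k S e).
transitivity (\sum_(u < n.+1)
    GE mu phi (fun _ _ => 1) (fun e => H (star u e) (del u e))).
  rewrite -GE_sum//; apply: eq_GE => // e.
  rewrite {1}Dk_sum natr_sum big_distrl; apply: eq_bigr => u _ /=.
  rewrite /H -Dk_ins; congr (_%:R * _).
  by rewrite deg_star; congr (nat_of_bool (_ == _)); apply: eq_card => i; rewrite !inE andbT.
under eq_bigr do rewrite (GE_root mu cf _ H)//.
rewrite sumr_const card_ord mulr_natl; congr (_ *+ _).
apply: eq_Rintegral => x _; rewrite mul1r /root_mean [RHS]big_mkcond.
apply: eq_bigr => S _; rewrite /H.
transitivity (GE mu phi (nbr_wt phi x S) (H S)).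
  by apply: eq_GE => // v y; rewrite mul1r.
by rewrite /H (GEZ mu cf); [case: eqP => _; rewrite ?mul1r ?mul0r|move=> v; exact: bm_nbr_wt].
Qed.

Lemma root_mean_cst n x c :
  root_mean n (fun=> c) x = 'C(n, k)%:R * (p x ^+ k * (1 - p x) ^+ (n - k) * c).
Proof.
have := sum_subset_card n (fun a => if a == k then p x ^+ k * (1 - p x) ^+ (n - k) * c else 0).
rewrite -big_mkcond /= => /esym E.
transitivity (\sum_(S : {set 'I_n} | #|S| == k) p x ^+ k * (1 - p x) ^+ (n - k) * c).
  by apply: eq_bigr => S /eqP Sk; rewrite (GE_nbr_wt_cst mu cf) cardCn Sk.
rewrite -E; have [nk|kn] := ltnP n k.
  rewrite bin_small// mul0r big1// => a _; case: eqP => [ak|]; rewrite ?mulr0//.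
  by have := ltn_ord a; rewrite ltnS ak leqNgt nk.
rewrite (bigD1 (Ordinal (kn : (k < n.+1)%N)))//= eqxx big1 ?addr0// => a ak.
by rewrite (_ : (_ == k) = false) ?mulr0//; apply: contraNF ak => /eqP E'; apply/eqP/val_inj.
Qed.

Lemma Gmean_id n : Gmean n.+1 k (fun m => m%:R) =
  n.+1%:R * ('C(n, k)%:R * \int[mu]_x (p x ^+ k * (1 - p x) ^+ (n - k))).
Proof.
rewrite (@eq_Gmean _ _ _ (fun m => m%:R * 1)); last by move=> m; rewrite mulr1.
rewrite (GmeanS n (fun=> 1)); congr (_ * _).
under eq_Rintegral do rewrite root_mean_cst mulr1.
rewrite RintZ//; apply: bmM; apply: bmX => //; apply: bmB => //; exact: bm_cst.
Qed.

Section chernoff.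
Variable th : R.
Hypotheses (th0 : 0 < th) (th1 : th <= 1).

Local Notation mgf z := (1 - (1 - th) * p z).

Let thX0 m : 0 <= th ^- m. Proof. by rewrite invr_ge0 exprn_ge0// ltW. Qed.

Let bm_mgf n : bm (fun z => mgf z ^+ n).
Proof. by apply: bmX; apply: bmB; [exact: bm_cst|apply: bmM => //; exact: bm_cst]. Qed.

Lemma GE_deg_le n (u : 'I_n.+1) :
  GE mu phi (fun _ _ => 1) (fun e => ((deg [set: _]%SET e u <= k)%N)%:R) <=
  th ^- k * \int[mu]_z mgf z ^+ n.
Proof.
pose h (i : 'I_n) (b : bool) := if b then th else 1.
apply: le_trans.
  apply: GE_le => // e; exact: (deg_le_prod k u _ e th0 th1).
rewrite GEZ// ler_wpM2l//.
under eq_GE => [v x|e].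
  over.
  under eq_bigr do rewrite finset.in_setT /=. over.
rewrite (GE_star mu cf u h)// le_eqVlt; apply/orP; left; apply/eqP.
apply: eq_Rintegral => z _; rewrite mul1r.
rewrite -[in RHS](card_ord n) -prodr_const; apply: eq_bigr => i _.
rewrite (@eq_Rintegral _ _ _ _ _ (fun y => 1 - (1 - th) * phi z y)); last first.
  by move=> y _ /=; ring.
by rewrite RintB ?RintZ ?Rint_cst//; apply: bmM => //; exact: bm_cst.
Qed.

(** The known edge contributes a factor [th] of its own, which cancels one of the [k.+1] in the
    Chernoff exponent. *)
Lemma GE_deg_le_edge n (u : 'I_n.+1) (i0 : 'I_n) :
  GE mu phi (fun _ _ => 1) (fun e => ((deg [set: _]%SET e u <= k.+1)%N)%:R *
     (i0 \in star u e)%:R) <=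
  th ^- k * \int[mu]_z (p z * mgf z ^+ n.-1).
Proof.
pose h (i : 'I_n) (b : bool) := (if b then th else 1) * (if i == i0 then b%:R else 1).
apply: (@le_trans _ _ (GE mu phi (fun _ _ => 1)
   (fun e => th ^- k.+1 * \prod_i h i (i \in star u e)))).
  apply: GE_le => // e; rewrite big_split /= mulrA ler_pM//.
    apply: le_trans (deg_le_prod k.+1 u [set: _]%SET e th0 th1) _.
    by rewrite le_eqVlt; apply/orP; left; apply/eqP; congr (_ * _); apply: eq_bigr => i _; rewrite finset.in_setT.
  by rewrite -big_mkcond big_pred1_eq.
rewrite GEZ// exprS invfM -mulrA mulrCA ler_wpM2l//.
rewrite (GE_star mu cf u h)// ler_pdivrMl//.
rewrite -RintZ; last by apply: bmM => //; exact: bm_mgf.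
rewrite le_eqVlt; apply/orP; left; apply/eqP.
apply: eq_Rintegral => z _; rewrite mul1r (bigD1 i0)//= mulrA; congr (_ * _).
  rewrite /h eqxx /mean_connection -RintZ//; apply: eq_Rintegral => y _ /=; ring.
have -> : n.-1 = #|predC1 i0| by rewrite cardC1 card_ord.
rewrite -prodr_const; apply: eq_bigr => i ii0.
rewrite (@eq_Rintegral _ _ _ _ _ (fun y => 1 - (1 - th) * phi z y)); last first.
  by move=> y _ /=; rewrite /h (negbTE ii0); ring.
by rewrite RintB ?RintZ ?Rint_cst//; apply: bmM => //; exact: bm_cst.
Qed.

(** A neighbour of the new vertex affects the count only if its degree is [k] before or after, hence
    at most [k.+1] after; the new vertex itself only if its degree is [k]. The bound is a union
    bound over these events. *)
Lemma Gmean_add_vertex n f PM : (forall m, 0 <= f m <= 1) -> (forall x, p x <= PM) ->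
  `|Gmean n.+1 k f - Gmean n k f| <=
  th ^- k * (\int[mu]_z mgf z ^+ n + n%:R * (PM * \int[mu]_z mgf z ^+ n.-1)).
Proof.
move=> f01 pPM; pose u : 'I_n.+1 := ord0.
(* Deleting a vertex of the larger graph leaves the law of the smaller one, so both means live on
   one space. *)
have -> : Gmean n k f =
    GE mu phi (fun (_ : 'I_n.+1) _ => 1) (fun e => f (Dk k [set: _]%SET (del u e))).
  rewrite (GE_root mu cf u (fun _ e => f (Dk k [set: _]%SET e)))//.
  rewrite -[LHS](Rint_cst mu); apply: eq_Rintegral => x _.
  rewrite mul1r /Gmean -(sum_GE_nbr_wt mu cf x); apply: eq_bigr => S _.
  by apply: eq_GE => // v y; rewrite mul1r.
pose b (e : edges n.+1) : R := ((deg [set: _]%SET e u <= k)%N)%:R +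
  \sum_(v < n) (((deg [set: _]%SET e (lift u v) <= k.+1)%N)%:R * (e [set lift u v; u]%SET)%:R).
have b0 e : 0 <= \sum_(v < n) (((deg [set: _]%SET e (lift u v) <= k.+1)%N)%:R * (e [set lift u v; u]%SET)%:R) :> R.
  by apply: sumr_ge0 => v _; rewrite mulr_ge0.
have diff e : `|f (Dk k [set: _]%SET e) - f (Dk k [set: _]%SET (del u e))| <= b e.
  have le1 : `|f (Dk k [set: _]%SET e) - f (Dk k [set: _]%SET (del u e))| <= 1.
    have /andP[? ?] := f01 (Dk k [set: _]%SET e).
    have /andP[? ?] := f01 (Dk k [set: _]%SET (del u e)).
    by rewrite ler_norml; apply/andP; split; lra.
  rewrite /b; case: (leqP (deg _ e u) k) => [_|ku]; first by rewrite ler_wpDr.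
  have [/existsP[v /andP[dv ev]]|/existsPn nv] := boolP [exists v : 'I_n,
      (deg [set: _]%SET e (lift u v) <= k.+1)%N && e [set lift u v; u]%SET].
    rewrite add0r (le_trans le1)// (bigD1 v)//= dv ev mulr1 lerDl.
    by apply: sumr_ge0 => w _; rewrite mulr_ge0.
  rewrite (_ : Dk k _ e = Dk k [set: _]%SET (del u e)) ?subrr ?normr0 ?addr_ge0//.
  rewrite (Dk_ins k u) /DkR; have := ku.
  have -> : deg [set: _]%SET e u = #|star u e|.
    by rewrite deg_star; apply: eq_card => i; rewrite !inE andbT.
  move=> ku'; rewrite gtn_eqF//=; apply: eq_card => v; rewrite !inE.
  have := nv v; rewrite deg_lift inE finset.setUC /=.
  case: (e [set lift u v; u]%SET) => /=; last by rewrite addn0.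
  by rewrite andbT addn1 ltnS -ltnNge => kd; rewrite !gtn_eqF// ltnS ltnW.
apply: le_trans.
  by apply: (le_GE_diff mu cf (b := b)) => // e; exact: diff.
rewrite GED// mulrDr; apply: lerD; first exact: GE_deg_le.
rewrite GE_sum//; apply: (@le_trans _ _ (\sum_(v < n)
    (th ^- k * (PM * \int[mu]_z mgf z ^+ n.-1)))); last first.
  by rewrite sumr_const card_ord -(mulr_natl (th ^- k * _)) mulrCA.
apply: ler_sum => v _.
have [i0 ui0|E] := unliftP (lift u v) u; last by have := neq_lift u v; rewrite {1}E eqxx.
rewrite (@eq_GE _ _ _ mu phi _ _ (fun _ _ => 1) _ (fun e =>
   ((deg [set: _]%SET e (lift u v) <= k.+1)%N)%:R * (i0 \in star (lift u v) e)%:R))//; last first.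
  by move=> e; rewrite inE -ui0.
apply: le_trans (GE_deg_le_edge _ _) _.
rewrite ler_wpM2l// -RintZ; last exact: bm_mgf.
apply: Rint_le => [||z]; first by apply: bmM => //; exact: bm_mgf.
  by apply: bmM; [exact: bm_cst|exact: bm_mgf].
rewrite ler_wpM2r// exprn_ge0// subr_ge0 mulr_ile1 ?mean_connection_ge0 ?mean_connection_le1//.
  by rewrite subr_ge0.
by rewrite gerBl ltW.
Qed.

End chernoff.

Section thinned.
Variables (eps pm PM : R).
Hypotheses (eps0 : 0 < eps) (phie : forall x y, phi x y <= 1 - eps).
Hypotheses (pmp : forall x, pm <= p x) (pPM : forall x, p x <= PM).
Variables (f : nat -> R) (C : R).
Hypothesis fC : forall m, 0 <= f m <= C.

Let rate := bad_rate mu phi eps pm PM k.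

Let fdiff n (S : {set 'I_n}) (e : edges n) m m' : (~~ bad k S e -> m = m') ->
  `|f m - f m'| <= C * (bad k S e)%:R.
Proof.
case: (bad k S e) => [_|->//]; last by rewrite subrr normr0 mulr0.
rewrite mulr1; have /andP[? ?] := fC m; have /andP[? ?] := fC m'.
by rewrite ler_norml; apply/andP; split; lra.
Qed.

Let C0 : 0 <= C. Proof. by have /andP[/le_trans] := fC 0; apply. Qed.

Let GE_fdiff n (S : {set 'I_n}) x (h h' : edges n -> nat) :
  (forall e, ~~ bad k S e -> h e = h' e) ->
  `|GE mu phi (nbr_wt phi x S) (fun e => f (h e)) -
    GE mu phi (nbr_wt phi x S) (fun e => f (h' e))| <= C * rate x #|S| #|~: S|.
Proof.
move=> hh.
have bS i : bm (nbr_wt phi x S i) by exact: bm_nbr_wt.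
have S0 i y : 0 <= nbr_wt phi x S i y by exact: nbr_wt_ge0.
apply: le_trans.
  by apply: (le_GE_diff mu cf (b := fun e => C * (bad k S e)%:R)) => // e; exact/fdiff/hh.
by rewrite GEZ// ler_wpM2l//; exact: (GE_bad cf eps0 phie pmp pPM).
Qed.

(** A virtual root at [x] is added by [sum_GE_nbr_wt]; off the bad event the count is that of its
    non-neighbours. The sets [S] are then grouped by size. *)
Lemma Gmean_thin n x :
  `|Gmean n k f - \sum_(a < n.+1) 'C(n, a)%:R * (p x ^+ a * non_nbr_mean mu phi k f (n - a) x)| <=
  C * \sum_(a < n.+1) 'C(n, a)%:R * rate x a (n - a).
Proof.
rewrite -(sum_subset_card n (fun a => p x ^+ a * non_nbr_mean mu phi k f (n - a) x)).
rewrite -(sum_subset_card n (fun a => rate x a (n - a))).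
rewrite /Gmean -(sum_GE_nbr_wt mu cf x) -sumrB big_distrr /=.
apply: (le_trans (ler_norm_sum _ _ _)); apply: ler_sum => S _.
rewrite -cardCn -(GE_non_nbr mu cf); apply: GE_fdiff => e; exact: nbad_Dk.
Qed.

End thinned.

(** Counterpart of [Gmean_thin] for a real root of degree [k]. The root itself is counted, whence
    [f m.+1]; the graph on the non-neighbours is the same. *)
Lemma root_mean_thin eps pm PM f C n x :
  0 < eps -> (forall x y, phi x y <= 1 - eps) ->
  (forall x, pm <= p x) -> (forall x, p x <= PM) ->
  (forall m, 0 <= f m <= C) ->
  `|root_mean n f x - 'C(n, k)%:R * (p x ^+ k * non_nbr_mean mu phi k (fun m => f m.+1) (n - k) x)| <=
  C * ('C(n, k)%:R * bad_rate mu phi eps pm PM k x k (n - k)).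
Proof.
move=> eps0 phie pmp pPM fC.
have C0 : 0 <= C by have /andP[/le_trans] := fC 0; apply.
have E c : \sum_(S : {set 'I_n} | #|S| == k) c = 'C(n, k)%:R * c :> R.
  rewrite sumr_const -(mulr_natl c); congr (_%:R * _).
  by have := card_draws 'I_n k; rewrite card_ord => <-; apply: eq_card => S; rewrite !inE.
rewrite -!E /root_mean -sumrB big_distrr /=.
apply: (le_trans (ler_norm_sum _ _ _)); apply: ler_sum => S /eqP Sk.
have bS i : bm (nbr_wt phi x S i) by exact: bm_nbr_wt.
have S0 i y : 0 <= nbr_wt phi x S i y by exact: nbr_wt_ge0.
have := GE_non_nbr mu cf k x S (fun m => f m.+1); rewrite cardCn Sk => <-.
apply: (@le_trans _ _ (GE mu phi (nbr_wt phi x S) (fun e => C * (bad k S e)%:R))).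
  apply: le_GE_diff => // e; case: (boolP (bad k S e)) => [_|nb].
    rewrite mulr1; have /andP[? ?] := fC (DkR k S e); have /andP[? ?] := fC (Dk k (~: S) e).+1.
    by rewrite ler_norml; apply/andP; split; lra.
  by rewrite (nbad_DkR Sk nb) subrr normr0 mulr0.
rewrite GEZ// ler_wpM2l//.
by have := GE_bad cf eps0 phie pmp pPM k x S; rewrite cardCn Sk.
Qed.

End vertex_counts.

(** * Poisson approximation by Stein's method *)

(** Finiteness of the average of [a] is part of the conclusion, since [a <= b + c]. *)
Lemma pmean_dist (R : realType) (s : R) (a b c : nat -> R) B C : 0 < s ->
  (forall n, 0 <= a n) -> (forall n, 0 <= b n) -> (forall n, 0 <= c n) ->
  (forall n, `|a n - b n| <= c n) ->
  pmean s b = B%:E -> pmean s c = C%:E ->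
  exists2 A, pmean s a = A%:E & `|A - B| <= C.
Proof.
move=> s0 a0 b0 c0 abc bE cE.
have h1 : (pmean s a <= (B + C)%:E)%E.
  rewrite EFinD -bE -cE -(pmeanD s)//; apply: le_pmean => // n.
  by have := abc n; rewrite ler_distl => /andP[].
have h2 : (B%:E <= pmean s a + C%:E)%E.
  rewrite -bE -cE -(pmeanD s)//; apply: le_pmean => // n.
  by have := abc n; rewrite ler_distl lerBlDr => /andP[].
have h3 := pmean_ge0 s a0.
case: (pmean s a) h1 h2 h3 => [A| |]// h1 h2 _; exists A => //.
by rewrite ler_distl lerBlDr -!lee_fin h1 EFinD h2.
Qed.

Lemma pmean_fin (R : realType) (s : R) (a : nat -> R) c : 0 < s ->
  (forall n, 0 <= a n <= c) -> exists2 A, pmean s a = A%:E & 0 <= A <= c.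
Proof.
move=> s0 ac.
have a0 n : 0 <= a n by have /andP[] := ac n.
have a1 n : a n <= c by have /andP[] := ac n.
have h1 := pmean_le_cst s0 a0 a1; have h2 := pmean_ge0 s a0.
case: (pmean s a) h1 h2 => [A| |]// h1 h2; exists A => //.
by rewrite -!lee_fin h1 h2.
Qed.

Lemma measurable_pmean d (T : measurableType d) (R : realType) (s : R)
    (g : nat -> T -> R) : (forall n, measurable_fun setT (g n)) ->
  (forall n x, 0 <= g n x) ->
  measurable_fun setT (fun x => pmean s (fun n => g n x)).
Proof.
move=> mg g0; apply: ge0_emeasurable_sum => [n x _ _|n _].
  by rewrite lee_fin mulr_ge0// poisson_pmf_ge0.
by apply/measurable_EFinP; apply: measurable_funM.
Qed.

(** * Stein's identity on the Poisson graph *)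

Section poisson_graph.
Context d (T : measurableType d) (R : realType).
Variables (mu : probability T R) (phi : T -> T -> R).
Hypothesis cf : connection_function phi.
Variable s : R.
Hypothesis s0 : 0 < s.

Local Notation p := (mean_connection mu phi).

Let bp : bm p. Proof. exact: bm_mean_connection. Qed.
Let p0 x : 0 <= p x. Proof. exact: mean_connection_ge0. Qed.
Let p1 x : p x <= 1. Proof. exact: mean_connection_le1. Qed.

Definition pois_deg (k : nat) (x : T) : R :=
  expR (- (s * p x)) * ((s * p x) ^+ k / k`!%:R).

Definition lam (k : nat) : R := s * \int[mu]_x pois_deg k x.

Definition Pmean (k : nat) (f : nat -> R) : \bar R :=
  pmean s (fun n => Gmean mu phi n k f).

Lemma pois_deg_ge0 k x : 0 <= pois_deg k x.
Proof. by rewrite mulr_ge0 ?expR_ge0// divr_ge0// exprn_ge0// mulr_ge0// ltW. Qed.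

Lemma bm_pois_deg k : bm (pois_deg k).
Proof.
have bsp : bm (fun x => s * p x) by apply: bmM => //; exact: bm_cst.
apply: bmM; last by apply: bmM; [exact: bmX|exact: bm_cst].
split; first by apply: measurableT_comp => //; apply: measurableT_comp => //; case: bsp.
exists 1 => x; rewrite ger0_norm ?expR_ge0// -expR0 ler_expR oppr_le0.
by rewrite mulr_ge0// ltW.
Qed.

Lemma lam_ge0 k : 0 <= lam k.
Proof. by rewrite mulr_ge0 ?(ltW s0)// Rint_ge0// => x; exact: pois_deg_ge0. Qed.

Let GE_nbr_ge0 n x (S : {set 'I_n}) h : (forall e, 0 <= h e) ->
  0 <= GE mu phi (nbr_wt phi x S) h.
Proof.
move=> h0; apply: GE_ge0 => // [v|v y]; [exact: bm_nbr_wt|exact: nbr_wt_ge0].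
Qed.

Lemma root_mean_ge0 k n f x : (forall m, 0 <= f m) -> 0 <= root_mean mu phi k n f x.
Proof. by move=> f0; apply: sumr_ge0 => S _; apply: GE_nbr_ge0 => e; exact: f0. Qed.

Lemma Pmean_shift k f : (forall m, 0 <= f m) ->
  Pmean k (fun m => m%:R * f m) =
  (s%:E * \int[mu]_x pmean s (fun n => root_mean mu phi k n f x))%E.
Proof.
move=> f0; rewrite -(Rint_pmean s mu); last first.
- by move=> n x; exact: root_mean_ge0.
- by move=> n; exact: bm_root_mean.
(* A root and [m] other points make [m.+1] points; at 0 points both sides vanish. *)
pose a n := if n is m.+1 then \int[mu]_x root_mean mu phi k m f x else 0.
rewrite -(@pmean_shift _ _ s0 a); last first.
  by case => [//|n]; apply: Rint_ge0 => x; exact: root_mean_ge0.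
by apply: eq_pmean => -[|n]; rewrite ?Gmean0 ?mul0r// (GmeanS mu cf).
Qed.

Lemma Pmean_id k : Pmean k (fun m => m%:R) = (lam k)%:E.
Proof.
rewrite (_ : (fun m => m%:R) = (fun m => m%:R * 1)); last by apply/funext => m; rewrite mulr1.
rewrite (@Pmean_shift k (fun=> 1))// /lam EFinM; congr (_ * _)%E.
rewrite EFin_Rint; last exact: bm_pois_deg.
apply: eq_integral => x _.
rewrite (@eq_pmean _ _ _ (fun n => 'C(n, k)%:R * (fun b => p x ^+ k * (1 - p x) ^+ b) (n - k)%N)); last first.
  by move=> n; rewrite (root_mean_cst mu cf) mulr1.
have q0 : 0 <= 1 - p x by rewrite subr_ge0.
rewrite (pmean_binom s0 k (a := fun b => p x ^+ k * (1 - p x) ^+ b)); last first.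
  by move=> n; rewrite mulr_ge0 ?exprn_ge0.
rewrite (pmeanZ s); last by move=> n; rewrite exprn_ge0.
rewrite (pmean_exp s0)// -!EFinM /pois_deg; congr EFin.
rewrite exprMn (_ : s * (1 - p x - 1) = - (s * p x)); last by ring.
ring.
Qed.

Variables (eps pm PM : R).
Hypotheses (eps0 : 0 < eps) (phie : forall x y, phi x y <= 1 - eps).
Hypotheses (pmp : forall x, pm <= p x) (pPM : forall x, p x <= PM).

Variable k : nat.

Local Notation q := (thin_rate eps pm).
Local Notation rho x := (1 - p x - q).

(** The bad event starts from a neighbour of the root: [k] of them for the real root, at most
    [s * PM] on average for the virtual one. It concerns that neighbour or one of its own
    neighbours, whence [1 + s * PM]; the rest is the Chernoff factor. *)
Definition stein_rate : R :=
  2 ^+ k * (k%:R + s * PM) * (1 + s * PM) * expR (- (s * q)).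

Let rho0 x : 0 <= rho x. Proof. exact: (rho_ge0 cf eps0 phie pmp). Qed.

Let PM0 : 0 <= PM.
Proof.
have [x _] : exists x : T, True; last exact: le_trans (p0 x) (pPM x).
apply: contrapT => h; have := probability_setT mu.
rewrite (_ : setT = set0) ?measure0; last first.
  by apply/seteqP; split => // x _; case: h; exists x.
by move=> /eqP; rewrite eqe eq_sym oner_eq0.
Qed.

(** [bad_rate] as a factor in the number of neighbours times a factor in the number of other points,
    the form that [pmean_conv] and [pmean_binom] require. *)
Let rate_far x b := 2 ^+ k * (rho x ^+ b + PM * (b%:R * rho x ^+ b.-1)).

Let rate_far_ge0 x b : 0 <= rate_far x b.
Proof. by rewrite mulr_ge0 ?addr_ge0 ?mulr_ge0 ?exprn_ge0. Qed.

Let rateE x a b : bad_rate mu phi eps pm PM k x a b = a%:R * p x ^+ a * rate_far x b.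
Proof. by rewrite /bad_rate /rate_far natrM; ring. Qed.

Let pmean_far x : pmean s (rate_far x) =
  (2 ^+ k * (1 + s * PM) * expR (s * (rho x - 1)))%:E.
Proof.
rewrite (pmeanZ s); last first.
  by move=> b; rewrite addr_ge0 ?mulr_ge0 ?exprn_ge0.
rewrite (pmeanD s); last 2 first.
- by move=> b; rewrite exprn_ge0.
- by move=> b; rewrite !mulr_ge0 ?exprn_ge0.
rewrite (pmeanZ s); last by move=> b; rewrite mulr_ge0 ?exprn_ge0.
by rewrite (pmean_exp s0)// (pmean_nexp s0)// -!EFinM; congr EFin; ring.
Qed.

Variables (f : nat -> R) (C : R).
Hypothesis fC : forall m, 0 <= f m <= C.

Let C0 : 0 <= C. Proof. by have /andP[/le_trans] := fC 0; apply. Qed.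
Let f0 m : 0 <= f m. Proof. by have /andP[] := fC m. Qed.

Let fS m := f m.+1.

Let nnm_itv b x : 0 <= non_nbr_mean mu phi k fS b x <= C.
Proof.
have b1 (v : 'I_b) : bm (fun y => 1 - phi x y).
  by apply: bmB; [exact: bm_cst|exact: (bm_phi2 cf)].
have g0 (v : 'I_b) y : 0 <= 1 - phi x y.
  by rewrite subr_ge0; have /andP[] := connection_itv cf x y.
rewrite GE_ge0//=; last by move=> e; exact: f0.
apply: (@le_trans _ _ (non_nbr_mean mu phi k (fun=> C) b x)).
  by apply: GE_le => // e; have /andP[] := fC (Dk k [set: _]%SET e).+1.
rewrite non_nbr_mean_cst// ler_piMl// exprn_ile1// ?subr_ge0//.
by rewrite gerBl.
Qed.

Let Fin : exists2 F, Pmean k fS = F%:E & 0 <= F <= C.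
Proof.
apply: (pmean_fin s0) => n; rewrite Gmean_ge0//=; last by move=> m; exact: f0.
apply: le_trans (Gmean_le mu cf n k (g := fun=> C) _) _; last by rewrite Gmean_cst.
by move=> m; have /andP[] := fC m.+1.
Qed.

Let nnm0 b x : 0 <= non_nbr_mean mu phi k fS b x. Proof. by have /andP[] := nnm_itv b x. Qed.

Let br0 x a b : 0 <= bad_rate mu phi eps pm PM k x a b.
Proof. by rewrite rateE mulr_ge0// mulr_ge0 ?exprn_ge0. Qed.

(** The virtual root. The weights behind [N] have total mass [expR (- (s * p x))], so
    [expR (s * p x) * N] is the normalised mean over the non-neighbours. *)
Let near F N x : Pmean k fS = F%:E ->
  pmean s (fun b => non_nbr_mean mu phi k fS b x) = N%:E ->
  `|F - expR (s * p x) * N| <=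
  C * (2 ^+ k * (s * p x) * (1 + s * PM) * expR (- (s * q))).
Proof.
move=> FE NE.
have h1 : pmean s (fun n => \sum_(a < n.+1) 'C(n, a)%:R * (p x ^+ a * non_nbr_mean mu phi k fS (n - a) x)) = (expR (s * p x) * N)%:E.
  rewrite (pmean_conv s0 (a := fun a => p x ^+ a) (b := fun b => non_nbr_mean mu phi k fS b x))//; last first.
    by move=> n; rewrite exprn_ge0.
  rewrite (pmean_exp s0)// NE -!EFinM -expRD; congr (_ * _)%:E; congr expR; ring.
have h2 : pmean s (fun n => C * \sum_(a < n.+1) 'C(n, a)%:R * bad_rate mu phi eps pm PM k x a (n - a)) =
    (C * (2 ^+ k * (s * p x) * (1 + s * PM) * expR (- (s * q))))%:E.
  rewrite (pmeanZ s); last by move=> n; apply: sumr_ge0 => a _; rewrite mulr_ge0.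
  rewrite (@eq_pmean _ _ _ (fun n => \sum_(a < n.+1) 'C(n, a)%:R * ((fun a => a%:R * p x ^+ a) a * (rate_far x) (n - a)%N))); last first.
    by move=> n; apply: eq_bigr => a _; rewrite rateE.
  rewrite (pmean_conv s0 (a := fun a => a%:R * p x ^+ a) (b := rate_far x))//; last first.
    by move=> n; rewrite mulr_ge0 ?exprn_ge0.
  rewrite pmean_far (pmean_nexp' s0)// -!EFinM; congr (_ * _)%:E.
  transitivity (2 ^+ k * (s * p x) * (1 + s * PM) *
     (expR s * expR (s * (p x - 1)) * expR (s * (rho x - 1)))); first by ring.
  by rewrite -!expRD; congr (_ * expR _); ring.
have [||||F' F'E] := pmean_dist s0 (a := fun n => Gmean mu phi n k fS) _ _ _ _ h1 h2.
- by move=> n; apply: Gmean_ge0 => // m; exact: f0.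
- by move=> n; apply: sumr_ge0 => a _; rewrite mulr_ge0// mulr_ge0 ?exprn_ge0.
- by move=> n; rewrite mulr_ge0//; apply: sumr_ge0 => a _; rewrite mulr_ge0.
- by move=> n; apply: (Gmean_thin cf k eps0 phie pmp pPM) => m; exact: fC.
by move: FE; rewrite /Pmean F'E => -[->].
Qed.

(** The real root of degree [k], compared with the same normalised mean as in [near], now times the
    probability [pois_deg k x] of that degree. *)
Let far N x : pmean s (fun b => non_nbr_mean mu phi k fS b x) = N%:E ->
  exists2 U, pmean s (fun n => root_mean mu phi k n f x) = U%:E &
  `|U - pois_deg k x * (expR (s * p x) * N)| <=
  C * (pois_deg k x * (2 ^+ k * k%:R * (1 + s * PM) * expR (- (s * q)))).
Proof.
move=> NE.
have h1 : pmean s (fun n => 'C(n, k)%:R * (p x ^+ k * non_nbr_mean mu phi k fS (n - k) x)) = (pois_deg k x * (expR (s * p x) * N))%:E.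
  rewrite (pmean_binom s0 k (a := fun b => p x ^+ k * non_nbr_mean mu phi k fS b x)); last first.
    by move=> n; rewrite mulr_ge0 ?exprn_ge0.
  rewrite pmeanZ// NE -!EFinM /pois_deg exprMn expRN; congr EFin.
  by field; rewrite ?pnatr_eq0 -?lt0n ?fact_gt0 ?gt_eqF ?expR_gt0.
have h2 : pmean s (fun n => C * ('C(n, k)%:R * bad_rate mu phi eps pm PM k x k (n - k))) =
   (C * (pois_deg k x * (2 ^+ k * k%:R * (1 + s * PM) * expR (- (s * q)))))%:E.
  rewrite (pmeanZ s); last by move=> n; rewrite mulr_ge0.
  rewrite (pmean_binom s0 k (a := fun b => bad_rate mu phi eps pm PM k x k b)); last by [].
  rewrite (@eq_pmean _ _ _ (fun b => (k%:R * p x ^+ k) * rate_far x b)); last first.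
    by move=> b; rewrite rateE.
  rewrite pmeanZ// pmean_far -!EFinM; congr (_ * _)%:E.
  rewrite (_ : s * (rho x - 1) = - (s * p x) + - (s * q)); last by ring.
  rewrite expRD /pois_deg exprMn; ring.
have [||||U UE Udist] := pmean_dist s0 (a := fun n => root_mean mu phi k n f x) _ _ _ _ h1 h2.
- by move=> n; exact: root_mean_ge0.
- by move=> n; rewrite mulr_ge0// mulr_ge0// exprn_ge0.
- by move=> n; rewrite mulr_ge0// mulr_ge0.
- by move=> n; exact: (root_mean_thin cf k n x eps0 phie pmp pPM fC).
by exists U.
Qed.

Let root_itv F x : Pmean k fS = F%:E ->
  exists2 U, pmean s (fun n => root_mean mu phi k n f x) = U%:E &
      `|U - pois_deg k x * F| <= pois_deg k x * (C * stein_rate).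
Proof.
move=> FE.
have [N NE _] := pmean_fin s0 (fun b => nnm_itv b x).
have nr := near FE NE; have [U UE Ud] := far NE.
exists U => //.
apply: le_trans (ler_distD (pois_deg k x * (expR (s * p x) * N)) _ _) _.
have pd := pois_deg_ge0 k x.
have nr' : `|pois_deg k x * (expR (s * p x) * N) - pois_deg k x * F| <=
    pois_deg k x * (C * (2 ^+ k * (s * p x) * (1 + s * PM) * expR (- (s * q)))).
  by rewrite -mulrBr normrM (ger0_norm pd) ler_wpM2l// distrC.
have e0 : 0 <= expR (- (s * q)) by exact: expR_ge0.
apply: le_trans (lerD Ud nr') _.
rewrite mulrCA -mulrDr ler_wpM2l// -mulrDr ler_wpM2l// /stein_rate.
rewrite [X in _ <= X](_ : _ = 2 ^+ k * (1 + s * PM) * expR (- (s * q)) * (k%:R + s * PM)); last by ring.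
rewrite [X in X <= _](_ : _ = 2 ^+ k * (1 + s * PM) * expR (- (s * q)) * (k%:R + s * p x)); last by ring.
rewrite ler_wpM2l ?lerD2l ?ler_wpM2l ?(ltW s0)//.
by rewrite !mulr_ge0// addr_ge0// mulr_ge0// ltW.
Qed.

(** [root_itv] combines [near] and [far] at a fixed root; integrating over the root turns the
    weights [pois_deg k] into [lam k]. *)
Lemma poisson_stein : exists W F : R,
  [/\ Pmean k (fun m => m%:R * f m) = W%:E, Pmean k (fun m => f m.+1) = F%:E &
      `|W - lam k * F| <= lam k * (C * stein_rate)].
Proof.
have [F FE _] := Fin.
pose U x := fine (pmean s (fun n => root_mean mu phi k n f x)).
have UE x : pmean s (fun n => root_mean mu phi k n f x) = (U x)%:E.
  by have [u uE _] := root_itv x FE; rewrite /U uE.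
have Ud x : `|U x - pois_deg k x * F| <= pois_deg k x * (C * stein_rate).
  by have [u uE] := root_itv x FE; rewrite /U uE.
have bpd := bm_pois_deg k.
have bU : bm U.
  split.
    apply: (measurableT_comp (f := fine)) => //; apply: measurable_pmean => [n|n x].
      by case: (bm_root_mean mu cf k n f).
    exact: root_mean_ge0.
  have [_ [M hM]] := bpd; exists (M * (`|F| + `|C * stein_rate|)) => x.
  rewrite -[U x](subrK (pois_deg k x * F)); apply: le_trans (ler_normD _ _) _.
  have pd := pois_deg_ge0 k x.
  have pM : pois_deg k x <= M by have := hM x; rewrite ger0_norm.
  rewrite mulrDr addrC lerD//; first by rewrite normrM (ger0_norm pd) ler_wpM2r.
  apply: le_trans (Ud x) _; apply: (@le_trans _ _ (pois_deg k x * `|C * stein_rate|)).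
    by rewrite ler_wpM2l// ler_norm.
  by rewrite ler_wpM2r.
exists (s * \int[mu]_x U x), F; split => //.
  rewrite Pmean_shift// EFinM EFin_Rint//; congr (_ * _)%E.
  by apply: eq_integral => x _; exact: UE.
rewrite /lam -!mulrA -mulrBr normrM (gtr0_norm s0) ler_wpM2l ?(ltW s0)//.
have bF c : bm (fun x => pois_deg k x * c) by apply: bmM => //; exact: bm_cst.
rewrite -!RintZr// -RintB//.
apply: le_trans (Rint_norm _ _) _; first exact: bmB.
apply: Rint_le => //.
have [m1 [M1 hM1]] : bm (fun x => U x - pois_deg k x * F) by exact: bmB.
split; first exact: measurableT_comp.
by exists M1 => x; rewrite normr_id.
Qed.

End poisson_graph.

(** * Bounded solutions of the Stein equation for the Poisson law *)

Section stein_solution.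
Variables (R : realType) (l : R).
Hypothesis l0 : 0 < l.

Let w n : R := poisson_pmf l n.

Definition pcdf (r : nat) : R := \sum_(i < r.+1) poisson_pmf l i.

Let w_gt0 n : 0 < w n.
Proof. by rewrite /w poisson_pmfE// !mulr_gt0 ?exprn_gt0 ?expR_gt0// invr_gt0 ltr0n fact_gt0. Qed.

Let wS n : l * w n = n.+1%:R * w n.+1.
Proof.
rewrite /w !poisson_pmfE// factS natrM exprS; field.
by rewrite nat1r !pnatr_eq0 -lt0n fact_gt0.
Qed.

Lemma pcdf_ge0 r : 0 <= pcdf r.
Proof. by apply: sumr_ge0 => i _; exact: poisson_pmf_ge0. Qed.

Lemma pcdfS r : pcdf r.+1 = pcdf r + poisson_pmf l r.+1.
Proof. by rewrite /pcdf big_ord_recr. Qed.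

Lemma pcdf0 : pcdf 0 = poisson_pmf l 0.
Proof. by rewrite /pcdf big_ord_recl big_ord0 addr0. Qed.

Lemma pcdf_nd a b : (a <= b)%N -> pcdf a <= pcdf b.
Proof.
move=> /subnK <-; elim: (b - a)%N => [|n ih]; first by rewrite add0n.
by rewrite addSn pcdfS (le_trans ih)// lerDl poisson_pmf_ge0.
Qed.

Let pcdfE r : (pcdf r)%:E = (\sum_(0 <= i < r.+1) (w i * 1)%:E)%E.
Proof. by rewrite /pcdf -sumEFin big_mkord; apply: eq_bigr => i _; rewrite mulr1. Qed.

Lemma pcdf_le1 r : pcdf r <= 1.
Proof.
rewrite -lee_fin -(pmean_cst l0 1) pcdfE; apply: nneseries_lim_ge => n _ _.
by rewrite lee_fin mulr_ge0// poisson_pmf_ge0.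
Qed.

Lemma pcdf_sup B : (forall r, pcdf r <= B) -> 1 <= B.
Proof.
move=> h; rewrite -lee_fin -(pmean_cst l0 1); apply: lime_le.
  by apply: is_cvg_nneseries => n _ _; rewrite lee_fin mulr_ge0// poisson_pmf_ge0.
by exists 1%N => // -[//|n] _; rewrite -pcdfE lee_fin.
Qed.

Let tail m : l <= m%:R -> 1 - pcdf m <= l * w m.
Proof.
move=> lm; rewrite lerBlDr.
(* The left side decreases in [M], because [l * w n = n.+1 * w n.+1] and [l <= n] from [m] on. *)
have key M : pcdf (M + m) - pcdf m + l * w (M + m)%N <= l * w m.
  elim: M => [|M ih]; first by rewrite subrr add0r.
  apply: le_trans ih; rewrite addSn pcdfS (wS (M + m)) -/(w (M + m).+1) -natr1.
  have lM : l <= (M + m)%:R by rewrite (le_trans lm)// ler_nat leq_addl.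
  have : 0 <= w (M + m).+1 * ((M + m)%:R - l) by rewrite mulr_ge0 ?subr_ge0// ltW.
  set a := w _; set b := _%:R; nra.
apply: pcdf_sup => r; have [rm|mr] := leqP r m.
  by rewrite (le_trans (pcdf_nd rm))// lerDr mulr_ge0// ltW.
have := key (r - m)%N; rewrite subnK ?(ltnW mr)//.
have : 0 <= l * w r by rewrite mulr_ge0// ltW.
lra.
Qed.

(** Up to index [l] the weights increase, so each of the [m.+1] terms is at most [w m]. *)
Let head m : m%:R <= l -> pcdf m <= m.+1%:R * w m.
Proof.
elim: m => [|m ih] ml; first by rewrite pcdf0 mul1r.
have ml' : m%:R <= l by rewrite (le_trans _ ml)// ler_nat.
have := ih ml'; rewrite pcdfS => {}ih.
have wm : w m <= w m.+1.
  rewrite -(ler_pM2l l0) wS; rewrite ler_wpM2r//; exact: ltW.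
rewrite -[m.+2%:R]natr1 mulrDl mul1r lerD2r (le_trans ih)// ler_wpM2l//.
Qed.

Variable r : nat.
Local Notation c := (pcdf r).

Fixpoint stein_sol (m : nat) : R :=
  if m is n.+1 then ((n <= r)%N%:R - c + n%:R * stein_sol n) / l else 0.

(** The Stein equation for the indicator of [m <= r], arranged so that all terms are nonnegative and
    can be averaged separately in [\bar R]. *)
Lemma stein_solE m : (m <= r)%N%:R + m%:R * stein_sol m = l * stein_sol m.+1 + c.
Proof. by rewrite /=; field; rewrite gt_eqF. Qed.

(** Multiplied by the Poisson weight, the recursion telescopes. The closed form shows the sign at
    once and leaves only [head] and [tail] to estimate. *)
Let solE m : l * w m * stein_sol m.+1 =
  if (m <= r)%N then (1 - c) * pcdf m else c * (1 - pcdf m).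
Proof.
elim: m => [|m ih].
  rewrite leq0n pcdf0 /= mul0r addr0 -/(w 0).
  by field; rewrite gt_eqF.
have -> : l * w m.+1 * stein_sol m.+2 =
    w m.+1 * ((m.+1 <= r)%N%:R - c) + l * w m * stein_sol m.+1.
  transitivity (w m.+1 * (l * stein_sol m.+2 + c - c)); first by ring.
  by rewrite -stein_solE (wS m); ring.
rewrite ih pcdfS -/(w m.+1).
case: (ltngtP m r) => [mr|rm|<-].
- by rewrite /=; ring.
- by rewrite /=; ring.
- rewrite /=; rewrite /pcdf -/(w _); ring.
Qed.

(** For [m >= l] the tail bound gives at most 1; for [m < l] the head bound gives at most
    [m.+1 / l], hence [1 + l^-1]. *)
Lemma stein_sol_itv m : 0 <= stein_sol m <= 1 + l^-1.
Proof.
have li0 : 0 <= l^-1 by rewrite invr_ge0 ltW.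
case: m => [|m]; first by rewrite lexx addr_ge0.
have lw : 0 < l * w m by rewrite mulr_gt0.
have c0 := pcdf_ge0 r; have c1 := pcdf_le1 r.
have m0 := pcdf_ge0 m; have m1 := pcdf_le1 m.
have s0 : 0 <= l * w m * stein_sol m.+1.
  by rewrite solE; case: ifP => _; rewrite mulr_ge0// subr_ge0.
rewrite pmulr_rge0// in s0; rewrite s0 /=.
have [lm|ml] := leP l m%:R.
  have : l * w m * stein_sol m.+1 <= l * w m.
    rewrite solE; case: ifPn => [mr|_]; last first.
      apply: le_trans (tail lm); rewrite ler_piMl// subr_ge0//.
    apply: le_trans (tail lm); apply: (@le_trans _ _ (1 - c)).
      by rewrite ler_piMr// subr_ge0.
    by rewrite lerD2l lerN2 pcdf_nd.
  rewrite -[leRHS]mulr1 ler_pM2l// => /le_trans; apply.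
  by rewrite lerDl.
have hm := head (ltW ml).
have : l * w m * stein_sol m.+1 <= m.+1%:R * w m.
  apply: le_trans hm; rewrite solE; case: ifPn => [_|]; first by rewrite ler_piMl// gerBl.
  rewrite -ltnNge => rm; apply: (@le_trans _ _ c); last exact/pcdf_nd/ltnW.
  by rewrite ler_piMr// gerBl.
rewrite -mulrA mulrCA [X in _ <= X]mulrC ler_pM2l// => h.
rewrite -(ler_pM2l l0) (le_trans h)// mulrDr mulr1 divff ?gt_eqF// -natr1 lerD2r.
exact: ltW.
Qed.

End stein_solution.

Section poisson_approximation.
Context d (T : measurableType d) (R : realType).
Variables (mu : probability T R) (phi : T -> T -> R).
Hypothesis cf : connection_function phi.
Variables (s eps pm PM : R).
Hypothesis s0 : 0 < s.
Hypotheses (eps0 : 0 < eps) (phie : forall x y, phi x y <= 1 - eps).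
Hypotheses (pmp : forall x, pm <= mean_connection mu phi x).
Hypotheses (pPM : forall x, mean_connection mu phi x <= PM).
Variable k : nat.
Hypothesis lam_gt0 : 0 < lam mu phi s k.

Lemma PmeanD f g : (forall m, 0 <= f m) -> (forall m, 0 <= g m) ->
  Pmean mu phi s k (fun m => f m + g m) =
  (Pmean mu phi s k f + Pmean mu phi s k g)%E.
Proof.
move=> f0 g0; rewrite /Pmean -(pmeanD s); [|by move=> n; apply: Gmean_ge0..].
by apply: eq_pmean => n; rewrite (GmeanD mu cf).
Qed.

Lemma PmeanZ c f : (forall m, 0 <= f m) ->
  Pmean mu phi s k (fun m => c * f m) = (c%:E * Pmean mu phi s k f)%E.
Proof.
move=> f0; rewrite /Pmean -(pmeanZ s); last by move=> n; apply: Gmean_ge0.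
by apply: eq_pmean => n; rewrite (GmeanZ mu cf).
Qed.

Lemma Pmean_cst c : Pmean mu phi s k (fun=> c) = c%:E.
Proof. by rewrite -(pmean_cst s0); apply: eq_pmean => n; exact: Gmean_cst. Qed.

(** Averaging the Stein equation over [D_k] makes the distance of distribution functions equal to
    the error of [poisson_stein], and [l * (1 + l^-1) = l + 1]. *)
Theorem poisson_approx r : exists2 Pr, Pmean mu phi s k (fun m => (m <= r)%N%:R) = Pr%:E &
  `|Pr - pcdf (lam mu phi s k) r| <= (lam mu phi s k + 1) * stein_rate s eps pm PM k.
Proof.
set l := lam mu phi s k.
pose f := stein_sol l r.
have fC m : 0 <= f m <= 1 + l^-1 by exact: stein_sol_itv.
have f0 m : 0 <= f m by have /andP[] := fC m.
have [W [F [WE FE WF]]] := poisson_stein cf s0 eps0 phie pmp pPM k fC.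
have := congr1 (Pmean mu phi s k) (funext (stein_solE lam_gt0 r)).
rewrite PmeanD//; last by move=> m; rewrite mulr_ge0.
rewrite (PmeanD (f := fun m => l * f m.+1) (g := fun=> pcdf l r)); last 2 first.
- by move=> m; rewrite mulr_ge0// ltW.
- by move=> m; exact: pcdf_ge0.
rewrite Pmean_cst (PmeanZ _ (f := fun m => f m.+1))// FE WE.
case: (Pmean _ _ _ _ _) => [Pr| |]// [E]; exists Pr => //.
have -> : Pr - pcdf l r = - (W - l * F) by lra.
rewrite normrN (le_trans WF)// -/l mulrA mulrDr mulr1 divff ?gt_eqF//.
Qed.

End poisson_approximation.

Local Open Scope classical_set_scope.
Local Open Scope ring_scope.

(** * The central limit theorem for the Poisson law *)

Section poisson_clt.
Variable R : realType.
Implicit Types (u x y a l t : R) (n : nat).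

(** The remainder has derivative [x ^+ 2 / (1 + x)], at most [2 * u ^+ 2] in absolute value between
    0 and [u]; the mean value theorem does the rest. *)
Lemma ln1p_taylor2 u : `|u| <= 2^-1 ->
  `|ln (1 + u) - (u - u ^+ 2 / 2)| <= 2 * `|u| ^+ 3.
Proof.
move=> u2.
pose f x := ln (1 + x) - (x - x ^+ 2 / 2).
pose df x := (1 + x)^-1 - (1 - x).
have f0 : f 0 = 0 by rewrite /f addr0 ln1 expr2; ring.
have fd x : -1 < x -> is_derive x 1 f (df x).
  move=> x1; have x0 : 0 < 1 + x by lra.
  have dln := is_derive1_ln x0.
  have dg : is_derive x (1 : R) (cst 1 + id : R -> R) 1.
    by apply: is_derive_eq; rewrite add0r.
  have d1 := @is_derive1_comp R (@ln R) (cst 1 + id) x _ _ dln dg.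
  have di := is_derive_id x (1 : R).
  have h := is_deriveB d1 (is_deriveB di (is_deriveZ 2^-1 (is_deriveX 2 di))).
  rewrite (_ : f = @ln R \o (cst 1 + id) - (id - 2^-1 \*: id ^+ 2)); last first.
    by apply/funext => z; rewrite /f !fctE /= -[_ *: _]/(_ * _) mulrC.
  apply: (is_derive_eq h).
  by rewrite /df mulr1 /= expr1 -![_ *: _]/(_ * _); field; rewrite gt_eqF.
have dfle x : -1 < x -> `|x| <= `|u| -> `|df x| <= 2 * `|u| ^+ 2.
  move=> x1 xu; have x2 : `|x| <= 2^-1 by exact: le_trans xu u2.
  have h : 2^-1 <= 1 + x by move: x2; rewrite ler_norml => /andP[]; lra.
  have -> : df x = x ^+ 2 / (1 + x) by rewrite /df; field; lra.
  rewrite normrM normrX (mulrC 2) ler_pM//.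
    by rewrite lerXn2r// nnegrE.
  rewrite ger0_norm ?invr_ge0; last by lra.
  by rewrite -[leRHS]invrK lef_pV2// posrE; lra.
have cont a b : -1 < a -> {within `[a, b], continuous f}.
  move=> a1; apply: derivable_within_continuous => z; rewrite in_itv /= => /andP[az _].
  by have [] := fd z (lt_le_trans a1 az).
have u1 : -1 < u by move: u2; rewrite ler_norml => /andP[]; lra.
rewrite -[X in `|X|]/(f u).
have -> : f u = f u - f 0 by rewrite f0 subr0.
rewrite exprSr mulrA.
have [u0|u0] := leP 0 u.
  have [z||c] := @MVT_segment _ f df 0 u u0.
  - by rewrite in_itv /= => /andP[z0 _]; apply: fd; lra.
  - by apply: cont; lra.
  rewrite in_itv /= => /andP[c0 cu] ->; rewrite subr0 normrM ler_pM//.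
  by apply: dfle; rewrite ?ger0_norm//; lra.
have [z||c] := @MVT_segment _ f df u 0 (ltW u0).
- by rewrite in_itv /= => /andP[z0 _]; apply: fd; lra.
- exact: cont.
rewrite in_itv /= => /andP[c0 cu] E; rewrite distrC E sub0r normrM normrN ler_pM//.
by apply: dfle; rewrite ?ler0_norm//; lra.
Qed.

(* Up to a normalising factor, the Poisson([n + y sqrt n]) weight of [n]. *)
Definition psi n y : R :=
  (1 + y / Num.sqrt n%:R) ^+ n * expR (- (y * Num.sqrt n%:R)).

(** Cut off where the mean [n + y sqrt n] would be negative. *)
Definition psi0 n y : R := if - Num.sqrt n%:R <= y then psi n y else 0.

Let sq n : R := Num.sqrt n%:R.
Let sq_gt0 n : 0 < sq n.+1. Proof. by rewrite sqrtr_gt0 ltr0n. Qed.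
Let sqE n : sq n ^+ 2 = n%:R. Proof. by rewrite sqr_sqrtr. Qed.
Let sq_ge1 n : 1 <= sq n.+1.
Proof. by rewrite -[leLHS]sqrtr1 ler_sqrt// ?ler1n// ler0n. Qed.

(** This and the next two lemmas measure the gain over [1 + u <= expR u]. At [u = y / sqrt n] and
    raised to the power [n], they give the decay of [psi] in its three ranges. *)
Lemma one_plus_le_neg u : -1 <= u <= 0 -> 1 + u <= expR (u - u ^+ 2 / 4).
Proof.
move=> /andP[u1 u0].
have e1 := expR_ge1Dx (u / 2); have e2 := expR_ge1Dx (- (u ^+ 2 / 4)).
rewrite expRD (_ : expR u = expR (u / 2) ^+ 2); last by rewrite -expRM_natl; congr expR; field.
apply: (@le_trans _ _ ((1 + u / 2) ^+ 2 * (1 - u ^+ 2 / 4))); last first.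
  apply: ler_pM; rewrite ?sqr_ge0//; first by nra.
  by rewrite lerXn2r ?nnegrE ?expR_ge0//; lra.
rewrite -subr_ge0 (_ : _ - _ = u ^+ 2 / 4 * (1 - (1 + u / 2) ^+ 2)); last by field.
by rewrite mulr_ge0 ?divr_ge0 ?sqr_ge0//; nra.
Qed.

Lemma one_plus_le_pos u : 0 <= u <= 1 -> 1 + u <= expR (u - u ^+ 2 / 9).
Proof.
move=> /andP[u0 u1].
have e1 := expR_ge1Dx (u / 2); have e2 := expR_ge1Dx (- (u ^+ 2 / 9)).
rewrite expRD (_ : expR u = expR (u / 2) ^+ 2); last by rewrite -expRM_natl; congr expR; field.
apply: (@le_trans _ _ ((1 + u / 2) ^+ 2 * (1 - u ^+ 2 / 9))); last first.
  apply: ler_pM; rewrite ?sqr_ge0//; first by nra.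
  by rewrite lerXn2r ?nnegrE ?expR_ge0//; lra.
rewrite -subr_ge0 (_ : _ - _ = u ^+ 2 / 9 * (9 / 4 - (1 + u / 2) ^+ 2)); last by field.
by rewrite mulr_ge0 ?divr_ge0 ?sqr_ge0//; nra.
Qed.

Lemma one_plus_le_large u : 1 <= u -> 1 + u <= expR (u - u / 8).
Proof.
move=> u1; have e1 := expR_ge1Dx (u * 7 / 16).
rewrite (_ : expR _ = expR (u * 7 / 16) ^+ 2); last by rewrite -expRM_natl; congr expR; field.
apply: (@le_trans _ _ ((1 + u * 7 / 16) ^+ 2)); first by nra.
by rewrite lerXn2r ?nnegrE ?expR_ge0//; lra.
Qed.

Let psi_pow n y (v w : R) : 0 <= 1 + y / sq n.+1 ->
  1 + y / sq n.+1 <= expR (y / sq n.+1 - v) -> n.+1%:R * v = w ->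
  psi n.+1 y <= expR (- w).
Proof.
move=> h0 h <-; rewrite /psi -/(sq _).
apply: (@le_trans _ _ (expR (y / sq n.+1 - v) ^+ n.+1 * expR (- (y * sq n.+1)))).
  by rewrite ler_wpM2r ?expR_ge0// lerXn2r ?nnegrE ?expR_ge0.
rewrite -expRM_natl -expRD ler_expR le_eqVlt; apply/orP; left; apply/eqP.
rewrite mulrBr -sqE.
have := sq_gt0 n; set N := sq n.+1 => N0.
by field; rewrite gt_eqF.
Qed.

(* Dominates every [psi0 n.+1]: Gaussian decay for [|y| <= sqrt n], exponential
   decay beyond. *)
Definition dom y : R :=
  expR 1 * 8 * exponential_pdf 8^-1 y + (normal_peak (Num.sqrt 2))^-1 * normal_pdf 0 (Num.sqrt 2) y.

Let s2 : Num.sqrt 2 != 0 :> R.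
Proof. by rewrite gt_eqF// sqrtr_gt0. Qed.

Let normE y : (normal_peak (Num.sqrt 2))^-1 * normal_pdf 0 (Num.sqrt 2) y = expR (- (y ^+ 2 / 4)).
Proof.
rewrite normal_pdfE// mulKf; last by rewrite gt_eqF// normal_peak_gt0.
by rewrite /normal_fun subr0 sqr_sqrtr//; congr expR; field.
Qed.

Lemma psi0_ge0 n y : 0 <= psi0 n.+1 y.
Proof.
rewrite /psi0; case: ifPn => // ny; rewrite mulr_ge0 ?expR_ge0// exprn_ge0//.
by rewrite -lerBlDl sub0r ler_pdivlMr// mulN1r.
Qed.

Lemma psi0_le_dom n y : psi0 n.+1 y <= dom y.
Proof.
rewrite /dom normE.
have e0 : 0 <= exponential_pdf 8^-1 y by apply: exponential_pdf_ge0.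
have e1 : 0 <= expR 1 * 8 * exponential_pdf 8^-1 y by rewrite !mulr_ge0 ?expR_ge0.
rewrite /psi0; case: ifPn => [ny|_]; last by rewrite addr_ge0 ?expR_ge0.
have N0 := sq_gt0 n; have N1 := sq_ge1 n.
have h0 : 0 <= 1 + y / sq n.+1 by rewrite -lerBlDl sub0r ler_pdivlMr// mulN1r.
(* The Gaussian part of [dom] serves [y < 0], the exponential part [y >= 0]. *)
have [y0|y0] := leP 0 y; last first.
  apply: ler_wpDl => //.
  apply: (@psi_pow n y ((y / sq n.+1) ^+ 2 / 4)) => //; last first.
    by rewrite expr_div_n sqE; field; rewrite nat1r pnatr_eq0.
  apply: one_plus_le_neg; rewrite -lerBlDl sub0r in h0; rewrite h0 /=.
  by rewrite pmulr_lle0 ?invr_gt0// ltW.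
rewrite exponential_pdfE//=.
apply: ler_wpDr; first exact: expR_ge0.
apply: (@le_trans _ _ (expR (1 - y / 8))); last first.
  rewrite expRD -mulrA ler_wpM2l ?expR_ge0// mulrA mulfV// mul1r ler_expR; lra.
have [yN|Ny] := leP y (sq n.+1).
  apply: (@le_trans _ _ (expR (- (y ^+ 2 / 9)))); last by rewrite ler_expR; nra.
  apply: (@psi_pow n y ((y / sq n.+1) ^+ 2 / 9)) => //; last first.
    by rewrite expr_div_n sqE; field; rewrite nat1r pnatr_eq0.
  by apply: one_plus_le_pos; rewrite divr_ge0 ?(ltW N0)//= ler_pdivrMr// mul1r.
apply: (@le_trans _ _ (expR (- (y * sq n.+1 / 8)))); last by rewrite ler_expR; nra.
apply: (@psi_pow n y (y / sq n.+1 / 8)) => //.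
  by apply: one_plus_le_large; rewrite ler_pdivlMr// mul1r ltW.
by rewrite -sqE; field; rewrite gt_eqF.
Qed.

Lemma integrable_dom : lebesgue_measure.-integrable setT (EFin \o dom).
Proof.
rewrite (_ : EFin \o dom = (fun y => (expR 1 * 8)%:E * (exponential_pdf 8^-1 y)%:E) \+
  (fun y => (normal_peak (Num.sqrt 2))^-1%:E * (normal_pdf 0 (Num.sqrt 2) y)%:E))%E; last by [].
apply: integrableD => //; apply: integrableZl => //.
  by apply: integrable_exponential_pdf; rewrite invr_gt0.
exact: integrable_normal_pdf.
Qed.

Definition gauss y : R := expR (- (y ^+ 2 / 2)).

Lemma psi0_cvg y : psi0 n.+1 y @[n --> \oo] --> gauss y.
Proof.
(* [n.+1] times the Taylor remainder of the logarithm, of order [|y| ^+ 3 / sqrt n]. *)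
pose r n := n.+1%:R * (ln (1 + y / sq n.+1) - (y / sq n.+1 - (y / sq n.+1) ^+ 2 / 2)).
have sqoo : sq n.+1 @[n --> \oo] --> +oo.
  apply/cvgryPge => A; near=> n.
  have : A ^+ 2 <= n.+1%:R.
    near: n; have /cvgryPge/(_ (A ^+ 2)) := @cvgr_idn R.
    move=> [m _ hm]; exists m => // n /= mn; rewrite (le_trans (hm _ mn))// ler_nat.
    exact: leqnSn.
  move=> h; have [A0|A0] := leP A 0; first by rewrite (le_trans A0)// ltW.
  by rewrite -[leLHS](ger0_norm (ltW A0)) -sqrtr_sqr ler_sqrt// ler0n.
have isq0 : (sq n.+1)^-1 @[n --> \oo] --> 0.
  by apply/gtr0_cvgV0 => //; apply: nearW => n; exact: sq_gt0.
have small : \forall n \near \oo, `|y| / sq n.+1 <= 2^-1.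
  have /cvgryPge/(_ (2 * `|y|)) := sqoo; apply: filterS => n h.
  by rewrite ler_pdivrMr//; lra.
have r0 : r n @[n --> \oo] --> 0.
  apply/norm_cvg0P; apply: (@squeeze_cvgr _ _ _ _ (fun=> 0) (fun n => 2 * `|y| ^+ 3 * (sq n.+1)^-1)).
  - near=> n; rewrite normr_ge0 /=.
    have h : `|y| / sq n.+1 <= 2^-1 by near: n.
    have N0 := sq_gt0 n.
    have u2 : `|y / sq n.+1| <= 2^-1 by rewrite normrM normfV (gtr0_norm N0).
    rewrite /r normrM ger0_norm//; apply: (@le_trans _ _ (n.+1%:R * (2 * `|y / sq n.+1| ^+ 3))).
      by rewrite ler_wpM2l//; exact: ln1p_taylor2.
    rewrite normrM normfV (gtr0_norm N0) -sqE le_eqVlt; apply/orP; left; apply/eqP.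
    by field; rewrite gt_eqF.
  - exact: cvg_cst.
  - rewrite -[X in _ --> X](mulr0 (2 * `|y| ^+ 3)); apply: cvgM => //; exact: cvg_cst.
have lim : expR (- (y ^+ 2 / 2) + r n) @[n --> \oo] --> gauss y.
  have h : - (y ^+ 2 / 2) + r n @[n --> \oo] --> - (y ^+ 2 / 2) + 0.
    by apply: cvgD => //; exact: cvg_cst.
  by rewrite addr0 in h; have := cvg_comp _ _ h (@continuous_expR R _).
apply: cvg_trans lim; apply: near_eq_cvg; near=> n.
have h : `|y| / sq n.+1 <= 2^-1 by near: n.
have N0 := sq_gt0 n.
have u2 : `|y / sq n.+1| <= 2^-1 by rewrite normrM normfV (gtr0_norm N0).
have u1 : 0 < 1 + y / sq n.+1 by move: u2; rewrite ler_norml => /andP[]; lra.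
rewrite /psi0 -/(sq _) ifT; last first.
  by move: u1; rewrite -ltrBlDl sub0r ltr_pdivlMr// mulN1r => /ltW.
have pE : (1 + y / sq n.+1) ^+ n.+1 = expR (n.+1%:R * ln (1 + y / sq n.+1)).
  by rewrite expRM_natl lnK// posrE.
rewrite /psi -/(sq _) /r pE -expRD; congr expR.
rewrite -sqE; move: N0; set N := sq n.+1 => N0; field; rewrite gt_eqF//.
Unshelve. all: by end_near.
Qed.

Let cont_psi n : continuous (psi n.+1).
Proof.
move=> y; rewrite /psi -/(sq _).
apply: cvgM.
  apply: (@cvg_comp _ _ _ (fun y => 1 + y / sq n.+1) (fun x => x ^+ n.+1)); last exact: exprn_continuous.
  apply: cvgD; first exact: cvg_cst.
  by apply: cvgM; [exact: cvg_id|exact: cvg_cst].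
apply: (@cvg_comp _ _ _ (fun y => - (y * sq n.+1)) expR); last exact: continuous_expR.
by apply: cvgN; apply: cvgM; [exact: cvg_id|exact: cvg_cst].
Qed.

Lemma measurable_psi0 n : measurable_fun setT (psi0 n.+1).
Proof.
apply: measurable_fun_if => //.
- exact: measurable_fun_ler.
- by apply: measurable_funTS; apply: continuous_measurable_fun; exact: cont_psi.
Qed.

Lemma cvg_integral_psi0 (D : set (measurableTypeR R)) : measurable D ->
  (\int[lebesgue_measure]_(y in D) (psi0 n.+1 y)%:E)%E @[n --> \oo] -->
  (\int[lebesgue_measure]_(y in D) (gauss y)%:E)%E.
Proof.
move=> mD.
have [] := @dominated_convergence _ _ R (@lebesgue_measure R) D mD
  (fun n y => (psi0 n.+1 y)%:E) (fun y => (gauss y)%:E) (EFin \o dom).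
- by move=> n; apply/measurable_EFinP; apply: measurable_funTS; exact: measurable_psi0.
- apply/measurable_EFinP; apply: measurable_funTS.
  apply: continuous_measurable_fun => y; rewrite /gauss.
  apply: (@cvg_comp _ _ _ (fun y => - (y ^+ 2 / 2)) expR); last exact: continuous_expR.
  apply: cvgN; apply: cvgM; [exact: exprn_continuous|exact: cvg_cst].
- by apply: aeW => y _; apply: cvg_EFin; [exact: nearW|exact: psi0_cvg].
- by apply: integrableS integrable_dom.
- apply: aeW => y n _; rewrite /= lee_fin ger0_norm ?psi0_ge0//; exact: psi0_le_dom.
by move=> _ _.
Qed.

(* Unlike [pcdf], in which [poisson_pmf] is cut off for [l <= 0], this is smooth
   in [l] on the whole line. *)
Definition pois_tail n l : R := expR (- l) * \sum_(i < n.+1) l ^+ i / i`!%:R.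

Lemma pois_tailE n l : 0 < l -> pcdf l n = pois_tail n l.
Proof.
move=> l0; rewrite /pcdf /pois_tail big_distrr; apply: eq_bigr => i _ /=.
by rewrite poisson_pmfE// mulrC.
Qed.

(** The derivative telescopes to the top term alone, which makes the distribution function at [n] an
    integral of a Gamma density in the mean. *)
Lemma is_derive_pois_tail n l :
  is_derive l 1 (pois_tail n) (- (expR (- l) * (l ^+ n / n`!%:R))).
Proof.
have de : is_derive l (1 : R) (expR \o -%R) (- expR (- l)).
  have := @is_derive1_comp R expR -%R l _ _ (is_derive_expR _) (is_deriveN (is_derive_id l (1:R))).
  by rewrite mulrN1.
elim: n => [|n ih].
  rewrite (_ : pois_tail 0 = expR \o -%R); last first.
    apply/funext => x; rewrite /pois_tail big_ord_recl big_ord0 addr0 expr0 fact0 invr1 !mulr1//.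
  by rewrite expr0 fact0 invr1 !mulr1.
have di := is_derive_id l (1 : R).
have h := is_deriveD ih (is_deriveM de (is_deriveZ (n.+1)`!%:R^-1 (is_deriveX n.+1 di))).
rewrite (_ : pois_tail n.+1 = pois_tail n + (expR \o -%R) * ((n.+1)`!%:R^-1 \*: id ^+ n.+1)); last first.
  apply/funext => x; rewrite /pois_tail !fctE /= big_ord_recr /= mulrDr; congr (_ + _ * _).
  by rewrite -[_ *: _]/(_ * _) mulrC.
apply: (is_derive_eq h).
rewrite /= !fctE /= -![_ *: _]/(_ * _) mulr1 factS natrM exprS.
by field; rewrite nat1r !pnatr_eq0 -lt0n fact_gt0.
Qed.

Lemma pois_tail_ge0 n l : 0 <= l -> 0 <= pois_tail n l.
Proof.
move=> l0; rewrite mulr_ge0 ?expR_ge0//; apply: sumr_ge0 => i _.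
by rewrite divr_ge0// exprn_ge0.
Qed.

(** Supplies the limit 0 at infinity for [integral_psi0_itv]; each of the [n.+1] terms is at most
    [n.+1 / l]. *)
Lemma pois_tail_le n l : 0 < l -> pois_tail n l <= n.+1%:R ^+ 2 / l.
Proof.
move=> l0; rewrite /pois_tail big_distrr /= expr2 -mulrA.
apply: (@le_trans _ _ (\sum_(i < n.+1) (n.+1%:R / l))); last first.
  by rewrite sumr_const card_ord -(mulr_natl (n.+1%:R / l)).
apply: ler_sum => i _; rewrite ler_pdivlMr// expRN -mulrA ler_pdivrMl ?expR_gt0//.
have h := expR_ge1Dxn i (ltW l0).
have f0 : 0 < (i.+1)`!%:R :> R by rewrite ltr0n fact_gt0.
have g0 : 0 < i`!%:R :> R by rewrite ltr0n fact_gt0.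
apply: (@le_trans _ _ (l ^+ i.+1 / (i.+1)`!%:R * n.+1%:R)); last first.
  by rewrite ler_wpM2r//; lra.
have -> : l ^+ i.+1 / (i.+1)`!%:R * n.+1%:R = (l ^+ i / i`!%:R * l) * (n.+1%:R / i.+1%:R).
  by rewrite factS natrM exprSr; field; rewrite gt_eqF//= nat1r pnatr_eq0.
rewrite ler_peMr ?mulr_ge0 ?invr_ge0 ?exprn_ge0 ?(ltW l0)// ler_pdivlMr ?ltr0n// mul1r ler_nat.
by case: i {h f0 g0}.
Qed.

(** The factor that turns [psi] into a density. Its limit, which is Stirling's formula, is not
    computed: [pois_tail_cvg] eliminates it through the total mass. *)
Let kn n : R := sq n.+1 * (n.+1%:R ^+ n.+1 * expR (- n.+1%:R) / (n.+1)`!%:R).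

Let kn_gt0 n : 0 < kn n.
Proof. by rewrite !mulr_gt0 ?expR_gt0 ?exprn_gt0 ?ltr0n// invr_gt0 ltr0n fact_gt0. Qed.

Lemma integral_psi0_itv n a : - sq n.+1 <= a ->
  (\int[lebesgue_measure]_(y in `[a, +oo[) (kn n * psi0 n.+1 y)%:E =
   (pois_tail n.+1 (n.+1%:R + a * sq n.+1))%:E)%E.
Proof.
move=> na; have N0 := sq_gt0 n.
pose g y : R := n.+1%:R + y * sq n.+1.
pose F y := - pois_tail n.+1 (g y).
have dF y : is_derive y 1 F (kn n * psi n.+1 y).
  have dg : is_derive y (1:R) (cst n.+1%:R + (sq n.+1 \*: id) : R -> R) (sq n.+1).
    by apply: is_derive_eq; rewrite add0r -[_ *: _]/(_ * _) mulr1.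
  have h := is_deriveN (@is_derive1_comp R (pois_tail n.+1) _ y _ _ (is_derive_pois_tail n.+1 _) dg).
  rewrite (_ : F = - (pois_tail n.+1 \o (cst n.+1%:R + (sq n.+1 \*: id)))); last first.
    by apply/funext => z; rewrite /F /g !fctE /= -[_ *: _]/(_ * _) mulrC.
  apply: (is_derive_eq h); rewrite !fctE /= -![_ *: _]/(_ * _) /psi /kn -/(sq _).
  have -> : n.+1%:R + sq n.+1 * y = n.+1%:R * (1 + y / sq n.+1).
    by rewrite -sqE; field; rewrite gt_eqF.
  rewrite exprMn mulrDr mulr1 opprD expRD.
  have -> : n.+1%:R * (y / sq n.+1) = y * sq n.+1 by rewrite -sqE; field; rewrite gt_eqF.
  by field; rewrite pnatr_eq0 -lt0n fact_gt0.
have cF : continuous F.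
  move=> y; apply: differentiable_continuous; apply/derivable1_diffP.
  by have [] := dF y.
transitivity (\int[lebesgue_measure]_(y in `[a, +oo[) (kn n * psi n.+1 y)%:E)%E.
  apply: eq_integral => y; rewrite inE /= in_itv /= andbT => ay.
  by rewrite /psi0 -/(sq _) (le_trans na ay).
rewrite (@ge0_continuous_FTC2y _ _ F a 0).
- by rewrite sub0e /F EFinN oppeK.
- move=> x ax; rewrite mulr_ge0 ?(ltW (kn_gt0 n))// mulr_ge0 ?expR_ge0// exprn_ge0//.
  by rewrite -/(sq _) -lerBlDl sub0r ler_pdivlMr// mulN1r (le_trans na).
- apply: continuous_subspaceT => y; apply: cvgM; [exact: cvg_cst|exact: cont_psi].
- apply/norm_cvg0P; apply: (@squeeze_cvgr _ _ _ _ (fun=> 0) (fun y => n.+2%:R ^+ 2 / sq n.+1 * y^-1)).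
  + near=> y; rewrite normr_ge0 /= normrN.
    have y0 : 0 < y by near: y; exact: nbhs_pinfty_gt.
    have ys : 0 < y * sq n.+1 by rewrite mulr_gt0.
    have g0 : 0 < g y by rewrite addr_gt0// ltr0n.
    rewrite ger0_norm; last by apply: pois_tail_ge0; exact: ltW.
    apply: le_trans (pois_tail_le _ g0) _; rewrite -mulrA ler_wpM2l ?sqr_ge0//.
    by rewrite -invfM mulrC lef_pV2 ?posrE// lerDr.
  + exact: cvg_cst.
  + have h : n.+2%:R ^+ 2 / sq n.+1 * y^-1 @[y --> +oo] --> n.+2%:R ^+ 2 / sq n.+1 * 0.
      apply: cvgM; first exact: cvg_cst.
      by apply/gtr0_cvgV0; [exact: nbhs_pinfty_gt|exact: cvg_id].
    by rewrite mulr0 in h.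
- by move=> x _; have [] := dF x.
- by apply: cvg_at_right_filter; exact: cF.
- by move=> x _; rewrite derive1E; have [_ ->] := dF x.
Unshelve. all: by end_near.
Qed.

Let measurable_gauss : measurable_fun setT gauss.
Proof.
apply: continuous_measurable_fun => y; rewrite /gauss.
apply: (@cvg_comp _ _ _ (fun y => - (y ^+ 2 / 2)) expR); last exact: continuous_expR.
apply: cvgN; apply: cvgM; [exact: exprn_continuous|exact: cvg_cst].
Qed.

Let pdfE y : normal_pdf 0 1 y = normal_peak 1 * gauss y :> R.
Proof.
rewrite normal_pdfE ?oner_eq0// /normal_fun subr0 expr1n /gauss.
by congr (_ * expR _); field.
Qed.

Let peak0 : 0 < normal_peak 1 :> R. Proof. by rewrite normal_peak_gt0// oner_eq0. Qed.

Let gauss_int (D : set (measurableTypeR R)) : measurable D ->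
  ((normal_peak 1)%:E * \int[lebesgue_measure]_(y in D) (gauss y)%:E =
   normal_prob 0 1 D)%E.
Proof.
move=> mD; rewrite -ge0_integralZl_EFin//; last first.
- exact: ltW.
- by apply/measurable_EFinP; apply: measurable_funTS.
- by move=> y _; rewrite lee_fin expR_ge0.
by apply: eq_integral => y _; rewrite pdfE EFinM.
Qed.

Let gauss_fin (D : set (measurableTypeR R)) : measurable D ->
  exists2 r : R, (\int[lebesgue_measure]_(y in D) (gauss y)%:E)%E = r%:E &
   normal_peak 1 * r = fine (normal_prob 0 1 D).
Proof.
move=> mD; have := gauss_int mD.
have : normal_prob 0 1 D \is a fin_num by exact: fin_num_measure.
have : (0 <= \int[lebesgue_measure]_(y in D) (gauss y)%:E)%E.
  by apply: integral_ge0 => y _; rewrite lee_fin expR_ge0.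
case: (\int[lebesgue_measure]_(y in D) (gauss y)%:E)%E => [r| |]// _ fin.
  by move=> <-; exists r.
by rewrite gt0_muley ?lte_fin// => h; move: fin; rewrite -h.
Qed.

(** The tail is the ratio of the integral of [psi0] over a half-line to that over the whole line, so
    [kn n] cancels; both integrals converge by dominated convergence. *)
Lemma pois_tail_cvg a :
  pois_tail n.+1 (n.+1%:R + a * sq n.+1) @[n --> \oo] -->
  fine (normal_prob 0 1 `[a, +oo[).
Proof.
have mT : measurable (setT : set (measurableTypeR R)) by [].
have ma : measurable (`[a, +oo[%classic : set (measurableTypeR R)) by exact: measurable_itv.
have [J JE Jp] := gauss_fin mT.
have [I IE Ip] := gauss_fin ma.
have J1 : J = (normal_peak 1)^-1.
  apply: (mulfI (lt0r_neq0 peak0)); rewrite Jp divff ?lt0r_neq0//.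
  by rewrite probability_setT.
(* At [a = - sqrt n] the Poisson mean is 0 and the distribution function is 1. *)
have JN n : (\int[lebesgue_measure]_(y in setT) (kn n * psi0 n.+1 y)%:E = 1)%E.
  have <- : pois_tail n.+1 (n.+1%:R + (- sq n.+1) * sq n.+1) = 1.
    rewrite mulNr -expr2 sqE subrr /pois_tail oppr0 expR0 mul1r big_ord_recl.
    rewrite expr0 fact0 divr1 big1 ?addr0// => i _; by rewrite expr0n /= mul0r.
  rewrite -integral_psi0_itv// integral_mkcond [RHS]integral_mkcond; apply: eq_integral => y _.
  rewrite !patchE in_setT; case: ifPn => // yN.
  rewrite /psi0 -/(sq _) ifF ?mulr0//; apply: contraNF yN => h.
  by rewrite inE /= in_itv /= andbT.
have mp (D : set (measurableTypeR R)) n : measurable D ->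
   ((kn n)%:E * \int[lebesgue_measure]_(y in D) (psi0 n.+1 y)%:E =
    \int[lebesgue_measure]_(y in D) (kn n * psi0 n.+1 y)%:E)%E.
  move=> mD; rewrite -ge0_integralZl_EFin//.
  - by move=> y _; rewrite lee_fin psi0_ge0.
  - by apply/measurable_EFinP; apply: measurable_funTS; exact: measurable_psi0.
  - exact: ltW.
have cJ := cvg_integral_psi0 mT; rewrite JE in cJ.
have cI := cvg_integral_psi0 ma; rewrite IE in cI.
have cJ' := fine_cvg cJ; have cI' := fine_cvg cI.
have sqoo : \forall n \near \oo, - sq n.+1 <= a.
  have /cvgryPge/(_ (a ^+ 2)) := @cvgr_idn R.
  apply: filterS => n h; rewrite lerNl; apply: (@le_trans _ _ `|a|).
    by rewrite -normrN ler_norm.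
  by rewrite -sqrtr_sqr ler_sqrt ?ler0n// (le_trans h)// ler_nat.
have J0 : J != 0 by rewrite J1 invr_neq0// lt0r_neq0.
have lim : fine (\int[lebesgue_measure]_(y in `[a, +oo[) (psi0 n.+1 y)%:E)%E /
   fine (\int[lebesgue_measure]_(y in setT) (psi0 n.+1 y)%:E)%E @[n --> \oo] --> I / J.
  by apply: cvgM; [exact: cI'|apply: cvgV; [exact: J0|exact: cJ']].
rewrite -Ip mulrC -[normal_peak 1]invrK -J1.
apply: cvg_trans lim; apply: near_eq_cvg; near=> n.
have na : - sq n.+1 <= a by near: n.
have := JN n; rewrite -(mp _ n mT).
have := integral_psi0_itv na; rewrite -(mp _ n ma).
have kn0 := kn_gt0 n.
have i0 D : (0 <= \int[lebesgue_measure]_(y in D) (psi0 n.+1 y)%:E)%E.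
  by apply: integral_ge0 => y _; rewrite lee_fin psi0_ge0.
case: (\int[lebesgue_measure]_(y in `[a, +oo[) (psi0 n.+1 y)%:E)%E (i0 `[a, +oo[%classic) => [x| |]// _;
  last by rewrite gt0_muley ?lte_fin.
rewrite -EFinM => -[E1].
case: (\int[lebesgue_measure]_(y in setT) (psi0 n.+1 y)%:E)%E (i0 setT) => [z| |]// _;
  last by rewrite gt0_muley ?lte_fin.
rewrite -EFinM => -[E2] /=.
have z0 : z != 0 by apply/eqP => z0; move: E2; rewrite z0 mulr0 => /esym/eqP; rewrite oner_eq0.
rewrite -E1 (_ : kn n = z^-1) 1?mulrC//.
by apply: (mulIf z0); rewrite E2 mulVf.
Unshelve. all: by end_near.
Qed.

Lemma normal_prob_sym t :
  normal_prob 0 1 `[- t, +oo[ = normal_prob 0 1 `]-oo, t] :> \bar R.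
Proof.
rewrite /normal_prob -[in RHS](opprK t) ge0_integration_by_substitutionNy.
- by apply: eq_integral => y _; rewrite /= !pdfE /gauss sqrrN.
- by apply: continuous_subspaceT; apply: continuous_normal_pdf; rewrite oner_eq0.
- by move=> x _; exact: normal_pdf_ge0.
Qed.

Lemma pois_tail_antitone n l l' : 0 <= l -> l <= l' -> pois_tail n l' <= pois_tail n l.
Proof.
move=> l0 ll.
have [|c] := @MVT_segment _ (pois_tail n) _ l l' ll (fun z _ => is_derive_pois_tail n z).
  by apply: derivable_within_continuous => z _; have [] := is_derive_pois_tail n z.
rewrite in_itv /= => /andP[lc _] E; rewrite -subr_le0 E mulr_le0_ge0 ?subr_ge0//.
rewrite oppr_le0 mulr_ge0 ?expR_ge0// divr_ge0// exprn_ge0//; exact: le_trans lc.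
Qed.

Definition Phi t : R := fine (normal_prob 0 1 `]-oo, t]).

(** In [pois_tail_cvg] the mean is a function of [n]; here [n] is a function of the mean [l]. As
    [l = n - t sqrt n + O(1)], monotonicity in the mean encloses [l] between the means for [t + del]
    and [t - del]. *)
Lemma poisson_clt t (del : R) : 0 < del -> exists L : R, forall l, L <= l ->
  Phi (t - del) - del <= pcdf l (Num.truncn (l + t * Num.sqrt l)) <= Phi (t + del) + del.
Proof.
move=> d0.
have /cvgrPdist_le/(_ _ d0)[n1 _ h1] := @pois_tail_cvg (- (t - del)).
have /cvgrPdist_le/(_ _ d0)[n2 _ h2] := @pois_tail_cvg (- (t + del)).
rewrite !normal_prob_sym -/(Phi _) in h1 h2.
(* Bounds [|t * (sqrt n - sqrt l)| + 1], where the 1 accounts for truncation. *)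
pose A := `|t| * (`|t| + 1) + 1.
(* A lower bound for [sqrt n]: the summands ensure [A <= del * sqrt n], a nonnegative mean for
   [t + del], and [n] beyond both thresholds. *)
pose M := A / del + `|t + del| + `|t - del| + n1%:R + n2%:R + 2.
have t0 : 0 <= `|t| by [].
have A0 : 0 <= A by rewrite /A; nra.
have Ad0 : 0 <= A / del by rewrite divr_ge0// ltW.
have M2 : 2 <= M.
  rewrite /M; have := normr_ge0 (t + del); have := normr_ge0 (t - del).
  have : 0 <= n1%:R :> R by []. have : 0 <= n2%:R :> R by []. lra.
exists ((`|t| + M ^+ 2 + 2) ^+ 2) => l Ll.
have B0 : 0 <= `|t| + M ^+ 2 + 2 by rewrite addr_ge0 ?addr_ge0 ?sqr_ge0.
have l0 : 0 < l by apply: lt_le_trans Ll; rewrite exprn_gt0//; have := sqr_ge0 M; lra.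
set x := Num.sqrt l.
have xx : x ^+ 2 = l by rewrite sqr_sqrtr// ltW.
have x0 : 0 < x by rewrite sqrtr_gt0.
have xB : `|t| + M ^+ 2 + 2 <= x.
  by rewrite -[leLHS](ger0_norm B0) -sqrtr_sqr ler_sqrt// ltW.
have tN : - `|t| <= t <= `|t| by rewrite -ler_norml.
have /andP[tN1 tN2] := tN.
have big : M ^+ 2 + 1 <= l + t * x by rewrite -xx; nra.
have y0 : 0 <= l + t * x by have := sqr_ge0 M; lra.
set n := Num.truncn (l + t * x).
have /andP[nle nlt] : n%:R <= l + t * x < n.+1%:R.
  by have := truncn_itv y0.
have nM : M ^+ 2 <= n%:R by move: nlt; rewrite -natr1; lra.
have [m nE] : exists m, n = m.+1.
  by exists n.-1; rewrite prednK// -(ltr0n R); nra.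
have sM : M <= sq n.
  rewrite -[leLHS]ger0_norm; last by lra.
  by rewrite -sqrtr_sqr ler_sqrt.
have N0 : 0 < sq n by rewrite nE sq_gt0.
have NN := sqE n.
have Mn : M <= n%:R by nra.
have mM : n1%:R + n2%:R <= m%:R :> R.
  move: Mn; rewrite nE -natr1 /M; have := normr_ge0 (t + del); have := normr_ge0 (t - del); lra.
have n1m : (n1 <= m)%N by rewrite -(ler_nat R); have : 0 <= n2%:R :> R by []; lra.
have n2m : (n2 <= m)%N by rewrite -(ler_nat R); have : 0 <= n1%:R :> R by []; lra.
have AN : A <= del * sq n.
  rewrite mulrC -ler_pdivrMr//; apply: le_trans sM; rewrite /M.
  have := normr_ge0 (t + del); have := normr_ge0 (t - del).
  have : 0 <= n1%:R :> R by []. have : 0 <= n2%:R :> R by []. lra.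
have diff : `|sq n - x| <= `|t| + 1.
  have E : (sq n - x) * (sq n + x) = n%:R - l by rewrite -NN -xx; ring.
  have S0 : 0 < sq n + x by rewrite addr_gt0.
  rewrite -(ler_pM2r S0) -{1}(gtr0_norm S0) -normrM E ler_norml; apply/andP; split.
    move: nlt; rewrite -natr1; nra.
  nra.
have td : `|t * (sq n - x)| + 1 <= del * sq n.
  apply: le_trans AN; rewrite normrM /A lerD2r ler_wpM2l//.
have /andP[td1 td2] : - (del * sq n - 1) <= t * (sq n - x) <= del * sq n - 1.
  by rewrite -ler_norml; lra.
rewrite -/n pois_tailE// nE.
have low : 0 <= n%:R + (- (t + del)) * sq n.
  have := ler_norm (t + del).
  have : `|t + del| <= sq n.
    apply: le_trans sM; rewrite /M; have := normr_ge0 (t - del).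
    have : 0 <= n1%:R :> R by []. have : 0 <= n2%:R :> R by []. lra.
  rewrite -NN; nra.
have lhs : n%:R + (- (t + del)) * sq n <= l by move: nle nlt; rewrite -natr1; nra.
have rhs : l <= n%:R + (- (t - del)) * sq n by move: nle nlt; rewrite -natr1; nra.
have := h1 m n1m; have := h2 m n2m; rewrite /= -!nE !ler_distlC => /andP[_ b2] /andP[b1 _].
have := pois_tail_antitone n low lhs; have := pois_tail_antitone n (ltW l0) rhs.
move=> c1 c2; apply/andP; split.
  exact: le_trans b1 c1.
exact: le_trans c2 b2.
Qed.

End poisson_clt.

(** * The law of the degree counts *)

Section sample.
Context dO d (Omega : measurableType dO) (T : measurableType d) (R : realType).
Variables (P : probability Omega R) (mu : probability T R).
Variable X : nat -> {RV P >-> T}.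
Hypothesis X_iid : iid_with_law mu X.

Definition sample n (w : Omega) : n.-tuple T := [tuple X i w | i < n].

Lemma measurable_sample n : measurable_fun setT (sample n).
Proof.
apply/measurable_fun_tnthP => i; rewrite (_ : _ \o _ = X i) //.
by apply/funext => w /=; rewrite tnth_mktuple.
Qed.

HB.instance Definition _ n :=
  isMeasurableFun.Build _ _ _ _ (sample n) (@measurable_sample n).

Lemma sample_law n A : measurable A -> P (sample n @^-1` A) = mpow mu n A.
Proof.
move=> mA.
transitivity (distribution P (sample n) A); first by [].
apply: box_measure_unique mA => B mB; rewrite mpow_box//.
pose B' i := if insub i is Some l then B l else setT.
have mB' i : measurable (B' i) by rewrite /B'; case: insubP.
have [law indep] := X_iid.
transitivity (P (\bigcap_(i in `I_n) (X i @^-1` B' i))).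
  rewrite /distribution /= /pushforward; congr (P _); apply/seteqP; split => w /= h i.
    by move=> ni; rewrite /B' insubT/=; have := h (Ordinal ni); rewrite tnth_mktuple.
  by have := h i (ltn_ord i); rewrite /B' valK tnth_mktuple.
rewrite indep//; apply: eq_bigr => i _; rewrite law//.
by rewrite /B' valK.
Qed.

Lemma sigma_gen_sample n A : measurable A -> sigma_gen X setT (sample n @^-1` A).
Proof.
have [h0 hD hU] : sigma_algebra setT (sigma_gen X setT) by exact: smallest_sigma_algebra.
apply: (@smallest_sub _ _ _ [set B | sigma_gen X setT (sample n @^-1` B)]).
  split => /=.
  - by rewrite preimage_set0.
  - by move=> B sB; rewrite setTD preimage_setC -setTD; exact: hD.
  - by move=> B sB; rewrite preimage_bigcup; exact: hU.
rewrite -bigcup_seq => C [i _] [B mB <-] /=; apply: sub_sigma_algebra.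
exists i => //; exists B => //; apply/seteqP; split => w /=; rewrite tnth_mktuple//.
by move=> [].
Qed.

Variable E : set Omega.
Hypothesis mE : measurable E.
Hypothesis indepE : forall B, sigma_gen X setT B -> P (E `&` B) = (P E * P B)%E.

(** By independence, [P] restricted to [E] has image [P E] times [mpow mu n] under the sample. *)
Lemma integral_sample n (h : n.-tuple T -> R) : bm h -> (forall t, 0 <= h t) ->
  (\int[P]_(w in E) (h (sample n w))%:E = P E * (\int[mpow mu n]_t h t)%:E)%E.
Proof.
move=> bh h0.
have mh : measurable_fun setT (EFin \o h) by case: bh => ? _; apply/measurable_EFinP.
have mhs : measurable_fun setT (fun w => (h (sample n w))%:E).
  exact: (measurableT_comp mh (@measurable_sample n)).
transitivity (\int[mrestr P mE]_(w in setT) (h (sample n w))%:E)%E.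
  rewrite [RHS](@ge0_negligible_integral _ _ _ _ _ (~` E))//=; last 3 first.
  - exact: measurableC.
  - by move=> w _; rewrite lee_fin.
  - by rewrite /mrestr setICl measure0.
  rewrite setTD setCK; apply: eq_measure_integral => A mA AE.
  by rewrite -[X in P X = _](setIidl AE).
transitivity (\int[pushforward (mrestr P mE) (sample n)]_(t in setT) (h t)%:E)%E.
  rewrite (@ge0_integral_pushforward _ _ _ _ _ (sample n))//.
  by move=> t _; rewrite lee_fin.
have PE0 : 0 <= fine (P E) by rewrite fine_ge0.
rewrite (@eq_measure_integral _ _ _ _ (mscale (NngNum PE0) (mpow mu n))); last first.
  move=> A mA _.
  transitivity (P (E `&` (sample n @^-1` A))); first by rewrite setIC.
  rewrite indepE; last exact: sigma_gen_sample.
  rewrite sample_law//; congr (_ * _)%E; apply/esym/fineK; exact: fin_num_measure.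
rewrite ge0_integral_mscale//=; last by move=> t _; rewrite lee_fin.
rewrite [in RHS]EFin_Rint//; congr (_ * _)%E; apply/fineK; exact: fin_num_measure.
Qed.

End sample.

Lemma ltn_ord_neq n (i l : 'I_n) : (i < l)%N -> i != l.
Proof. by apply: contraTneq => ->; rewrite ltnn. Qed.

(** * From random graphs to edge configurations *)

Section edges_of_graph.
Variable n : nat.

(** The condition [p.1 < p.2] selects the ordering on which [random_connection_graph] prescribes the
    law. *)
Definition graph_edges_of (g : rel nat) : edges n :=
  [ffun A : {set 'I_n} =>
    if [pick p : 'I_n * 'I_n | (p.1 < p.2)%N && (A == [set p.1; p.2]%SET)]
    is Some p then g p.1 p.2 else false].

Lemma graph_edges_ofE (g : rel nat) (i l : 'I_n) : symmetric g ->
  (i != l) -> graph_edges_of g [set i; l]%SET = g i l.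
Proof.
move=> gs il; rewrite ffunE; case: pickP => [[a b] /= /andP[ab /eqP E]|h].
  have : a \in [set i; l]%SET by rewrite E set21.
  have : b \in [set i; l]%SET by rewrite E set22.
  rewrite !inE => /orP[]/eqP be /orP[]/eqP ae; move: ab; rewrite ae be ?ltnn//.
have [il'|li|E] := ltngtP i l.
- by have := h (i, l); rewrite /= il' eqxx.
- by have := h (l, i); rewrite /= li finset.setUC eqxx.
- by move: il; rewrite (ord_inj E) eqxx.
Qed.

Lemma degree_deg (g : rel nat) (i : 'I_n) : symmetric g -> irreflexive g ->
  degree n g i = deg [set: _]%SET (graph_edges_of g) i.
Proof.
move=> gs gi; apply: eq_card => l; rewrite !inE /=.
have [->|li] := eqVneq l i; first by rewrite gi.
by rewrite graph_edges_ofE// eq_sym.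
Qed.

Lemma num_deg_Dk (g : rel nat) k : symmetric g -> irreflexive g ->
  num_deg n g k = Dk k [set: _]%SET (graph_edges_of g).
Proof. by move=> gs gi; apply: eq_card => i; rewrite !inE -degree_deg. Qed.

Lemma graph_edges_ofP (g : rel nat) (e : edges n) : symmetric g ->
  (forall A, e A -> exists i l : 'I_n, i != l /\ A = [set i; l]%SET) ->
  (forall i l : 'I_n, (i < l)%N -> g i l = e [set i; l]%SET) <->
  graph_edges_of g = e.
Proof.
move=> gs ve; split => [h|<- i l il]; last first.
  by rewrite graph_edges_ofE//; exact: ltn_ord_neq.
apply/ffunP => A; rewrite ffunE; case: pickP => [[a b] /= /andP[ab /eqP ->]|hA].
  exact: h.
apply/esym/negbTE/negP => eA; have [i [l [il E]]] := ve _ eA.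
have [il'|li|E'] := ltngtP i l.
- by have := hA (i, l); rewrite /= il' E eqxx.
- by have := hA (l, i); rewrite /= li E finset.setUC eqxx.
- by move: il; rewrite (ord_inj E') eqxx.
Qed.

(** A set that is not a pair contributes the factor 1, as [edge_prob] vanishes there and [e] is
    false. *)
Lemma bwt_pairs d (T : measurableType d) (R : realType) (phi : T -> T -> R)
    (cf : connection_function phi) (t : n.-tuple T) (e : edges n) :
  (forall A, e A -> exists i l : 'I_n, i != l /\ A = [set i; l]%SET) ->
  bwt (edge_prob phi t) e =
  \prod_(i < n) \prod_(l < n | (i < l)%N)
    (if e [set i; l]%SET then phi (tnth t i) (tnth t l)
     else 1 - phi (tnth t i) (tnth t l)).
Proof.
move=> ve; rewrite pair_big_dep /=.
pose h (p : 'I_n * 'I_n) := [set p.1; p.2]%SET.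
pose Dp := [pred p : 'I_n * 'I_n | (p.1 < p.2)%N].
have hI : {in Dp &, injective h}.
  move=> [a b] [a' b'] /= ab ab'; rewrite !inE /= in ab ab'; rewrite /h /= => E.
  have : a \in [set a'; b']%SET by rewrite -E set21.
  have : b \in [set a'; b']%SET by rewrite -E set22.
  rewrite !inE => /orP[]/eqP be /orP[]/eqP ae; move: ab ab'; rewrite ae be ?ltnn//.
  by move=> x1 x2; have := ltn_trans x1 x2; rewrite ltnn.
transitivity (\prod_(A in h @: Dp) (if e A then edge_prob phi t A else 1 - edge_prob phi t A)).
  rewrite /bwt [RHS]big_mkcond /=; apply: eq_bigr => A _.
  case: (boolP (A \in _)) => // nA.
  have nA' i l : i != l -> A != [set i; l]%SET.
    move=> il; apply: contra nA => /eqP ->.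
    have [il'|li|E] := ltngtP i l.
    - by apply/imsetP; exists (i, l).
    - by apply/imsetP; exists (l, i) => //; rewrite /h finset.setUC.
    - by move: il; rewrite (ord_inj E) eqxx.
  rewrite ifF; last first.
    by apply/negP => eA; have [i [l [il E]]] := ve _ eA; have := nA' _ _ il; rewrite E eqxx.
  by rewrite edge_prob_non// subr0.
rewrite big_imset//=; apply: eq_bigr => -[i l] /= il.
by rewrite /h /= (edge_probE cf)//; exact: ltn_ord_neq.
Qed.

End edges_of_graph.

Section graph_law.
Context dO d (Omega : measurableType dO) (T : measurableType d) (R : realType).
Variables (P : probability Omega R) (mu : probability T R).
Variables (X : nat -> {RV P >-> T}) (phi : T -> T -> R).
Variables (N : Omega -> nat) (G : Omega -> rel nat).
Hypotheses (X_iid : iid_with_law mu X) (cf : connection_function phi).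
Hypothesis mN : forall n, measurable (N @^-1` [set n]).
Hypothesis N_indep : forall n B, sigma_gen X setT B ->
  P (N @^-1` [set n] `&` B) = (P (N @^-1` [set n]) * P B)%E.
Hypothesis G_graph : random_connection_graph X N phi G.

Let config n (e : edges n) := N @^-1` [set n] `&` [set w | graph_edges_of n (G w) = e].

Let measurable_config n e : measurable (@config n e).
Proof.
apply: measurableI => //.
have -> : [set w | graph_edges_of n (G w) = e] =
   \bigcap_(A in [set: {set 'I_n}]) [set w | graph_edges_of n (G w) A = e A].
  apply/seteqP; split => w /= h; first by move=> A _ /=; rewrite h.
  by apply/ffunP => A; exact: h.
apply: fin_bigcap_measurable => [|A _]; first exact: finite_finset.
rewrite (_ : [set w | _] = [set w |
   (if [pick p : 'I_n * 'I_n | (p.1 < p.2)%N && (A == [set p.1; p.2]%SET)]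
    is Some p then G w p.1 p.2 else false) = e A]); last first.
  by apply/seteqP; split => w /=; rewrite ffunE.
case: pickP => [p _|_].
  have mG := graph_measurable G_graph p.1 p.2.
  case: (e A) => //; rewrite (_ : [set w | _] = ~` [set w | G w p.1 p.2]).
    exact: measurableC.
  by apply/seteqP; split => w /=; [move=> -> | move/negP/negbTE].
case: (e A).
  by rewrite (_ : [set w | _] = set0)//; apply/seteqP; split.
by rewrite (_ : [set w | _] = setT)//; apply/seteqP; split.
Qed.

Let P_config n (e : edges n) :
  P (config e) = (P (N @^-1` [set n]) * (\int[mpow mu n]_t bwt (edge_prob phi t) e)%:E)%E.
Proof.
have bw : bm (fun t : n.-tuple T => bwt (edge_prob phi t) e).
  apply: bm_prod => A; apply: bm_if; first exact: bm_edge_prob.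
  by apply: bmB; [exact: bm_cst|exact: bm_edge_prob].
have w0 t : 0 <= bwt (edge_prob phi t) e.
  by apply: bwt_ge0 => A; exact: edge_prob01.
have [ve|] := pselect (forall A, e A -> exists i l : 'I_n, i != l /\ A = [set i; l]%SET).
  have gT : sigma_gen X `I_n setT.
    have [h0 hD _] : sigma_algebra setT (sigma_gen X `I_n) by exact: smallest_sigma_algebra.
    by rewrite -[setT]setD0; exact: hD.
  have := graph_edges G_graph (fun i l => e [set i; l]%SET) gT.
  rewrite setIT => hG.
  rewrite -(integral_sample X_iid (mN n) (@N_indep n))//.
  transitivity (P (N @^-1` [set n] `&` [set w | forall i l : 'I_n, (i < l)%N -> G w i l = e [set i; l]%SET])).
    congr (P (_ `&` _)); apply/seteqP; split => w /=.
      by move/(graph_edges_ofP (graph_sym G_graph w) ve).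
    by move/(graph_edges_ofP (graph_sym G_graph w) ve).
  rewrite hG; apply: eq_integral => w _; congr EFin.
  rewrite (bwt_pairs cf _ ve); apply: eq_bigr => i _; apply: eq_bigr => l _.
  by rewrite !tnth_mktuple.
(* An edge on a set that is not a pair: the event is empty, and the weight has a zero factor. *)
move=> /existsNP[A /not_implyP[eA nA]].
have nA' i l : i != l -> A != [set i; l]%SET.
  by move=> il; apply/eqP => E; apply: nA; exists i, l.
have -> : config e = set0.
  apply/seteqP; split => // w [_ /= h]; move: eA; rewrite -h ffunE.
  case: pickP => // p /andP[pp /eqP E]; have := nA' p.1 p.2.
  by rewrite E eqxx => /(_ (ltn_ord_neq pp)).
rewrite measure0 (_ : (fun t => _) = (fun=> 0)) ?Rint_cst ?mule0//.
apply/funext => t; apply/eqP; rewrite /bwt; apply/prodf_eq0; exists A => //.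
by rewrite eA edge_prob_non.
Qed.

Lemma integral_num_deg_fiber n k (h : nat -> R) : (forall m, 0 <= h m) ->
  (\int[P]_(w in N @^-1` [set n]) (h (num_deg (N w) (G w) k))%:E =
   P (N @^-1` [set n]) * (Gmean mu phi n k h)%:E)%E.
Proof.
move=> h0.
transitivity (\int[P]_(w in N @^-1` [set n])
   (\sum_(e : edges n) (h (Dk k [set: _]%SET e) * \1_(config e) w)%:E))%E.
  apply: eq_integral => w; rewrite inE /= => Nw; rewrite sumEFin; congr EFin.
  rewrite Nw (num_deg_Dk n k (graph_sym G_graph w) (graph_irr G_graph w)).
  rewrite (bigD1 (graph_edges_of n (G w)))//= indicE mem_set// mulr1 big1 ?addr0// => e.
  move=> ne; rewrite indicE memNset ?mulr0//= => -[_ E]; move: ne.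
  by rewrite -E eqxx.
rewrite ge0_integral_sum//; last first.
- by move=> e w _; rewrite lee_fin mulr_ge0.
- move=> e; apply/measurable_EFinP; apply: measurable_funM => //.
rewrite /Gmean /GE.
rewrite (_ : (\int[mpow mu n]_t _)%R = \sum_(e : edges n) h (Dk k [set: _]%SET e) *
    \int[mpow mu n]_t bwt (edge_prob phi t) e)%R; last first.
  have bw e : bm (fun t : n.-tuple T => bwt (edge_prob phi t) e).
    apply: bm_prod => A; apply: bm_if; first exact: bm_edge_prob.
    by apply: bmB; [exact: bm_cst|exact: bm_edge_prob].
  under [RHS]eq_bigr do rewrite -RintZ//.
  rewrite -Rint_sum; last by move=> e; apply: bmM => //; exact: bm_cst.
  apply: eq_Rintegral => t _; rewrite big1// mul1r.
  by apply: eq_bigr => e _; rewrite mulrC.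
have finE : P (N @^-1` [set n]) \is a fin_num by exact: fin_num_measure.
rewrite -(fineK finE) -EFinM big_distrr /= -sumEFin; apply: eq_bigr => e _.
under eq_integral do rewrite EFinM.
rewrite ge0_integralZl_EFin//; last first.
- by apply/measurable_EFinP; apply: measurable_funTS; exact: measurable_indic.
rewrite integral_indic// setIidl; last by move=> w [].
transitivity ((h (Dk k [set: _]%SET e))%:E * P (config e))%E; first by [].
by rewrite P_config -{1}(fineK finE) -!EFinM mulrCA.
Qed.

Let mh k (h : nat -> R) n : measurable_fun (N @^-1` [set n])
  (fun w => (h (num_deg (N w) (G w) k))%:E).
Proof.
apply/measurable_EFinP; apply: (@eq_measurable_fun _ _ _ _ _ (fun w =>
   \sum_(e : edges n) (h (Dk k [set: _]%SET e) * \1_(config e) w))).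
  move=> w; rewrite inE /= => Nw.
  rewrite Nw (num_deg_Dk n k (graph_sym G_graph w) (graph_irr G_graph w)).
  rewrite (bigD1 (graph_edges_of n (G w)))//= indicE mem_set// mulr1 big1 ?addr0// => e.
  move=> ne; rewrite indicE memNset ?mulr0//= => -[_ E]; move: ne.
  by rewrite -E eqxx.
apply: measurable_sum => e; apply: measurable_funM => //.
Qed.

Let cover : \bigcup_n (N @^-1` [set n]) = setT.
Proof. by apply/seteqP; split => // w _; exists (N w). Qed.

Lemma measurable_num_deg k (h : nat -> R) :
  measurable_fun setT (fun w => (h (num_deg (N w) (G w) k))%:E).
Proof. by rewrite -cover; apply/measurable_fun_bigcup => // n; exact: mh. Qed.

Lemma integral_num_deg k (h : nat -> R) : (forall m, 0 <= h m) ->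
  (\int[P]_w (h (num_deg (N w) (G w) k))%:E =
   \sum_(0 <= n <oo) P (N @^-1` [set n]) * (Gmean mu phi n k h)%:E)%E.
Proof.
move=> h0; rewrite -{1}cover ge0_integral_bigcup//.
- by apply: eq_eseriesr => n _; exact: integral_num_deg_fiber.
- by rewrite cover; exact: measurable_num_deg.
- by move=> w _; rewrite lee_fin.
- by move=> i j _ _ [w [/= -> ->]].
Qed.

End graph_law.

(** * Asymptotics of the mean counts *)

(** Half of the exponential absorbs the power; in [lam_le_exp] the other half is left for the
    decay. *)
Lemma pow_fact_le_exp (R : realType) (y : R) i : 0 <= y ->
  y ^+ i / i`!%:R <= 2 ^+ i * expR (y / 2).
Proof.
move=> y0; have y20 : 0 <= y / 2 by rewrite divr_ge0.
have h : (y / 2) ^+ i / i`!%:R <= expR (y / 2).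
  case: i => [|i]; last by have := expR_ge1Dxn i y20; lra.
  by have := expR_ge1Dx (y / 2); rewrite expr0 fact0 divr1; lra.
have -> : y ^+ i / i`!%:R = 2 ^+ i * ((y / 2) ^+ i / i`!%:R).
  by rewrite expr_div_n; field; rewrite pnatr_eq0 -lt0n fact_gt0 expf_neq0.
by rewrite ler_wpM2l// exprn_ge0.
Qed.

(** One extra term of the exponential series buys the factor [1 / y]; at [y = ln s] the error terms
    then fall under [near_div_ln_le]. *)
Lemma pow_exp_le (R : realType) (c y : R) i : 0 < c -> 0 < y ->
  y ^+ i * expR (- (c * y)) <= (i.+1)`!%:R / c ^+ i.+1 / y.
Proof.
move=> c0 y0; have cy0 : 0 <= c * y by rewrite mulr_ge0// ltW.
have f0 : 0 < (i.+1)`!%:R :> R by rewrite ltr0n fact_gt0.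
have h : (c * y) ^+ i.+1 / (i.+1)`!%:R <= expR (c * y).
  by have := expR_ge1Dxn i cy0; lra.
rewrite expRN ler_pdivrMr ?expR_gt0//.
have cn0 : 0 < c ^+ i.+1 by rewrite exprn_gt0.
have -> : y ^+ i = (c * y) ^+ i.+1 / (c ^+ i.+1 * y).
  rewrite exprMn [y ^+ i.+1]exprSr invfM mulrACA divff ?gt_eqF// mul1r mulfK//.
  by rewrite gt_eqF.
have -> : (i.+1)`!%:R / c ^+ i.+1 / y * expR (c * y) =
    expR (c * y) * (i.+1)`!%:R / (c ^+ i.+1 * y) by rewrite invfM; ring.
rewrite ler_pM2r ?invr_gt0 ?mulr_gt0//.
by rewrite -ler_pdivrMr.
Qed.

Lemma fact_ge1 (R : realType) i : 1 <= i`!%:R :> R.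
Proof. by rewrite ler1n fact_gt0. Qed.

Section lam_bounds.
Context d (T : measurableType d) (R : realType).
Variables (mu : probability T R) (phi : T -> T -> R).
Hypothesis cf : connection_function phi.
Variables (s pm PM : R).
Hypothesis s0 : 0 < s.
Local Notation p := (mean_connection mu phi).
Hypotheses (pm0 : 0 <= pm) (pmp : forall x, pm <= p x) (pPM : forall x, p x <= PM).

Local Notation L := (lam mu phi s).

Let sp0 x : 0 <= s * p x.
Proof. by rewrite mulr_ge0 ?(ltW s0)// (le_trans pm0). Qed.

Let bpd k : bm (pois_deg mu phi s k). Proof. exact: bm_pois_deg. Qed.

Lemma lam_le k : L k <= (s * PM) ^+ k * L 0.
Proof.
rewrite /lam mulrCA ler_wpM2l ?(ltW s0)// -RintZ//.
apply: Rint_le => //; first by apply: bmM => //; exact: bm_cst.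
move=> x; rewrite /pois_deg expr0 fact0 divr1 mulr1 mulrC ler_wpM2r ?expR_ge0//.
apply: (@le_trans _ _ ((s * p x) ^+ k)).
  by rewrite ler_piMr ?exprn_ge0// invf_le1 ?fact_ge1// ltr0n fact_gt0.
by rewrite lerXn2r ?nnegrE ?ler_wpM2l ?(ltW s0)// mulr_ge0 ?(ltW s0)// (le_trans pm0)// (le_trans (pmp x)).
Qed.

Lemma lam_ge k : (s * pm) ^+ k / k`!%:R * L 0 <= L k.
Proof.
rewrite /lam mulrCA ler_wpM2l ?(ltW s0)// -RintZ//.
apply: Rint_le => //; first by apply: bmM => //; exact: bm_cst.
move=> x; rewrite /pois_deg expr0 fact0 divr1 mulr1 mulrC ler_wpM2l ?expR_ge0//.
rewrite ler_wpM2r ?invr_ge0//.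
by rewrite lerXn2r ?nnegrE ?ler_wpM2l ?(ltW s0)// mulr_ge0// ltW.
Qed.

Lemma lam0_ge : s * expR (- (s * PM)) <= L 0.
Proof.
rewrite /lam ler_wpM2l ?(ltW s0)//; apply: Rint_ge_cst => // x.
by rewrite /pois_deg expr0 fact0 divr1 mulr1 ler_expR lerN2 ler_wpM2l// ltW.
Qed.

Lemma lam_le_exp k : L k <= s * (2 ^+ k * expR (- (s * pm / 2))).
Proof.
rewrite /lam ler_wpM2l ?(ltW s0)//; apply: Rint_le_cst => // x.
apply: (@le_trans _ _ (expR (- (s * p x)) * (2 ^+ k * expR (s * p x / 2)))).
  by rewrite ler_wpM2l ?expR_ge0//; exact: pow_fact_le_exp.
rewrite mulrCA -expRD ler_wpM2l ?exprn_ge0// ler_expR.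
have : s * pm <= s * p x by rewrite ler_wpM2l// ltW.
lra.
Qed.

End lam_bounds.

(** * De-Poissonization *)

Section depoissonization.
Context d (T : measurableType d) (R : realType).
Variables (mu : probability T R) (phi : T -> T -> R).
Hypothesis cf : connection_function phi.
Local Notation p := (mean_connection mu phi).

Lemma pmean_var (s : R) : 0 < s -> pmean s (fun m => (m%:R - s) ^+ 2) = s%:E.
Proof.
move=> s0.
have e1 : pmean s (fun m => m%:R) = s%:E.
  rewrite (@eq_pmean _ s _ (fun m => m%:R * 1)); last by move=> m; rewrite mulr1.
  by rewrite (pmean_shift s0 (a := fun=> 1))// pmean_cst// mule1.
have e2 : pmean s (fun m => m%:R ^+ 2) = (s * (s + 1))%:E.
  under eq_pmean do rewrite expr2.
  rewrite (pmean_shift s0 (a := fun m => m%:R))//.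
  rewrite (@eq_pmean _ s _ (fun m => m%:R + 1)); last by move=> m; rewrite -natr1.
  by rewrite pmeanD// e1 pmean_cst// -EFinD -EFinM.
have : pmean s (fun m => (m%:R - s) ^+ 2 + 2 * s * m%:R) = pmean s (fun m => m%:R ^+ 2 + s ^+ 2).
  by apply: eq_pmean => m; ring.
rewrite pmeanD; [|by move=> m; exact: sqr_ge0|by move=> m; rewrite !mulr_ge0// ltW].
rewrite [in RHS]pmeanD; [|by move=> m; exact: sqr_ge0|by move=> m; exact: sqr_ge0].
rewrite pmeanZ// e1 e2 pmean_cst//.
case: (pmean s _) => [r| |]// [E]; congr EFin; lra.
Qed.

Variables (n : nat) (PM : R).
Hypothesis n0 : (0 < n)%N.
Hypotheses (pPM : forall x, p x <= PM) (PM1 : PM <= 1) (nPM : 1 <= n%:R * PM).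
Variables (k : nat) (f : nat -> R).
Hypothesis f01 : forall m, 0 <= f m <= 1.

Let nR0 : 0 < n%:R :> R. Proof. by rewrite ltr0n. Qed.
Let PM0 : 0 < PM. Proof. by rewrite -(pmulr_rgt0 _ nR0) (lt_le_trans ltr01). Qed.
Let p0 x : 0 <= p x. Proof. exact: mean_connection_ge0. Qed.
Let bp : bm p. Proof. exact: bm_mean_connection. Qed.

Let J : R := \int[mu]_x expR (- (n%:R * p x)).

(* The bound of [Gmean_add_vertex] for [th = 1 / (n PM)], up to a constant, for
   the numbers of points within [1 / PM] of [n]. *)
Definition vertex_rate : R :=
  expR 4 * (n%:R * PM) ^+ k * (1 + 2 * (n%:R * PM)) * J.

(** So small that [th * p x * m] stays bounded, which preserves the full decay
    [expR (- (n%:R * p x))]; the price [th ^- k] is only a power of [n%:R * PM]. *)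
Let th : R := (n%:R * PM)^-1.
Let th0 : 0 < th. Proof. by rewrite invr_gt0 mulr_gt0. Qed.
Let th1 : th <= 1. Proof. by rewrite invf_le1// mulr_gt0. Qed.

Let bexp : bm (fun x => expR (- (n%:R * p x))).
Proof.
split; first by apply: measurableT_comp => //; apply: measurableT_comp => //; apply: measurable_funM => //; case: bp.
by exists 1 => x; rewrite ger0_norm ?expR_ge0// -expR0 ler_expR oppr_le0 mulr_ge0.
Qed.

Let J0 : 0 <= J. Proof. by apply: Rint_ge0 => x; exact: expR_ge0. Qed.

Let mgf0 x : 0 <= 1 - (1 - th) * p x.
Proof.
rewrite (_ : _ - _ = (1 - p x) + th * p x); last by ring.
by apply: addr_ge0; [rewrite subr_ge0; exact: mean_connection_le1|apply: mulr_ge0; [exact: ltW|exact: p0]].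
Qed.

Let mgf_le m x : n%:R - PM^-1 - 1 <= m%:R -> m%:R <= 2 * n%:R :> R ->
  (1 - (1 - th) * p x) ^+ m <= expR 4 * expR (- (n%:R * p x)).
Proof.
move=> ml mu2.
have q0 := mgf0 x.
apply: (@le_trans _ _ (expR (- ((1 - th) * p x)) ^+ m)).
  by rewrite lerXn2r ?nnegrE ?expR_ge0//; have := expR_ge1Dx (- ((1 - th) * p x)); lra.
rewrite -expRM_natl -expRD ler_expR.
have px := pPM x; have p1 := mean_connection_le1 mu cf x.
(* The loss from [th] and the loss from replacing [m] by [n] are at most 2 each, whence [expR 4]. *)
have h1 : th * p x * m%:R <= 2.
  apply: (@le_trans _ _ (th * PM * (2 * n%:R))).
    by rewrite ler_pM ?mulr_ge0 ?(ltW th0)// ler_wpM2l// ltW.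
  rewrite /th le_eqVlt; apply/orP; left; apply/eqP; field; rewrite !gt_eqF//.
have h2 : (n%:R - m%:R) * p x <= 2.
  apply: (@le_trans _ _ ((PM^-1 + 1) * p x)); first by rewrite ler_wpM2r//; lra.
  rewrite mulrDl mul1r; have : PM^-1 * p x <= 1 by rewrite ler_pdivrMl// mulr1.
  lra.
move: h1 h2; set a := p x; set b := m%:R; set c := n%:R; nra.
Qed.

Let step m : n%:R - PM^-1 <= m%:R -> m%:R <= 2 * n%:R :> R ->
  `|Gmean mu phi m.+1 k f - Gmean mu phi m k f| <= vertex_rate.
Proof.
move=> ml mu2.
apply: le_trans (Gmean_add_vertex cf k th0 th1 m f01 pPM) _.
have bmgf i : bm (fun z => (1 - (1 - th) * p z) ^+ i).
  by apply: bmX; apply: bmB; [exact: bm_cst|apply: bmM => //; exact: bm_cst].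
have bJ : bm (fun x => expR 4 * expR (- (n%:R * p x))) by apply: bmM => //; exact: bm_cst.
have I i : n%:R - PM^-1 - 1 <= i%:R -> i%:R <= 2 * n%:R :> R ->
    \int[mu]_z (1 - (1 - th) * p z) ^+ i <= expR 4 * J.
  by move=> h1 h2; rewrite -RintZ//; apply: Rint_le => // x; exact: mgf_le.
have I1 : \int[mu]_z (1 - (1 - th) * p z) ^+ m <= expR 4 * J by apply: I => //; lra.
have I2 : \int[mu]_z (1 - (1 - th) * p z) ^+ m.-1 <= expR 4 * J.
  apply: I; first by case: (m) ml => [|m'] /=; rewrite -?natr1; lra.
  by apply: le_trans mu2; rewrite ler_nat leq_pred.
have e0 : 0 <= expR 4 * J by rewrite mulr_ge0 ?expR_ge0.
have -> : th ^- k = (n%:R * PM) ^+ k by rewrite /th exprVn invrK.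
rewrite /vertex_rate.
have -> : expR 4 * (n%:R * PM) ^+ k * (1 + 2 * (n%:R * PM)) * J =
  (n%:R * PM) ^+ k * (expR 4 * J + 2 * n%:R * (PM * (expR 4 * J))) by ring.
rewrite ler_wpM2l ?exprn_ge0 ?mulr_ge0 ?(ltW PM0)// lerD// ler_pM//.
- by rewrite mulr_ge0 ?(ltW PM0)//; apply: Rint_ge0 => x; rewrite exprn_ge0.
- by rewrite ler_wpM2l// ltW.
Qed.

Let q m := Gmean mu phi m k f.

Let vr0 : 0 <= vertex_rate.
Proof. by rewrite !mulr_ge0 ?expR_ge0 ?exprn_ge0 ?addr_ge0 ?mulr_ge0 ?(ltW PM0). Qed.

Let steps m i : n%:R - PM^-1 <= m%:R -> (m + i)%:R <= n%:R + PM^-1 ->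
  `|q (m + i) - q m| <= i%:R * vertex_rate.
Proof.
move=> ml; elim: i => [|i ih] mi; first by rewrite addn0 subrr normr0 mul0r.
have K : PM^-1 <= n%:R by rewrite -[leLHS]mul1r ler_pdivrMr.
have mi' : (m + i)%:R <= n%:R + PM^-1 by apply: le_trans mi; rewrite ler_nat leq_add2l.
rewrite addnS -natr1 mulrDl mul1r.
have -> : q (m + i).+1 - q m = (q (m + i) - q m) + (q (m + i).+1 - q (m + i)) by ring.
apply: le_trans (ler_normD _ _) _; apply: lerD; first exact: ih.
apply: step; first by rewrite (le_trans ml)// ler_nat leq_addr.
by apply: le_trans mi' _; lra.
Qed.

Let q01 m : 0 <= q m <= 1.
Proof.
apply/andP; split; first by apply: Gmean_ge0 => // i; have /andP[] := f01 i.
rewrite -(Gmean_cst mu phi m k 1); apply: Gmean_le => // i; by have /andP[] := f01 i.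
Qed.

Let dist m : `|q m - q n| <= vertex_rate * `|m%:R - n%:R| + PM ^+ 2 * (m%:R - n%:R) ^+ 2.
Proof.
have sq0 : 0 <= PM ^+ 2 * (m%:R - n%:R) ^+ 2 by rewrite mulr_ge0 ?sqr_ge0.
(* Beyond [PM^-1] the trivial bound 1 is below the quadratic term; within it the one-vertex steps
   add up. *)
have [h|h] := leP `|m%:R - n%:R| (PM^-1); last first.
  apply: (@le_trans _ _ 1).
    have /andP[? ?] := q01 m; have /andP[? ?] := q01 n.
    by rewrite ler_norml; apply/andP; split; lra.
  apply: ler_wpDl; first by rewrite mulr_ge0.
  rewrite -exprMn -real_normK ?num_real// normrM (gtr0_norm PM0).
  by rewrite exprn_ege1// -ler_pdivrMl// mulr1 ltW.
apply: ler_wpDr => //; rewrite mulrC.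
move: h; rewrite ler_norml => /andP[h1 h2].
have [mn|/ltnW nm] := leqP m n.
  have := steps (m := m) (i := (n - m)%N); rewrite subnKC// distrC natrB// => st.
  rewrite [X in _ <= X * _]distrC [X in _ <= X * _]ger0_norm ?subr_ge0 ?ler_nat//.
  by apply: st; [lra|rewrite lerDl invr_ge0 ltW].
have := steps (m := n) (i := (m - n)%N); rewrite subnKC// natrB// => st.
rewrite [X in _ <= X * _]ger0_norm ?subr_ge0 ?ler_nat//.
by apply: st; [rewrite gerBl invr_ge0 ltW|lra].
Qed.

(* The Poisson variable is within [1 / PM] of its mean [n] by Chebyshev's
   inequality, except with probability [n PM ^ 2]. *)
Lemma depoissonize Pr : Pmean mu phi n%:R k f = Pr%:E ->
  `|Pr - q n| <= Num.sqrt n%:R * vertex_rate + n%:R * PM ^+ 2.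
Proof.
move=> PE; pose r := Num.sqrt (n%:R : R).
have r0 : 0 < r by rewrite sqrtr_gt0.
have rr : r ^+ 2 = n%:R by rewrite sqr_sqrtr.
(* From [|x| <= (r + x ^+ 2 / r) / 2] with [r = sqrt n]: after this, averaging the bound uses only
   the variance [n]. *)
pose a : R := vertex_rate * r / 2.
pose b : R := vertex_rate / (2 * r) + PM ^+ 2.
have a0 : 0 <= a by rewrite divr_ge0// mulr_ge0// ltW.
have b0 : 0 <= b by rewrite addr_ge0 ?sqr_ge0// divr_ge0// mulr_ge0// ltW.
have bound m : `|q m - q n| <= a + b * (m%:R - n%:R) ^+ 2.
  apply: le_trans (dist m) _; rewrite /a /b mulrDl addrA lerD2r.
  have -> : vertex_rate * r / 2 + vertex_rate / (2 * r) * (m%:R - n%:R) ^+ 2 =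
     vertex_rate * ((r + (m%:R - n%:R) ^+ 2 / r) / 2) by field; rewrite gt_eqF.
  rewrite ler_wpM2l// ler_pdivlMr// -(ler_pM2l r0).
  have -> : r * (r + (m%:R - n%:R) ^+ 2 / r) = r ^+ 2 + `|m%:R - n%:R| ^+ 2.
    by rewrite real_normK ?num_real//; field; rewrite gt_eqF.
  by have := sqr_ge0 (r - `|m%:R - n%:R|); nra.
have q0 m : 0 <= q m by have /andP[] := q01 m.
have [||||||Pr' PE' Pd] := pmean_dist nR0 (a := q) (b := fun=> q n)
   (c := fun m => a + b * (m%:R - n%:R) ^+ 2) (B := q n) (C := a + b * n%:R).
- exact: q0.
- by move=> _; exact: q0.
- by move=> m; rewrite addr_ge0// mulr_ge0// sqr_ge0.
- exact: bound.
- by rewrite pmean_cst.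
- rewrite (pmeanD _ (a := fun=> a))//; last by move=> m; rewrite mulr_ge0// sqr_ge0.
  by rewrite pmeanZ ?pmean_var ?pmean_cst// => m; exact: sqr_ge0.
move: PE; rewrite /Pmean PE' => -[<-]; apply: le_trans Pd _.
rewrite /a /b -/r; move: vertex_rate rr r0; clearbody r => v <- r0.
by rewrite le_eqVlt; apply/orP; left; apply/eqP; field; rewrite gt_eqF.
Qed.

End depoissonization.

Section near_pinfty.
Context (R : realType).

Lemma near_ln_ge (A : R) : \forall s \near +oo, A <= ln s.
Proof.
near=> s; have h : expR A <= s by near: s; apply: nbhs_pinfty_ge; rewrite num_real.
by rewrite -(expRK A) ler_ln// posrE ?expR_gt0// (lt_le_trans (expR_gt0 A)).
Unshelve. all: by end_near. Qed.

Lemma near_div_ln_le (C del : R) : 0 < del -> \forall s \near +oo, C / ln s <= del.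
Proof.
move=> del0; near=> s.
have h1 : 1 <= ln s by near: s; apply: near_ln_ge.
have h2 : C / del <= ln s by near: s; apply: near_ln_ge.
have l0 : 0 < ln s by lra.
by rewrite ler_pdivrMr// mulrC -ler_pdivrMr.
Unshelve. all: by end_near. Qed.

Lemma near_truncn (Q : R -> Prop) : (\forall s \near +oo, Q s) ->
  \forall s \near (+oo : set_system R), Q (Num.truncn s)%:R.
Proof.
move=> [M [Mr h]]; near=> s; apply: h.
have s0 : 0 <= s by near: s; apply: nbhs_pinfty_ge; rewrite num_real.
have sM : M + 1 <= s by near: s; apply: nbhs_pinfty_ge; rewrite num_real.
by have /andP[_] := truncn_itv s0; rewrite -natr1; lra.
Unshelve. all: by end_near. Qed.

End near_pinfty.

Lemma bin_le_exp n k : ('C(n, k) <= n ^ k)%N.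
Proof.
elim: n k => [|n IH] [|k] //; rewrite binS (leq_trans (leq_add (IH _) (IH _)))//.
rewrite expnS -mulSnr expnS leq_mul2l /=.
by case: k => [|k] //; rewrite leq_exp2r.
Qed.

Lemma bm_expRN d (T : measurableType d) (R : realType) (c : R) (f : T -> R) :
  0 <= c -> bm f -> (forall x, 0 <= f x) -> bm (fun x => expR (- (c * f x))).
Proof.
move=> c0 bf f0; split.
  apply: measurableT_comp => //; apply: measurableT_comp => //.
  by apply: measurable_funM => //; case: bf.
by exists 1 => x; rewrite ger0_norm ?expR_ge0// -expR0 ler_expR oppr_le0 mulr_ge0.
Qed.

Lemma probability_inhabited d (T : measurableType d) (R : realType)
  (mu : probability T R) : exists x : T, True.
Proof.
apply/not_existsP => h; have : mu setT = 0.
  rewrite (_ : setT = set0) ?measure0//.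
  by apply/seteqP; split => // x _; exact: h x I.
by move=> h'; have := @probability_setT _ _ _ mu; rewrite h' => /esym/eqP; rewrite onee_eq0.
Qed.

(** * Orders of magnitude under the convergence hypothesis *)

Section mean_asymptotics.
Context d (T : measurableType d) (R : realType).
Variables (mu : probability T R) (phi : R -> T -> T -> R).
Variables (pm PM : R -> R) (eps alpha : R) (j : nat).
Hypotheses (eps0 : 0 < eps) (alpha0 : 0 < alpha).
Hypothesis cf : forall s, 0 < s -> connection_function (phi s).
Hypothesis pm0 : forall s, 0 < s -> 0 <= pm s.
Hypothesis pmp : forall s, 0 < s -> forall x, pm s <= mean_connection mu (phi s) x.
Hypothesis pPM : forall s, 0 < s -> forall x, mean_connection mu (phi s) x <= PM s.
Hypothesis PMpm : forall s, 0 < s -> eps * PM s <= pm s.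

Local Notation L s k := (lam mu (phi s) s k).

Hypothesis sum_cvg : (\sum_(i < j.+1) L s i) @[s --> +oo] --> alpha.

Lemma lam0_bounds : exists c1 c2 a b, [/\ 0 < c1, 0 < c2, 0 < a, 0 < b &
  \forall s \near +oo, [/\ 0 < s, c1 * ln s <= s * pm s, s * PM s <= c2 * ln s,
    a <= L s 0 * ln s ^+ j & L s 0 * ln s ^+ j <= b]].
Proof.
pose B : R := \sum_(i < j.+1) 2 ^+ i.
have B0 : 0 < B.
  by rewrite /B big_ord_recl/= expr0 ltr_pwDl// sumr_ge0// => i _; rewrite exprn_ge0.
(* From [ln s / 2 <= s * PM s] and [s * pm s <= 4 * ln s] below, carried over to the other bound by
   [eps]; the [+ 1] makes [c2 >= 1], so that powers of [c2 * ln s] increase. *)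
pose c1 := eps / 2; pose c2 := 4 / eps + 1.
have c10 : 0 < c1 by rewrite divr_gt0.
have e40 : 0 < 4 / eps by rewrite divr_gt0.
have c21 : 1 <= c2 by rewrite /c2; lra.
have c20 : 0 < c2 by lra.
pose a := alpha / 2 / (j.+1%:R * c2 ^+ j).
pose b := 2 * alpha * j`!%:R / c1 ^+ j.
exists c1, c2, a, b; split => //.
- by rewrite /a divr_gt0// ?divr_gt0// mulr_gt0// exprn_gt0.
- by rewrite /b divr_gt0 ?exprn_gt0// !mulr_gt0// ltr0n fact_gt0.
near=> s.
have s0 : 0 < s by near: s; apply: nbhs_pinfty_gt; rewrite num_real.
have l1 : 1 <= ln s by near: s; apply: near_ln_ge.
have lA : 2 * ln (2 * alpha) <= ln s by near: s; apply: near_ln_ge.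
have lB : - ln (alpha / 2 / B) <= ln s by near: s; apply: near_ln_ge.
have Sa : `|alpha - \sum_(i < j.+1) L s i| <= alpha / 2.
  near: s; apply: (@cvgr_dist_le _ R^o _ _ _ (fun s => \sum_(i < j.+1) L s i)) => //.
  by rewrite divr_gt0.
set S := \sum_(i < j.+1) L s i in Sa.
have {Sa} [Sl Su] : alpha / 2 <= S /\ S <= 2 * alpha by move: Sa; rewrite ler_norml => /andP[]; lra.
have L_ge0 i : 0 <= L s i by apply: lam_ge0 => //; exact: cf.
have L_leS (i : 'I_j.+1) : L s i <= S.
  by rewrite /S (bigD1 i)//= lerDl sumr_ge0.
have sE : s = expR (ln s) by rewrite lnK// posrE.
(* [L s 0] is at least [s * expR (- (s * PM s))] and at most the whole sum, which stays below
   [2 * alpha]. *)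
have sPMl : ln s / 2 <= s * PM s.
  have h := lam0_ge (cf s0) s0 (pPM s0).
  have h2 : expR (ln s - s * PM s) <= expR (ln (2 * alpha)).
    rewrite expRD -sE lnK ?posrE ?mulr_gt0//.
    by apply: le_trans h _; apply: le_trans Su; apply: (L_leS ord0).
  by move: h2; rewrite ler_expR; lra.
have spml : c1 * ln s <= s * pm s.
  have h := PMpm s0.
  have : s * (eps * PM s) <= s * pm s by rewrite ler_pM2l.
  have : eps * (ln s / 2) <= eps * (s * PM s) by rewrite ler_pM2l.
  by rewrite /c1; lra.
(* A larger [s * pm s] would push every mean in the sum so low that the sum could not exceed
   [alpha / 2]. *)
have spmu : s * pm s <= 4 * ln s.
  have h : alpha / 2 <= s * (B * expR (- (s * pm s / 2))).
    apply: le_trans Sl _; rewrite /S /B mulr_suml mulr_sumr ler_sum// => i _.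
    exact: (lam_le_exp (cf s0) s0 (pm0 s0) (pmp s0)).
  have h2 : expR (ln (alpha / 2 / B)) <= expR (ln s - s * pm s / 2).
    rewrite lnK ?posrE ?divr_gt0// expRD -sE ler_pdivrMr//.
    by apply: le_trans h _; rewrite -[leRHS]mulrA [expR _ * B]mulrC.
  by move: h2; rewrite ler_expR; lra.
have sPMu : s * PM s <= c2 * ln s.
  have h : s * (eps * PM s) <= s * pm s by rewrite ler_pM2l// PMpm.
  have h2 : s * PM s <= 4 / eps * ln s.
    by rewrite mulrAC ler_pdivlMr// [_ * eps]mulrC; lra.
  by rewrite /c2; lra.
have PM0 : 0 <= s * PM s by lra.
have c2l : 1 <= c2 * ln s by nra.
split => //.
- rewrite /a ler_pdivrMr; last by rewrite mulr_gt0// exprn_gt0.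
  apply: le_trans Sl _.
  have -> : L s 0 * ln s ^+ j * (j.+1%:R * c2 ^+ j) = \sum_(i < j.+1) (c2 * ln s) ^+ j * L s 0.
    by rewrite sumr_const card_ord exprMn -mulr_natr; ring.
  rewrite /S ler_sum// => i _.
  apply: (le_trans (lam_le (cf s0) s0 (pm0 s0) (pmp s0) (pPM s0) i)).
  rewrite ler_wpM2r//.
  apply: (@le_trans _ _ ((c2 * ln s) ^+ i)); first by rewrite lerXn2r ?nnegrE//; lra.
  by rewrite ler_weXn2l// -ltnS.
- have h := lam_ge (cf s0) s0 (pm0 s0) (pmp s0) j.
  have h2 : (c1 * ln s) ^+ j / j`!%:R * L s 0 <= 2 * alpha.
    apply: le_trans (le_trans h _); last exact: le_trans (L_leS ord_max) Su.
    rewrite ler_wpM2r// ler_pM2r ?invr_gt0 ?ltr0n ?fact_gt0//.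
    by rewrite lerXn2r// nnegrE ?(le_trans _ spml)// mulr_ge0 ?(ltW c10) ?(le_trans _ l1).
  rewrite /b ler_pdivlMr ?exprn_gt0// -ler_pdivrMr ?ltr0n ?fact_gt0//.
  by apply: le_trans h2; rewrite [(_ * ln s) ^+ j]exprMn le_eqVlt; apply/orP; left; apply/eqP; ring.
Unshelve. all: by end_near. Qed.

(** The power [ln s ^+ j] stays on the left because [k - j] may be negative. *)
Lemma lam_bounds k : exists a b, [/\ 0 < a, 0 < b &
  \forall s \near +oo, a * ln s ^+ k <= L s k * ln s ^+ j <= b * ln s ^+ k].
Proof.
have [c1 [c2 [a [b [c10 c20 a0 b0 H]]]]] := lam0_bounds.
exists (c1 ^+ k / k`!%:R * a), (c2 ^+ k * b); split.
- by rewrite mulr_gt0// divr_gt0 ?exprn_gt0// ltr0n fact_gt0.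
- by rewrite mulr_gt0// exprn_gt0.
near=> s.
have l1 : 1 <= ln s by near: s; apply: near_ln_ge.
have [s0 h1 h2 h3 h4] : [/\ 0 < s, c1 * ln s <= s * pm s, s * PM s <= c2 * ln s,
    a <= L s 0 * ln s ^+ j & L s 0 * ln s ^+ j <= b] by near: s.
have lk0 n : 0 <= ln s ^+ n by rewrite exprn_ge0//; lra.
have Lge0 : 0 <= L s 0 by apply: lam_ge0 => //; exact: cf.
have c1l : 0 <= c1 * ln s by rewrite mulr_ge0; lra.
have [x0 _] := probability_inhabited mu.
have pMx : pm s <= PM s.
  exact: le_trans (pmp s0 x0) (pPM s0 x0).
have sPM0 : 0 <= s * PM s by apply: mulr_ge0; [exact: ltW|exact: le_trans (pm0 s0) pMx].
apply/andP; split.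
  have h := lam_ge (cf s0) s0 (pm0 s0) (pmp s0) k.
  apply: (@le_trans _ _ ((s * pm s) ^+ k / k`!%:R * L s 0 * ln s ^+ j)); last by rewrite ler_wpM2r.
  have -> : c1 ^+ k / k`!%:R * a * ln s ^+ k = (c1 * ln s) ^+ k / k`!%:R * a.
    by rewrite exprMn; ring.
  rewrite -[leRHS]mulrA; apply: ler_pM => //; [|exact: ltW|].
    by rewrite divr_ge0// exprn_ge0.
  rewrite ler_pM2r ?invr_gt0 ?ltr0n ?fact_gt0// lerXn2r ?nnegrE//.
  exact: le_trans h1.
have h := lam_le (cf s0) s0 (pm0 s0) (pmp s0) (pPM s0) k.
apply: (@le_trans _ _ ((s * PM s) ^+ k * L s 0 * ln s ^+ j)); first by rewrite ler_wpM2r.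
have -> : c2 ^+ k * b * ln s ^+ k = (c2 * ln s) ^+ k * b by rewrite exprMn; ring.
rewrite -mulrA; apply: ler_pM => //; [exact: exprn_ge0|exact: mulr_ge0|].
by rewrite lerXn2r ?nnegrE// (le_trans sPM0).
Unshelve. all: by end_near. Qed.

Lemma lam_small i del : (i < j)%N -> 0 < del -> \forall s \near +oo, L s i <= del.
Proof.
move=> ij del0; have [a [b [a0 b0 H]]] := lam_bounds i.
near=> s.
have l1 : 1 <= ln s by near: s; apply: near_ln_ge.
have : b / ln s <= del by near: s; apply: near_div_ln_le.
have /andP[_ h] : a * ln s ^+ i <= L s i * ln s ^+ j <= b * ln s ^+ i by near: s.
apply: le_trans; have l0 : 0 < ln s by lra.
have Lge0 : 0 <= L s i.
  have s0 : 0 < s by near: s; apply: nbhs_pinfty_gt; rewrite num_real.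
  by apply: lam_ge0 => //; exact: cf.
rewrite ler_pdivlMr// -(ler_pM2r (exprn_gt0 i l0)); apply: le_trans h.
rewrite -mulrA -exprS ler_wpM2l//.
by rewrite ler_weXn2l.
Unshelve. all: by end_near. Qed.

Lemma lam_large k M : (j < k)%N -> \forall s \near +oo, M <= L s k.
Proof.
move=> jk; have [a [b [a0 b0 H]]] := lam_bounds k.
near=> s.
have l1 : 1 <= ln s by near: s; apply: near_ln_ge.
have lM : M / a <= ln s by near: s; apply: near_ln_ge.
have /andP[h _] : a * ln s ^+ k <= L s k * ln s ^+ j <= b * ln s ^+ k by near: s.
have l0 : 0 < ln s by lra.
rewrite -(ler_pM2r (exprn_gt0 j l0)); apply: le_trans h.
apply: (@le_trans _ _ (a * ln s * ln s ^+ j)).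
  apply: ler_wpM2r; first by rewrite exprn_ge0// ltW.
  by rewrite mulrC -ler_pdivrMr.
by rewrite -mulrA -exprS ler_pM2l// ler_weXn2l.
Unshelve. all: by end_near. Qed.

Lemma lam_cvg : L s j @[s --> +oo] --> alpha.
Proof.
apply/(@cvgrPdist_le _ R^o) => del del0; near=> s.
have h1 : `|alpha - \sum_(i < j.+1) L s i| <= del / 2.
  near: s; apply: (@cvgr_dist_le _ R^o _ _ _ (fun s => \sum_(i < j.+1) L s i)) => //.
  by rewrite divr_gt0.
have h2 : forall i : 'I_j, L s i <= del / 2 / j.+1%:R.
  near: s; apply: filter_forall => i.
  by apply: lam_small => //; rewrite !divr_gt0.
have s0 : 0 < s by near: s; apply: nbhs_pinfty_gt; rewrite num_real.
have L_ge0 i : 0 <= L s i by apply: lam_ge0 => //; exact: cf.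
move: h1; rewrite big_ord_recr/=.
have h3 : 0 <= \sum_(i < j) L s i by rewrite sumr_ge0.
have h4 : \sum_(i < j) L s i <= del / 2.
  apply: (@le_trans _ _ (\sum_(i < j) del / 2 / j.+1%:R)); first by rewrite ler_sum.
  rewrite sumr_const card_ord -[leLHS]mulr_natr -mulrA.
  apply: ler_piMr; first by rewrite divr_ge0 ?ltW.
  by rewrite mulrC ler_pdivrMr// mul1r ler_nat ltnW.
rewrite !ler_norml => /andP[]; lra.
Unshelve. all: by end_near. Qed.

(** The exponential in the rate is at most [expR (- (c * ln s))], a negative power of [s]; against
    it stand [k] powers of [ln s] from [L s k] and two from the rate. *)
Lemma stein_rate_small k del : 0 < del ->
  \forall s \near +oo, (L s k + 1) * stein_rate s eps (pm s) (PM s) k <= del.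
Proof.
move=> del0; have [c1 [c2 [a0 [b0 [c10 c20 _ _ H0]]]]] := lam0_bounds.
have [a [b [a_gt0 b_gt0 H]]] := lam_bounds k.
pose c := eps * c1 / 2.
have c_gt0 : 0 < c by rewrite divr_gt0// mulr_gt0.
pose C := (b + 1) * (2 ^+ k * (k%:R + c2) * (1 + c2)).
have kc2 : 0 <= k%:R + c2 by rewrite addr_ge0// ltW.
have C0 : 0 <= C.
  by rewrite /C !mulr_ge0 ?exprn_ge0//; lra.
near=> s.
have l1 : 1 <= ln s by near: s; apply: near_ln_ge.
have : C * ((k.+3)`!%:R / c ^+ k.+3) / ln s <= del.
  by near: s; apply: near_div_ln_le.
apply: le_trans.
have [s0 h1 h2 _ _] : [/\ 0 < s, c1 * ln s <= s * pm s, s * PM s <= c2 * ln s,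
    a0 <= L s 0 * ln s ^+ j & L s 0 * ln s ^+ j <= b0] by near: s.
have /andP[_ h] : a * ln s ^+ k <= L s k * ln s ^+ j <= b * ln s ^+ k by near: s.
have l0 : 0 < ln s by lra.
have Lge0 : 0 <= L s k by apply: lam_ge0 => //; exact: cf.
have lk1 n : 1 <= ln s ^+ n by rewrite exprn_ege1.
have hL : L s k + 1 <= (b + 1) * ln s ^+ k.
  have := lk1 k; have : L s k <= L s k * ln s ^+ j by rewrite ler_peMr.
  by lra.
have [x0 _] := probability_inhabited mu.
have pMx : pm s <= PM s by exact: le_trans (pmp s0 x0) (pPM s0 x0).
have sPM0 : 0 <= s * PM s by apply: mulr_ge0; [exact: ltW|exact: le_trans (pm0 s0) pMx].
rewrite /stein_rate /thin_rate.
have hE : expR (- (s * (eps * pm s / 2))) <= expR (- (c * ln s)).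
  have : eps * (c1 * ln s) <= eps * (s * pm s) by rewrite ler_pM2l.
  by rewrite ler_expR /c; lra.
have hA : k%:R + s * PM s <= (k%:R + c2) * ln s.
  have : k%:R <= k%:R * ln s by rewrite ler_peMr.
  by lra.
have hB : 1 + s * PM s <= (1 + c2) * ln s by lra.
apply: (@le_trans _ _ ((b + 1) * ln s ^+ k *
   (2 ^+ k * ((k%:R + c2) * ln s) * ((1 + c2) * ln s) * expR (- (c * ln s))))).
  apply: ler_pM => //; first by rewrite addr_ge0.
    by apply: mulr_ge0 _ (expR_ge0 _); rewrite !mulr_ge0 ?exprn_ge0 ?addr_ge0.
  apply: ler_pM => //.
    by rewrite !mulr_ge0 ?exprn_ge0 ?addr_ge0.
  apply: ler_pM => //; try by rewrite ?mulr_ge0 ?exprn_ge0 ?addr_ge0.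
  by rewrite ler_pM2l ?exprn_gt0.
have -> : (b + 1) * ln s ^+ k *
   (2 ^+ k * ((k%:R + c2) * ln s) * ((1 + c2) * ln s) * expR (- (c * ln s))) =
   C * (ln s ^+ k.+2 * expR (- (c * ln s))) by rewrite /C !exprS; ring.
rewrite -[leRHS]mulrA ler_wpM2l//.
exact: pow_exp_le.
Unshelve. all: by end_near. Qed.

(** The integral in [vertex_rate] is [L s 0 / s], so the first term is a power of [ln s] over
    [sqrt s]; the second is the square of [s * PM s] over [s]. The guard [s = n%:R] keeps the filter
    on the reals, for [near_truncn]. *)
Lemma depoisson_rate_small k del : 0 < del ->
  \forall s \near (+oo : set_system R), forall n, s = n%:R ->
    Num.sqrt n%:R * vertex_rate mu (phi n%:R) n (PM n%:R) k + n%:R * PM n%:R ^+ 2 <= del.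
Proof.
move=> del0; have [c1 [c2 [a0 [b0 [c10 c20 _ b_gt0 H0]]]]] := lam0_bounds.
pose C := expR 4 * (c2 ^+ k * (1 + 2 * c2)) * b0.
have C0 : 0 <= C.
  by rewrite /C !mulr_ge0 ?exprn_ge0 ?expR_ge0//; lra.
pose h2 : R := 1 / 2.
near=> s.
have l1 : 1 <= ln s by near: s; apply: near_ln_ge.
have e1 : C * ((k.+2)`!%:R / h2 ^+ k.+2) / ln s <= del / 2.
  by near: s; apply: near_div_ln_le; rewrite divr_gt0.
have e2 : c2 ^+ 2 * (3`!%:R / 1 ^+ 3) / ln s <= del / 2.
  by near: s; apply: near_div_ln_le; rewrite divr_gt0.
have [s0 _ hPM _ hL] : [/\ 0 < s, c1 * ln s <= s * pm s, s * PM s <= c2 * ln s,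
    a0 <= L s 0 * ln s ^+ j & L s 0 * ln s ^+ j <= b0] by near: s.
move=> n sn; rewrite -sn.
have l0 : 0 < ln s by lra.
have lk1 m : 1 <= ln s ^+ m by rewrite exprn_ege1.
have Lge0 : 0 <= L s 0 by apply: lam_ge0 => //; exact: cf.
have Lb : L s 0 <= b0 by apply: le_trans hL; rewrite ler_peMr.
have [x0 _] := probability_inhabited mu.
have pMx : pm s <= PM s by exact: le_trans (pmp s0 x0) (pPM s0 x0).
have sPM0 : 0 <= s * PM s by apply: mulr_ge0; [exact: ltW|exact: le_trans (pm0 s0) pMx].
have sE : s = expR (ln s) by rewrite lnK// posrE.
rewrite (splitr del); apply: lerD; last first.
  apply: le_trans e2.
  have -> : s * PM s ^+ 2 = (s * PM s) ^+ 2 * expR (- (1 * ln s)).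
    by rewrite mul1r expRN -sE; field; rewrite gt_eqF.
  rewrite -[leRHS]mulrA; apply: (@le_trans _ _ ((c2 * ln s) ^+ 2 * expR (- (1 * ln s)))).
    by rewrite ler_wpM2r ?expR_ge0// lerXn2r ?nnegrE// (le_trans sPM0).
  by rewrite exprMn -mulrA ler_wpM2l ?exprn_ge0 ?(ltW c20)//; apply: pow_exp_le.
apply: le_trans e1.
have LE : L s 0 = s * \int[mu]_x expR (- (s * mean_connection mu (phi s) x)).
  rewrite /lam; congr (_ * _); congr Rintegral; apply/funext => x.
  by rewrite /pois_deg expr0 fact0 divr1 mulr1.
have sqE : Num.sqrt s = s * expR (- (h2 * ln s)).
  have h : s = expR (h2 * ln s) ^+ 2.
    by rewrite -expRM_natl {1}sE; congr expR; rewrite /h2; field.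
  by rewrite {1 2}h sqrtr_sqr ger0_norm ?expR_ge0// expRN expr2 mulfK// gt_eqF// expR_gt0.
have -> : Num.sqrt s * vertex_rate mu (phi s) n (PM s) k =
   expR 4 * ((s * PM s) ^+ k * (1 + 2 * (s * PM s))) * L s 0 * expR (- (h2 * ln s)).
  by rewrite sqE LE /vertex_rate -sn; ring.
apply: (@le_trans _ _ (expR 4 * ((c2 * ln s) ^+ k * ((1 + 2 * c2) * ln s)) * b0 *
    expR (- (h2 * ln s)))).
  rewrite ler_wpM2r ?expR_ge0//.
  have t0 : 0 <= 1 + 2 * (s * PM s) by lra.
  apply: ler_pM => //; first by apply: mulr_ge0 (expR_ge0 _) _; apply: mulr_ge0 t0; exact: exprn_ge0.
  rewrite ler_wpM2l ?expR_ge0//.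
  apply: ler_pM => //; [exact: exprn_ge0| |lra].
  by rewrite lerXn2r ?nnegrE// (le_trans sPM0).
have -> : expR 4 * ((c2 * ln s) ^+ k * ((1 + 2 * c2) * ln s)) * b0 * expR (- (h2 * ln s))
   = C * (ln s ^+ k.+1 * expR (- (h2 * ln s))).
  by rewrite /C exprMn exprS; ring.
rewrite -[leRHS]mulrA ler_wpM2l//.
by apply: pow_exp_le; rewrite // /h2; lra.
Unshelve. all: by end_near. Qed.

Hypothesis phie : forall s, 0 < s -> forall x y, phi s x y <= 1 - eps.

Lemma near_lam_gt0 k : \forall s \near +oo, 0 < L s k.
Proof.
have [a [b [a_gt0 b_gt0 H]]] := lam_bounds k.
near=> s.
have l1 : 1 <= ln s by near: s; apply: near_ln_ge.
have l0 : 0 < ln s by lra.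
have /andP[h _] : a * ln s ^+ k <= L s k * ln s ^+ j <= b * ln s ^+ k by near: s.
rewrite -(pmulr_lgt0 _ (exprn_gt0 j l0)); apply: lt_le_trans h.
by rewrite mulr_gt0// exprn_gt0.
Unshelve. all: by end_near. Qed.

Lemma Pmean_cdf_pcdf k del : 0 < del -> \forall s \near +oo, forall r,
  exists2 Pr, Pmean mu (phi s) s k (fun m => (m <= r)%N%:R) = Pr%:E &
    `|Pr - pcdf (L s k) r| <= del.
Proof.
move=> del0; near=> s => r.
have s0 : 0 < s by near: s; apply: nbhs_pinfty_gt; rewrite num_real.
have Lk : 0 < L s k by near: s; apply: near_lam_gt0.
have h : (L s k + 1) * stein_rate s eps (pm s) (PM s) k <= del.
  by near: s; apply: stein_rate_small.
have [Pr PrE Prd] := poisson_approx (cf s0) s0 eps0 (phie s0) (pmp s0) (pPM s0) Lk r.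
by exists Pr => //; exact: le_trans Prd h.
Unshelve. all: by end_near. Qed.

Lemma pcdf_lam_cvg m del : 0 < del ->
  \forall s \near +oo, `|pcdf (L s j) m - pcdf alpha m| <= del.
Proof.
move=> del0; have cc : {for alpha, continuous (pois_tail m : R -> R)}.
  apply/differentiable_continuous/derivable1_diffP.
  exact: (@ex_derive _ _ _ _ _ _ _ (is_derive_pois_tail m alpha)).
have cv : pois_tail m (L s j) @[s --> +oo] --> pois_tail m alpha.
  exact: (cvg_comp _ _ lam_cvg cc).
near=> s; have Lj : 0 < L s j by near: s; apply: near_lam_gt0.
rewrite !pois_tailE// distrC.
by near: s; apply: (@cvgr_dist_le _ R^o _ _ _ (fun s => pois_tail m (L s j))).
Unshelve. all: by end_near. Qed.

Lemma Pmean_cdf_cvg m del : 0 < del -> \forall s \near +oo,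
  exists2 Pr, Pmean mu (phi s) s j (fun i => (i <= m)%N%:R) = Pr%:E &
    `|Pr - pcdf alpha m| <= del.
Proof.
move=> del0; have del20 : 0 < del / 2 by rewrite divr_gt0.
near=> s.
have [Pr PrE Prd] : exists2 Pr, Pmean mu (phi s) s j (fun i => (i <= m)%N%:R) = Pr%:E &
    `|Pr - pcdf (L s j) m| <= del / 2.
  by have : m = m by []; near: s; apply: filterS (Pmean_cdf_pcdf j del20) => s + _; apply.
have h : `|pcdf (L s j) m - pcdf alpha m| <= del / 2.
  by near: s; apply: pcdf_lam_cvg.
exists Pr => //; rewrite (le_trans (ler_distD (pcdf (L s j) m) _ _))//.
by rewrite (splitr del) lerD.
Unshelve. all: by end_near. Qed.

Lemma Gmean_cdf_cvg m del : 0 < del ->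
  \forall s \near (+oo : set_system R), forall n, s = n%:R ->
    `|Gmean mu (phi n%:R) n j (fun i => (i <= m)%N%:R) - pcdf alpha m| <= del.
Proof.
move=> del0; have del20 : 0 < del / 2 by rewrite divr_gt0.
have [c1 [c2 [a0 [b0 [c10 c20 _ b_gt0 H0]]]]] := lam0_bounds.
near=> s => n sn.
have l1 : 1 / c1 <= ln s by near: s; apply: near_ln_ge.
have [s0 hpm _ _ _] : [/\ 0 < s, c1 * ln s <= s * pm s, s * PM s <= c2 * ln s,
    a0 <= L s 0 * ln s ^+ j & L s 0 * ln s ^+ j <= b0] by near: s.
have [x0 _] := probability_inhabited mu.
have pMx : pm s <= PM s by exact: le_trans (pmp s0 x0) (pPM s0 x0).
have sPM1 : 1 <= s * PM s.
  apply: le_trans (le_trans hpm _); last by rewrite ler_pM2l.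
  by rewrite mulrC -ler_pdivrMr.
have [Pr PrE Prd] : exists2 Pr, Pmean mu (phi s) s j (fun i => (i <= m)%N%:R) = Pr%:E &
    `|Pr - pcdf alpha m| <= del / 2.
  by near: s; apply: Pmean_cdf_cvg.
have rate : Num.sqrt n%:R * vertex_rate mu (phi n%:R) n (PM n%:R) j +
    n%:R * PM n%:R ^+ 2 <= del / 2.
  by move: n sn; near: s; apply: depoisson_rate_small.
rewrite sn in s0 sPM1 PrE.
have n0 : (0 < n)%N by rewrite -(ltr0n R).
have f01 (i : nat) : 0 <= (i <= m)%N%:R :> R /\ (i <= m)%N%:R <= 1 :> R.
  by case: (i <= m)%N.
have h := depoissonize (cf s0) n0 (pPM s0) sPM1
  (fun i => introT andP (f01 i)) PrE.
rewrite (le_trans (ler_distD Pr _ _))// (splitr del) lerD//.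
by rewrite distrC (le_trans h).
Unshelve. all: by end_near. Qed.

(** The mean count of the binomial graph is compared with [L s 0] directly: the exponent of [1 - p]
    falls short of [s] by [k.+1], which costs [expR k.+1%:R]. *)
Lemma Gmean_id_le s n k : 0 < s -> s = n%:R ->
  Gmean mu (phi s) n k (fun i => i%:R) <= expR k.+1%:R * (s * PM s) ^+ k * L s 0.
Proof.
move=> s0 sn; have cs := cf s0.
case: n sn => [|n] sn; first by rewrite sn ltxx in s0.
have p0 := mean_connection_ge0 mu cs; have p1 := mean_connection_le1 mu cs.
have [x0 _] := probability_inhabited mu.
have PM0 : 0 <= PM s by exact: le_trans (p0 x0) (pPM s0 x0).
have bp := bm_mean_connection mu cs.
have s1n : s = 1 + n%:R by rewrite sn -natr1 addrC.
have key x : 'C(n, k)%:R * (mean_connection mu (phi s) x ^+ k *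
     (1 - mean_connection mu (phi s) x) ^+ (n - k)) <=
    expR k.+1%:R * (s * PM s) ^+ k * expR (- (s * mean_connection mu (phi s) x)).
  have [nk|kn] := ltnP n k.
    by rewrite bin_small// mul0r !mulr_ge0 ?expR_ge0 ?exprn_ge0// mulr_ge0// ltW.
  set p := mean_connection mu (phi s) x.
  have px0 : 0 <= p := p0 x; have px1 : p <= 1 := p1 x.
  have q0 : 0 <= 1 - p by rewrite subr_ge0.
  have h1 : 'C(n, k)%:R * p ^+ k <= (s * PM s) ^+ k.
    rewrite exprMn; apply: ler_pM => //; first exact: exprn_ge0.
      rewrite sn -natrX ler_nat (leq_trans (bin_le_exp n k))//.
      by case: (k) => [|k'] //; rewrite leq_exp2r.
    by rewrite lerXn2r ?nnegrE// pPM.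
  have h2 : (1 - p) ^+ (n - k) <= expR k.+1%:R * expR (- (s * p)).
    apply: (@le_trans _ _ (expR (- p) ^+ (n - k))).
      by rewrite lerXn2r ?nnegrE ?expR_ge0//; have := expR_ge1Dx (- p).
    rewrite -expRM_natl -expRD ler_expR natrB// s1n.
    have : k.+1%:R * p <= k.+1%:R by rewrite ler_piMr.
    by rewrite -natr1; lra.
  rewrite mulrA; apply: le_trans (ler_pM _ _ h1 h2) _; last by lra.
  - by rewrite mulr_ge0 ?exprn_ge0.
  - exact: exprn_ge0.
have LE : L s 0 = s * \int[mu]_x expR (- (s * mean_connection mu (phi s) x)).
  rewrite /lam; congr (_ * _); congr Rintegral; apply/funext => x.
  by rewrite /pois_deg expr0 fact0 divr1 mulr1.
rewrite Gmean_id// -sn LE [leRHS]mulrCA ler_pM2l//.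
have bpq : bm (fun x => mean_connection mu (phi s) x ^+ k *
     (1 - mean_connection mu (phi s) x) ^+ (n - k)).
  by apply: bmM; apply: bmX => //; apply: bmB => //; exact: bm_cst.
have bexp : bm (fun x => expR (- (s * mean_connection mu (phi s) x))).
  by apply: bm_expRN => //; exact: ltW.
rewrite -!RintZ//; apply: Rint_le => //; apply: bmM => //; exact: bm_cst.
Qed.

Lemma Gmean_id_small k del : (k < j)%N -> 0 < del ->
  \forall s \near (+oo : set_system R), forall n, s = n%:R ->
    Gmean mu (phi s) n k (fun i => i%:R) <= del.
Proof.
move=> kj del0.
have [c1 [c2 [a0 [b0 [c10 c20 _ b_gt0 H0]]]]] := lam0_bounds.
near=> s => n sn.
have l1 : 1 <= ln s by near: s; apply: near_ln_ge.
have l0 : 0 < ln s by lra.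
have [s0 _ hPM _ hL] : [/\ 0 < s, c1 * ln s <= s * pm s, s * PM s <= c2 * ln s,
    a0 <= L s 0 * ln s ^+ j & L s 0 * ln s ^+ j <= b0] by near: s.
have : expR k.+1%:R * c2 ^+ k * b0 / ln s <= del by near: s; apply: near_div_ln_le.
apply: le_trans.
have h := Gmean_id_le k s0 sn; apply: (le_trans h).
have [x0 _] := probability_inhabited mu.
have pMx : pm s <= PM s by exact: le_trans (pmp s0 x0) (pPM s0 x0).
have sPM0 : 0 <= s * PM s by apply: mulr_ge0; [exact: ltW|exact: le_trans (pm0 s0) pMx].
have Lge0 : 0 <= L s 0 by apply: lam_ge0 => //; exact: cf.
rewrite -!mulrA ler_pM2l ?expR_gt0//.
apply: (@le_trans _ _ ((c2 * ln s) ^+ k * L s 0)).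
  by rewrite ler_wpM2r// lerXn2r ?nnegrE// (le_trans sPM0).
rewrite exprMn -mulrA ler_pM2l ?exprn_gt0// ler_pdivlMr// mulrAC -exprSr mulrC.
apply: le_trans hL; rewrite ler_wpM2l//.
by rewrite ler_weXn2l.
Unshelve. all: by end_near. Qed.

End mean_asymptotics.

(** * Convergence in law *)

Lemma cvg_EFin_near (R : realType) (f : R -> \bar R) (l : R) :
  (forall del, 0 < del -> \forall s \near +oo, exists2 v, f s = v%:E & `|v - l| <= del) ->
  f s @[s --> +oo] --> l%:E.
Proof.
move=> H; apply: cvg_EFin.
  by apply: filterS (H 1 ltr01) => s [v ->].
apply/(@cvgrPdist_le _ R^o) => del del0; apply: filterS (H del del0) => s [v /= -> /=].
by rewrite distrC.
Qed.

Lemma poisson_law_itv (R : realType) (a r : R) : 0 < a ->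
  poisson_law a `]-oo, r]%classic = (if r < 0 then 0 else pcdf a (Num.truncn r))%:E.
Proof.
move=> a0; rewrite /poisson_law/= /distribution/= /pushforward/= /poisson_prob a0.
have [r0|r0] := ltP r 0.
  rewrite (_ : _ @^-1` _ = set0) ?esum_set0//.
  apply/seteqP; split => // n /=; rewrite in_itv/= /nat_to_real => h.
  by have := le_lt_trans h r0; rewrite ltrn0.
rewrite (_ : _ @^-1` _ = `I_(Num.truncn r).+1); last first.
  apply/seteqP; split => n /=; rewrite in_itv/= /nat_to_real ltnS truncn_ge_nat//.
rewrite esum_fset; last 2 first.
- exact: finite_II.
- by move=> i _; rewrite lee_fin poisson_pmf_ge0.
by rewrite -fsbig_ord /pcdf sumEFin.
Qed.

Section graph_counts.
Context dO d (Omega : measurableType dO) (T : measurableType d) (R : realType).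
Variables (P : probability Omega R) (mu : probability T R).
Variables (X : nat -> {RV P >-> T}) (phi : T -> T -> R).
Variables (N : Omega -> nat) (G : Omega -> rel nat).
Hypothesis mN : forall n, measurable (N @^-1` [set n]).
Hypothesis G_graph : random_connection_graph X N phi G.

Lemma measurable_num_degP k (b : pred nat) :
  measurable [set w | b (num_deg (N w) (G w) k)].
Proof.
have h := measurable_num_deg mN G_graph k (fun m => (b m)%:R).
rewrite (_ : [set w | _] = setT `&`
    (fun w => ((b (num_deg (N w) (G w) k))%:R : R)%:E) @^-1` [set 1%E]).
  by apply: h => //; exact: emeasurable_set1.
rewrite setTI; apply/seteqP; split => w /=; first by move=> ->.
by case: (b _) => // -[] /eqP; rewrite eq_sym oner_eq0.
Qed.

Lemma prob_num_deg k (b : pred nat) :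
  P [set w | b (num_deg (N w) (G w) k)] =
  (\int[P]_w ((b (num_deg (N w) (G w) k))%:R)%:E)%E.
Proof.
rewrite -[X in P X](setIT) -integral_indic//; last exact: measurable_num_degP.
apply: eq_integral => w _; rewrite indicE; congr ((nat_of_bool _)%:R)%:E.
by apply/idP/idP; rewrite inE.
Qed.

Lemma integral_Dlt k : (\int[P]_w (Dlt R N G k w)%:E =
  \sum_(i < k) \int[P]_w (D R N G i w)%:E)%E.
Proof.
rewrite -ge0_integral_sum//.
- apply: eq_integral => w _; rewrite sumEFin /Dlt /num_deg_lt natr_sum.
  by [].
- by move=> i; exact: (measurable_num_deg mN G_graph i (fun m => m%:R)).
- by move=> i w _; rewrite lee_fin.
Qed.

(** A positive count is at least 1, so Markov's inequality gives the same bound for every [del]. *)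
Lemma prob_Dlt_le k del : 0 < del ->
  (P [set w | (del < `|Dlt R N G k w - 0|)%R] <= \sum_(i < k) \int[P]_w (D R N G i w)%:E)%E.
Proof.
move=> del0; rewrite -integral_Dlt.
have mD : measurable_fun setT (fun w => (Dlt R N G k w)%:E).
  rewrite (_ : (fun w => _) = (fun w => \sum_(i < k) (D R N G i w)%:E)%E); last first.
    by apply/funext => w; rewrite sumEFin /Dlt /num_deg_lt natr_sum.
  apply: emeasurable_sum => i.
  exact: (measurable_num_deg mN G_graph i (fun m => m%:R)).
have mS : measurable [set w | (del < `|Dlt R N G k w - 0|)%R].
  rewrite (_ : [set w | _] = setT `&` (fun w => (Dlt R N G k w)%:E) @^-1` `]del%:E, +oo[%classic).
    exact: (mD measurableT _ (emeasurable_itv _)).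
  rewrite setTI; apply/seteqP; split => w /=;
    by rewrite in_itv/= andbT lte_fin subr0 ger0_norm.
rewrite -[X in (P X <= _)%E](setIT) -integral_indic//.
apply: ge0_le_integral => //.
  by apply/measurable_EFinP; exact: measurable_indic.
move=> w _; rewrite indicE lee_fin.
case: (boolP (w \in _)) => //; rewrite inE/= subr0 => h.
have : (0 : R) < Dlt R N G k w by rewrite -[ltRHS]ger0_norm// (lt_trans del0).
by rewrite /Dlt ltr0n ler1n.
Qed.

End graph_counts.

Section count_links.
Context dO d (Omega : measurableType dO) (T : measurableType d) (R : realType).
Variables (P : probability Omega R) (mu : probability T R).
Variables (X : nat -> {RV P >-> T}) (phi : T -> T -> R) (G : Omega -> rel nat).
Hypothesis X_iid : iid_with_law mu X.
Hypothesis cf : connection_function phi.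

Lemma measurable_RV_fiber (N : {RV P >-> nat}) n : measurable (N @^-1` [set n]).
Proof. exact: measurable_funPTI. Qed.

Lemma measurable_cst_fiber (m n : nat) : measurable ((fun=> m : nat) @^-1` [set n] : set Omega).
Proof. by rewrite preimage_cst; case: ifP => _; [exact: measurableT|exact: measurable0]. Qed.

Lemma integral_num_deg_poisson s (N : {RV P >-> nat}) k (h : nat -> R) : 0 < s ->
  poisson_distributed s N -> independent_of_seq N X ->
  random_connection_graph X N phi G -> (forall m, 0 <= h m) ->
  (\int[P]_w (h (num_deg (N w) (G w) k))%:E)%E = Pmean mu phi s k h.
Proof.
move=> s0 Np Ni Gg h0.
rewrite (integral_num_deg X_iid cf (measurable_RV_fiber N) Ni Gg)//.
by rewrite /Pmean /pmean; apply: eq_eseriesr => n _; rewrite Np.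
Qed.

Lemma integral_num_deg_binomial n k (h : nat -> R) :
  random_connection_graph X (fun=> n) phi G -> (forall m, 0 <= h m) ->
  (\int[P]_w (h (num_deg n (G w) k))%:E)%E = (Gmean mu phi n k h)%:E.
Proof.
move=> Gg h0.
have Ni m B : sigma_gen X setT B -> P ((fun=> n) @^-1` [set m] `&` B) =
    (P ((fun=> n) @^-1` [set m]) * P B)%E.
  move=> _; rewrite preimage_cst; case: ifP => _.
    by rewrite setTI probability_setT mul1e.
  by rewrite set0I measure0 mul0e.
have := integral_num_deg_fiber X_iid cf (measurable_cst_fiber n) Ni Gg n k h0.
rewrite preimage_cst mem_set//= => ->.
by rewrite probability_setT mul1e.
Qed.

End count_links.

Section count_limits.
Context dO (Omega : measurableType dO) (R : realType) (P : probability Omega R).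

(** Both distribution functions depend on [r] only through its integer part, so integer thresholds
    give convergence at every [r]. *)
Lemma cvg_poisson_law (Y : R -> Omega -> R) (Z : R -> Omega -> nat) alpha :
  0 < alpha -> (forall s w, Y s w = (Z s w)%:R) ->
  (forall m del, 0 < del -> \forall s \near +oo,
    exists2 v, P [set w | (Z s w <= m)%N] = v%:E & `|v - pcdf alpha m| <= del) ->
  cvg_in_distribution P Y (poisson_law alpha).
Proof.
move=> a0 YZ H r _; rewrite poisson_law_itv//.
have [r0|r0] := ltP r 0.
  rewrite (_ : (fun s => _) = fun=> 0%E); first exact: cvg_cst.
  apply/funext => s; rewrite (_ : [set w | _] = set0) ?measure0//.
  apply/seteqP; split => // w /=; rewrite YZ => h.
  by have := le_lt_trans h r0; rewrite ltrn0.
apply: cvg_EFin_near => del del0.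
apply: filterS (H (Num.truncn r) del del0) => s [v vE vd]; exists v => //.
rewrite -vE; congr (P _); apply/seteqP; split => w /=; by rewrite YZ truncn_ge_nat.
Qed.

Lemma near_Phi_close (t del : R) : 0 < del ->
  {for t, continuous (fun t : R => normal_prob 0 1 `]-oo, t]%classic : \bar R)} ->
  exists2 e, 0 < e <= del & forall x, `|x - t| <= e -> `|Phi x - Phi t| <= del.
Proof.
move=> del0 ct.
have cP : Phi x @[x --> t] --> Phi t.
  apply: fine_cvg; rewrite /Phi fineK; first exact: ct.
  exact: fin_num_measure.
have : \forall x \near t, `|Phi t - Phi x| <= del.
  by move/cvgrPdist_le : cP; apply.
move=> /nbhs_ballP[e /= e0 he].
(* The witness serves in [poisson_clt] both as the shift of [t] and as the error, hence the cap by
   [del]. *)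
exists (Num.min (e / 2) del).
  by rewrite lt_min del0 divr_gt0//= ge_min lexx orbT.
move=> x xt; rewrite distrC; apply: he; rewrite /ball/= distrC.
by apply: le_lt_trans xt _; rewrite gt_min; apply/orP; left; rewrite ltr_pdivrMr// ltr_pMr// ltr1n.
Qed.

(** The third hypothesis is uniform in [m] because the threshold, the integer part of
    [l s + t * Num.sqrt (l s)], moves with [s]. The three errors are the comparison with the Poisson
    law, the limit theorem and the modulus of continuity of [Phi] at [t]. *)
Lemma cvg_normal_prob (Y : R -> Omega -> R) (Z : R -> Omega -> nat) (l : R -> R) :
  (forall s w, Y s w = (Z s w)%:R) ->
  (forall M, \forall s \near +oo, M <= l s) ->
  (forall del, 0 < del -> \forall s \near +oo, forall m,
    exists2 v, P [set w | (Z s w <= m)%N] = v%:E & `|v - pcdf (l s) m| <= del) ->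
  cvg_in_distribution P (fun s w => (Y s w - l s) / Num.sqrt (l s)) (normal_prob 0 1).
Proof.
move=> YZ lM H t ct.
suff : P [set w | (Y s w - l s) / Num.sqrt (l s) <= t] @[s --> +oo] --> (Phi t)%:E.
  by rewrite /Phi fineK//; exact: fin_num_measure.
apply: cvg_EFin_near => del del0.
have del30 : 0 < del / 3 by rewrite divr_gt0.
have [e /andP[e0 ed] he] := near_Phi_close del30 ct.
have [L hL] := poisson_clt t e0.
near=> s.
have Ll : L <= l s by near: s; exact: lM.
have l1 : 1 <= l s by near: s; exact: lM.
have lt : t ^+ 2 <= l s by near: s; exact: lM.
set m := Num.truncn (l s + t * Num.sqrt (l s)).
have [v vE vd] : exists2 v, P [set w | (Z s w <= m)%N] = v%:E &
    `|v - pcdf (l s) m| <= del / 3.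
  by move: (m); near: s; apply: H.
have l0 : 0 <= l s by lra.
have sq0 : 0 < Num.sqrt (l s) by rewrite sqrtr_gt0; lra.
have a0 : 0 <= l s + t * Num.sqrt (l s).
  have h : `|t| <= Num.sqrt (l s) by rewrite -sqrtr_sqr ler_wsqrtr.
  have : - Num.sqrt (l s) <= t by move: h; rewrite ler_norml => /andP[].
  by move=> h2; rewrite -{1}(sqr_sqrtr l0); nra.
exists v.
  rewrite -vE; congr (P _); apply/seteqP; split => w /=;
    by rewrite YZ ler_pdivrMr// lerBlDl /m truncn_ge_nat.
have /andP[h1 h2] := hL _ Ll; rewrite -/m in h1 h2.
have k1 := he (t - e); have k2 := he (t + e).
have {}k1 : `|Phi (t - e) - Phi t| <= del / 3 by apply: k1; rewrite addrC addKr normrN ger0_norm// ltW.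
have {}k2 : `|Phi (t + e) - Phi t| <= del / 3 by apply: k2; rewrite addrC addKr ger0_norm// ltW.
move: k1 k2 vd; rewrite !ler_norml => /andP[k1 _] /andP[_ k2] /andP[v1 v2].
by apply/andP; split; lra.
Unshelve. all: by end_near. Qed.

End count_limits.

Section Phi_class_bounds.
Context d (T : measurableType d) (R : realType).
Variables (mu : probability T R) (phi : T -> T -> R).
Hypothesis cf : connection_function phi.
Local Notation p := (mean_connection mu phi).

Lemma mean_connection_le_sup x : p x <= sup (range p).
Proof.
apply: ub_le_sup; last by exists x.
by exists 1 => _ [y _ <-]; exact: mean_connection_le1.
Qed.

Lemma inf_le_mean_connection x : inf (range p) <= p x.
Proof.
apply: ge_inf; last by exists x.
by exists 0 => _ [y _ <-]; exact: mean_connection_ge0.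
Qed.

Lemma inf_mean_connection_ge0 : 0 <= inf (range p).
Proof.
have [x0 _] := probability_inhabited mu.
apply: lb_le_inf; first by exists (p x0), x0.
by move=> _ [y _ <-]; exact: mean_connection_ge0.
Qed.

Lemma connection_le_sup x y : phi x y <= connection_sup phi.
Proof.
apply: ub_le_sup; last by exists (x, y).
by exists 1 => _ [z _ <-]; have /andP[] := connection_itv cf z.1 z.2.
Qed.

End Phi_class_bounds.

Lemma Theta_ln_powz (R : realType) (f : R -> R) (j k : nat) (a b : R) :
  0 < a -> 0 < b ->
  (\forall s \near +oo, a * ln s ^+ k <= f s * ln s ^+ j <= b * ln s ^+ k) ->
  (f : R -> R) \is 'Theta_(+oo) (fun s : R => ln s ^ (k%:Z - j%:Z)).
Proof.
move=> a0 b0 H; rewrite qualifE; apply/asboolP; exists (a, b); first by rewrite /= a0 b0.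
near=> s.
have l1 : 1 <= ln s by near: s; apply: near_ln_ge.
have l0 : 0 < ln s by lra.
have /andP[h1 h2] : a * ln s ^+ k <= f s * ln s ^+ j <= b * ln s ^+ k by near: s.
have lj0 := exprn_gt0 j l0; have lk0 := exprn_gt0 k l0.
have f0 : 0 < f s.
  by rewrite -(pmulr_lgt0 _ lj0); apply: lt_le_trans h1; rewrite mulr_gt0.
have -> : ln s ^ (k%:Z - j%:Z) = ln s ^+ k / ln s ^+ j.
  by rewrite expfzDr ?gt_eqF// -exprnN.
have g0 : 0 < ln s ^+ k / ln s ^+ j by rewrite divr_gt0.
rewrite /= (ger0_norm (ltW f0)) (ger0_norm (ltW g0)) !mulrA.
by rewrite ler_pdivrMr// ler_pdivlMr.
Unshelve. all: by end_near. Qed.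

Lemma sum_ord_le (R : realType) (j : nat) (F : 'I_j -> R) (e : R) : 0 < e ->
  (forall i, F i <= e / j.+1%:R) -> \sum_(i < j) F i <= e.
Proof.
move=> e0 H; apply: (@le_trans _ _ (\sum_(i < j) e / j.+1%:R)); first exact: ler_sum.
rewrite sumr_const card_ord -[leLHS]mulr_natr -mulrA.
apply: ler_piMr; first exact: ltW.
by rewrite mulrC ler_pdivrMr// mul1r ler_nat ltnW.
Qed.

Lemma near_ord (R : realType) (j : nat) (Q : 'I_j -> R -> Prop) :
  (forall i, \forall s \near +oo, Q i s) -> \forall s \near +oo, forall i, Q i s.
Proof. by move=> H; apply: filter_forall. Qed.

Lemma ereal_small (R : realType) (x : \bar R) (e : R) : (0 <= x)%E -> (x <= e%:E)%E ->
  exists2 v, x = v%:E & `|v - 0| <= e.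
Proof.
case: x => [v||] //; rewrite !lee_fin => v0 ve.
by exists v; rewrite // subr0 ger0_norm.
Qed.

Theorem theorem2p1 (R : realType)
  (d : measure_display) (T : measurableType d) (mu : probability T R)
  (dO : measure_display) (Omega : measurableType dO) (P : probability Omega R)
  (X : nat -> {RV P >-> T}) (N : R -> {RV P >-> nat})
  (phi : R -> T -> T -> R)
  (GP : R -> Omega -> rel nat) (GB : nat -> Omega -> rel nat)
  (j k : nat) (eps alpha : R)
  (X_iid : iid_with_law mu X)
  (N_poisson : forall s : R, 0 < s -> poisson_distributed s (N s))
  (N_indep : forall s : R, 0 < s -> independent_of_seq (N s) X)
  (GP_graph : forall s : R, 0 < s ->
     random_connection_graph X (N s) (phi s) (GP s))
  (GB_graph : forall n : nat, (0 < n)%N ->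
     random_connection_graph X (fun=> n) (phi n%:R) (GB n))
  (eps_gt0 : 0 < eps)
  (phi_class : forall s : R, 0 < s -> Phi_class mu eps (phi s))
  (phi_sup : forall s : R, 0 < s -> connection_sup (phi s) <= 1 - eps)
  (alpha_gt0 : 0 < alpha)
  (mean_cvg :
     ('E_P[Dlt R (N s) (GP s) j.+1])%E @[s --> +oo] --> alpha%:E) :
  let DP s i := D R (N s) (GP s) i in
  let EDP s i : R := fine 'E_P[DP s i]%E in
  let DB s i := D R (fun=> Num.truncn s) (GB (Num.truncn s)) i in
  [/\ cvg_in_distribution P (DP ^~ j) (poisson_law alpha),
      cvg_in_distribution P (DB ^~ j) (poisson_law alpha),
      cvg_in_probability P (fun s => Dlt R (N s) (GP s) j) 0,
      cvg_in_probability P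
        (fun s => Dlt R (fun=> Num.truncn s) (GB (Num.truncn s)) j) 0 &
      ((EDP ^~ k : R -> R) \is 'Theta_(+oo) (fun s : R => ln s ^ (k%:Z - j%:Z))) /\
      ((j < k)%N -> cvg_in_distribution P
         (fun s w => (DP s k w - EDP s k) / Num.sqrt (EDP s k))
         (normal_prob 0 1))].
Proof.
move=> DP EDP DB.
pose p s := mean_connection mu (phi s).
pose pm s := inf (range (p s)); pose PM s := sup (range (p s)).
have cf s (s0 : 0 < s) : connection_function (phi s) := (phi_class _ s0).1.
have PMpm s (s0 : 0 < s) : eps * PM s <= pm s := (phi_class _ s0).2.
have pm0 s (s0 : 0 < s) : 0 <= pm s by exact: inf_mean_connection_ge0 (cf _ s0).
have pmp s (s0 : 0 < s) x : pm s <= p s x by exact: inf_le_mean_connection (cf _ s0) x.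
have pPM s (s0 : 0 < s) x : p s x <= PM s by exact: mean_connection_le_sup (cf _ s0) x.
have phie s (s0 : 0 < s) x y : phi s x y <= 1 - eps.
  exact: le_trans (connection_le_sup (cf _ s0) x y) (phi_sup _ s0).
have PmeanP s k' h (s0 : 0 < s) (h0 : forall m, 0 <= h m) :
    (\int[P]_w (h (num_deg (N s w) (GP s w) k'))%:E)%E = Pmean mu (phi s) s k' h.
  exact: (integral_num_deg_poisson X_iid (cf _ s0) k' s0 (N_poisson _ s0) (N_indep _ s0) (GP_graph _ s0) h0).
have GmeanP n k' h (n0 : (0 < n)%N) (h0 : forall m, 0 <= h m) :
    (\int[P]_w (h (num_deg n (GB n w) k'))%:E)%E = (Gmean mu (phi n%:R) n k' h)%:E.
  apply: (integral_num_deg_binomial X_iid _ k' (GB_graph _ n0) h0).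
  by apply: cf; rewrite ltr0n.
have EDPE s k' : 0 < s -> (\int[P]_w (DP s k' w)%:E)%E = (lam mu (phi s) s k')%:E.
  by move=> s0; rewrite -(Pmean_id _ (cf _ s0) s0); apply: PmeanP.
have EDPfine s k' : 0 < s -> EDP s k' = lam mu (phi s) s k'.
  by move=> s0; rewrite /EDP unlock EDPE.
have near0 : \forall s \near (+oo : set_system R), 0 < s.
  by apply: nbhs_pinfty_gt; rewrite num_real.
(* For [s > 0] the extended-real mean is the finite sum of the [lam], so the limit passes to the
   reals. *)
have sum_cvg : (\sum_(i < j.+1) lam mu (phi s) s i) @[s --> +oo] --> alpha.
  have /fine_cvg := mean_cvg; apply: cvg_trans; apply: near_eq_cvg.
  apply: filterS near0 => s s0 /=; rewrite unlock.
  rewrite (integral_Dlt (measurable_RV_fiber (N s)) (GP_graph _ s0)).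
  rewrite (eq_bigr (fun i : 'I_j.+1 => (lam mu (phi s) s i)%:E)); last first.
    by move=> i _; exact: EDPE.
  by rewrite sumEFin.
have prob01 (b : bool) : 0 <= b%:R :> R by case: b.
have lcvg := Pmean_cdf_cvg eps_gt0 alpha_gt0 cf pm0 pmp pPM PMpm sum_cvg phie.
split.
- apply: (@cvg_poisson_law _ _ _ _ _ (fun s w => num_deg (N s w) (GP s w) j)) => // m del del0.
  near=> s.
  have s0 : 0 < s by near: s.
  have [v vE vd] : exists2 v, Pmean mu (phi s) s j (fun i => (i <= m)%N%:R) = v%:E &
    `|v - pcdf alpha m| <= del by near: s; exact: lcvg.
  exists v => //; rewrite -vE -PmeanP//.
  exact: (prob_num_deg (measurable_RV_fiber (N s)) (GP_graph _ s0) j (fun i => (i <= m)%N)).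
- apply: (@cvg_poisson_law _ _ _ _ _ (fun s w => num_deg (Num.truncn s) (GB (Num.truncn s) w) j)) => // m del del0.
  near=> s.
  have n0 : (0 < Num.truncn s)%N.
    by rewrite truncn_gt0; near: s; apply: nbhs_pinfty_ge; rewrite num_real.
  exists (Gmean mu (phi (Num.truncn s)%:R) (Num.truncn s) j (fun i => (i <= m)%N%:R)).
    rewrite -GmeanP//.
    exact: (prob_num_deg (measurable_cst_fiber Omega (Num.truncn s)) (GB_graph _ n0) j (fun i => (i <= m)%N)).
  near: s.
  (* The estimate concerns large reals that are integers; [near_truncn] brings it to the integer
     part of [s]. *)
  have := Gmean_cdf_cvg eps_gt0 alpha_gt0 cf pm0 pmp pPM PMpm sum_cvg phie m del0.
  by move/near_truncn; apply: filterS => s; apply.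
- move=> del del0; apply: cvg_EFin_near => e e0.
  near=> s.
  have s0 : 0 < s by near: s.
  have h := prob_Dlt_le (measurable_RV_fiber (N s)) (GP_graph _ s0) j del0.
  have {}h : (P [set w | (del < `|Dlt R (N s) (GP s) j w - 0|)%R] <= e%:E)%E.
    apply: (le_trans h).
    rewrite (eq_bigr (fun i : 'I_j => (lam mu (phi s) s i)%:E)); last first.
      by move=> i _; exact: EDPE.
    rewrite sumEFin lee_fin; apply: sum_ord_le => //.
    near: s; apply: near_ord => i.
    apply: (lam_small eps_gt0 alpha_gt0 cf pm0 pmp pPM PMpm sum_cvg) => //.
    by rewrite divr_gt0.
  exact: ereal_small.
(* As for the Poisson graph, with the binomial means bounded directly by [Gmean_id_small]. *)
- move=> del del0; apply: cvg_EFin_near => e e0.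
  near=> s.
  have n0 : (0 < Num.truncn s)%N.
    by rewrite truncn_gt0; near: s; apply: nbhs_pinfty_ge; rewrite num_real.
  have n0R : 0 < (Num.truncn s)%:R :> R by rewrite ltr0n.
  have h := prob_Dlt_le (measurable_cst_fiber Omega (Num.truncn s)) (GB_graph _ n0) j del0.
  have {}h : (P [set w | (del < `|Dlt R (fun=> Num.truncn s) (GB (Num.truncn s)) j w - 0|)%R] <= e%:E)%E.
    apply: (le_trans h).
    rewrite (eq_bigr (fun i : 'I_j =>
      (Gmean mu (phi (Num.truncn s)%:R) (Num.truncn s) i (fun m => m%:R))%:E)); last first.
      by move=> i _; exact: GmeanP.
    rewrite sumEFin lee_fin; apply: sum_ord_le => //.
    near: s; apply: near_ord => i.
    have ej : 0 < e / j.+1%:R by rewrite divr_gt0.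
    have := Gmean_id_small eps_gt0 alpha_gt0 cf pm0 pmp pPM PMpm sum_cvg (ltn_ord i) ej.
    by move/near_truncn; apply: filterS => s; apply.
  exact: ereal_small.
have [a [b [a0 b0 Hk]]] := lam_bounds eps_gt0 alpha_gt0 cf pm0 pmp pPM PMpm sum_cvg k.
split.
  apply: (Theta_ln_powz a0 b0); near=> s.
  by rewrite EDPfine; near: s.
move=> jk.
have := @cvg_normal_prob _ _ _ P (DP ^~ k) (fun s w => num_deg (N s w) (GP s w) k) (EDP ^~ k).
apply => //.
  move=> M; near=> s; rewrite EDPfine; last by near: s.
  by near: s; apply: (lam_large eps_gt0 alpha_gt0 cf pm0 pmp pPM PMpm sum_cvg).
move=> del del0; near=> s => m.
have s0 : 0 < s by near: s.
have [v vE vd] : exists2 v, Pmean mu (phi s) s k (fun i => (i <= m)%N%:R) = v%:E &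
    `|v - pcdf (lam mu (phi s) s k) m| <= del.
  move: (m); near: s.
  exact: (Pmean_cdf_pcdf eps_gt0 alpha_gt0 cf pm0 pmp pPM PMpm sum_cvg phie).
exists v; last by rewrite EDPfine.
rewrite -vE -PmeanP//.
exact: (prob_num_deg (measurable_RV_fiber (N s)) (GP_graph _ s0) k (fun i => (i <= m)%N)).
Unshelve. all: by end_near. Qed.
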